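(* Let $X$ be a separable Banach lattice. The following conditions are equivalent: (1) for every Banach lattice $Y$, $X$ is linearly embeddable into $Y$ if and only if $X$ is lattice embeddable into $Y$; (2) $X$ is lattice embeddable into $C[0,1]$.
   Context: Banach lattices are real. An operator is a bounded linear map. $C[0,1]$ is the Banach lattice of continuous real-valued functions on $[0,1]$ with the supremum norm and pointwise order. An operator $T\colon X\to Y$ between Banach lattices is a lattice homomorphism if $T(x\vee y)=Tx\vee Ty$ and $T(x\wedge y)=Tx\wedge Ty$ for all $x,y\in X$. A Banach space $X$ is linearly embeddable into a Banach space $Y$ if there is an operator $T\colon X\to Y$ which is a (linear, not necessarily isometric) isomorphism onto its range. If $X$ and $Y$ are Banach lattices and such a $T$ can be chosen to be also a lattice homomorphism, then $X$ is said to be lattice embeddable into $Y$. *)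

(* Defs.v *)
From HB Require Import structures.
From mathcomp Require Import all_boot all_order all_algebra.
From mathcomp Require Import ring.
From mathcomp Require Import boolp classical_sets functions cardinality reals topology normedtype.

Set Implicit Arguments.
Unset Strict Implicit.
Unset Printing Implicit Defensive.

Import Order.TTheory GRing.Theory Num.Theory.
Import numFieldNormedType.Exports.

Local Open Scope classical_set_scope.
Local Open Scope ring_scope.

(* The order is not an [Order.Lattice] of the library because
   Hierarchy-Builder accepts no join of [GRing.Zmodule] and [Order.Lattice]
   besides those leading to [Num.RealDomain], which are totally ordered.
   In [lle_norm], [ljoin x (- x)] is the modulus of [x]. *)
HB.mixin Record isBanachLattice (R : realType) E & CompleteNormedModule R E := {
  lle : rel E;
  lmeet : E -> E -> E;
  ljoin : E -> E -> E;
  lle_refl : reflexive lle;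
  lle_anti : antisymmetric lle;
  lle_trans : transitive lle;
  lmeetP : forall x y z, lle x (lmeet y z) = lle x y && lle x z;
  ljoinP : forall x y z, lle (ljoin x y) z = lle x z && lle y z;
  lleD2r : forall z x y, lle x y -> lle (x + z) (y + z);
  lle_scaler_ge0 : forall (a : R) x, 0 <= a -> lle 0 x -> lle 0 (a *: x);
  lle_norm : forall x y,
    lle (ljoin x (- x)) (ljoin y (- y)) -> `|x| <= `|y| :> R
}.

#[short(type="banachLatticeType")]
HB.structure Definition BanachLattice (R : realType) :=
  {E of CompleteNormedModule R E & isBanachLattice R E}.

Definition separable_space (T : topologicalType) :=
  exists D : set T, countable D /\ dense D.

Section embeddings.
Context {R : realType}.

Definition bounded_operator (X Y : normedModType R) (T : {linear X -> Y}) :=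
  exists M : R, forall x, `|T x| <= M * `|x|.

(* [S] is only constrained on the range of [T], where it is the inverse. *)
Definition isomorphism_onto_range (X Y : normedModType R)
    (T : {linear X -> Y}) :=
  exists S : Y -> X, cancel T S /\
    exists M : R, forall y, range T y -> `|S y| <= M * `|y|.

Definition lattice_homomorphism (X Y : banachLatticeType R) (T : X -> Y) :=
  (forall x y, T (ljoin x y) = ljoin (T x) (T y)) /\
  (forall x y, T (lmeet x y) = lmeet (T x) (T y)).

Definition linearly_embeddable (X Y : completeNormedModType R) :=
  exists T : {linear X -> Y}, bounded_operator T /\ isomorphism_onto_range T.

Definition lattice_embeddable (X Y : banachLatticeType R) :=
  exists T : {linear X -> Y},
    [/\ bounded_operator T, isomorphism_onto_range T
      & lattice_homomorphism T].

End embeddings.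

Definition unit_interval (R : realType) : set R := `[0, 1].
Arguments unit_interval : clear implicits.

Definition C01 (R : realType) : Type :=
  continuousType (set_type (unit_interval R)) R.

(* The topology of [C01 R] is the one of the supremum norm: none of the
   topologies of [function_spaces] is inherited from [continuousType]. *)
Section C01.
Context {R : realType}.
Local Notation I := (set_type (unit_interval R)).
Implicit Types f g h : C01 R.

HB.instance Definition _ := Choice.copy (C01 R) (continuousType I R).

Definition C01_fun f : I -> R := f.
Coercion C01_fun : C01 >-> Funclass.

Let C01P f g : (forall t, f t = g t) -> f = g.
Proof. by move=> fg; apply/continuousEP. Qed.

Let cts f : continuous (f : I -> R).
Proof. exact: (@cts_fun _ _ (f : continuousType I R)). Qed.

Let add_cts f g : continuous (fun t : I => f t + g t).
Proof. by move=> t; exact: (cvgD (@cts f t) (@cts g t)). Qed.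
Let opp_cts f : continuous (fun t : I => - f t).
Proof. by move=> t; exact: (cvgN (@cts f t)). Qed.
Let scale_cts (a : R) f : continuous (fun t : I => a * f t).
Proof. by move=> t; exact: (cvgM (cvg_cst a) (@cts f t)). Qed.
Let max_cts f g : continuous (fun t : I => Num.max (f t) (g t)).
Proof. by move=> t; exact: (continuous_max (@cts f t) (@cts g t)). Qed.
Let min_cts f g : continuous (fun t : I => Num.min (f t) (g t)).
Proof. by move=> t; exact: (continuous_min (@cts f t) (@cts g t)). Qed.
Let cst_cts (a : R) : continuous (fun t : I => a).
Proof. exact: cst_continuous. Qed.

Definition C01_add f g : C01 R :=
  (mkcts (@add_cts f g) : continuousType I R).
Definition C01_opp f : C01 R :=
  (mkcts (@opp_cts f) : continuousType I R).
Definition C01_zero : C01 R :=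
  (mkcts (@cst_cts 0) : continuousType I R).
Definition C01_scale (a : R) f : C01 R :=
  (mkcts (@scale_cts a f) : continuousType I R).
Definition C01_join f g : C01 R :=
  (mkcts (@max_cts f g) : continuousType I R).
Definition C01_meet f g : C01 R :=
  (mkcts (@min_cts f g) : continuousType I R).
Definition C01_le f g : bool := `[< forall t, f t <= g t >].
Definition C01_norm f : R := sup (range (fun t => `|f t|)).

Let addA : associative C01_add.
Proof. by move=> f g h; apply: C01P => t; apply: addrA. Qed.
Let addC : commutative C01_add.
Proof. by move=> f g; apply: C01P => t; apply: addrC. Qed.
Let add0 : left_id C01_zero C01_add.
Proof. by move=> f; apply: C01P => t; apply: add0r. Qed.
Let addN : left_inverse C01_zero C01_opp C01_add.
Proof. by move=> f; apply: C01P => t; apply: addNr. Qed.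

HB.instance Definition _ := GRing.isZmodule.Build (C01 R) addA addC add0 addN.

Let scaleA a b f : C01_scale a (C01_scale b f) = C01_scale (a * b) f.
Proof. by apply: C01P => t; apply: mulrA. Qed.
Let scale1 : left_id 1 C01_scale.
Proof. by move=> f; apply: C01P => t; apply: mul1r. Qed.
Let scaleDr : right_distributive C01_scale +%R.
Proof. by move=> a f g; apply: C01P => t; apply: mulrDr. Qed.
Let scaleDl f : {morph C01_scale^~ f : a b / a + b}.
Proof. by move=> a b; apply: C01P => t; apply: mulrDl. Qed.

HB.instance Definition _ :=
  GRing.Zmodule_isLmodule.Build R (C01 R) scaleA scale1 scaleDr scaleDl.

Let I0 : I.
Proof. by exists 0; rewrite inE /unit_interval /= in_itv /= lexx ler01. Defined.

Let hasub f : has_sup (range (fun t => `|f t|)).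
Proof.
split; first by exists `|f I0|, I0.
have cf : {within unit_interval R, continuous (valL (f : I -> R))}.
  by apply/subspace_valL_continuousP; apply: cts.
have := continuous_compact cf (@segment_compact R 0 1).
move=> /compact_bounded [M [_ HM]]; exists (M + 1) => _ [t _ <-].
apply: HM; first by rewrite ltrDl.
exists (val t); first by apply: set_mem; exact: valP.
have -> : valL (f : I -> R) (val t) = sigL (unit_interval R) (valL (f : I -> R)) t by [].
by rewrite valLK.
Qed.

Lemma C01_norm_ge f t : `|f t| <= C01_norm f.
Proof. by apply: ub_le_sup; [case: (hasub f) | exists t]. Qed.

Lemma C01_norm_le f c : (forall t, `|f t| <= c) -> C01_norm f <= c.
Proof.
by move=> fc; apply: ge_sup; [case: (hasub f) | move=> _ [t _ <-]].
Qed.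

Let normD f g : C01_norm (f + g) <= C01_norm f + C01_norm g.
Proof.
apply: C01_norm_le => t; apply: le_trans (ler_normD (f t) (g t)) _.
by apply: lerD; exact: C01_norm_ge.
Qed.

Let normZ a f : C01_norm (a *: f) = `|a| * C01_norm f.
Proof.
have le b h : C01_norm (b *: h) <= `|b| * C01_norm h.
  apply: C01_norm_le => t; rewrite (normrM b (h t)).
  by apply: ler_wpM2l => //; exact: C01_norm_ge.
apply/eqP; rewrite eq_le le /=.
have [->|a0] := eqVneq a 0.
  by rewrite normr0 mul0r (le_trans _ (C01_norm_ge _ I0)).
rewrite -ler_pdivlMl ?normr_gt0// -normfV.
by rewrite -[X in C01_norm X <= _](scalerK a0) le.
Qed.

Let norm0 f : C01_norm f = 0 -> f = 0.
Proof.
move=> f0; apply: C01P => t; apply/eqP.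
by rewrite -normr_le0 -f0 C01_norm_ge.
Qed.

HB.instance Definition _ :=
  Lmodule_isNormed.Build R (C01 R) normD normZ norm0.

Let complete (F : set_system (C01 R)) : ProperFilter F -> cauchy F -> cvg F.
Proof.
move=> FF Fc.
have dist e : 0 < e -> exists f, \forall g \near F, C01_norm (f - g) < e.
  move=> e0; have [f Ff] : exists f, F (ball f e) by apply: (cauchyP F).1.
  by exists f; move: Ff; rewrite -ball_normE.
have ptcvg (t : I) : exists l : R, (fun f : C01 R => f t) @ F --> l.
  exists (lim ((fun f : C01 R => f t) @ F)).
  apply: cauchy_cvg; apply: cauchy_exP => e /dist[f Ff]; exists (f t).
  apply: filterS Ff => g /=; rewrite -ball_normE/=.
  exact/le_lt_trans/(C01_norm_ge (f - g) t).
have [u Fu] := choice ptcvg.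
have fu f e t : (\forall g \near F, C01_norm (f - g) < e) -> `|f t - u t| <= e.
  move=> Ff; apply/ler_addgt0Pr => d d0; near F => g.
  rewrite (le_trans (ler_distD (g t) _ _))// lerD//.
    rewrite (le_trans (C01_norm_ge (f - g) t))// ltW//.
    by near: g.
  by rewrite distrC; near: g; have /cvgrPdist_le := Fu t; apply.
have uc : continuous u.
  move=> t; have nF : Filter (nbhs (t : I)) by exact: nbhs_filter.
  apply/(@cvgrPdist_le _ _ _ (nbhs (t : I)) nF) => e e0.
  have e3 : 0 < e / 3 by rewrite divr_gt0.
  have [f Ff] := dist _ e3; near=> s.
  have -> : u t - u s = (u t - f t) + (f t - f s) + (f s - u s) by ring.
  have -> : e = e / 3 + e / 3 + e / 3 by field.
  rewrite (le_trans (ler_normD _ _))// lerD ?fu//.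
  rewrite (le_trans (ler_normD _ _))// lerD ?(distrC (u t)) ?fu//.
  by near: s; exact: ((@cvgrPdist_le _ _ _ (nbhs (t : I)) nF _ _).1 (@cts f t)).
apply/cvg_ex; exists (mkcts uc : continuousType I R).
apply/cvgrPdist_le => e e0.
have e2 : 0 < e / 2 by rewrite divr_gt0.
have [f Ff] := dist _ e2; near=> g.
apply: C01_norm_le => t; rewrite [e]splitr.
apply: le_trans (ler_distD (f t) (u t) (g t)) _.
rewrite lerD//; first by rewrite distrC fu.
rewrite (le_trans (C01_norm_ge (f - g) t))// ltW//.
by near: g.
Unshelve. all: by end_near. Qed.

HB.instance Definition _ := Uniform_isComplete.Build (C01 R) complete.

Let leP f g : reflect (forall t, f t <= g t) (C01_le f g).
Proof. exact: asboolP. Qed.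

Let lereflC : reflexive C01_le.
Proof. by move=> f; apply/leP. Qed.
Let leantiC : antisymmetric C01_le.
Proof.
move=> f g /andP[/leP fg /leP gf]; apply: C01P => t.
by apply/le_anti; rewrite fg gf.
Qed.
Let letransC : transitive C01_le.
Proof.
by move=> g f h /leP fg /leP gh; apply/leP => t; apply: le_trans (gh t).
Qed.
Let meetP f g h : C01_le f (C01_meet g h) = C01_le f g && C01_le f h.
Proof.
apply/leP/andP => [H|[/leP fg /leP fh] t]; last first.
  by rewrite [leRHS]/(Num.min (g t) (h t)) le_min fg fh.
by split; apply/leP => t; have := H t;
  rewrite [leRHS]/(Num.min (g t) (h t)) le_min => /andP[].
Qed.
Let joinP f g h : C01_le (C01_join f g) h = C01_le f h && C01_le g h.
Proof.
apply/leP/andP => [H|[/leP fh /leP gh] t]; last first.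
  by rewrite [leLHS]/(Num.max (f t) (g t)) ge_max fh gh.
by split; apply/leP => t; have := H t;
  rewrite [leLHS]/(Num.max (f t) (g t)) ge_max => /andP[].
Qed.
Let leD2r h f g : C01_le f g -> C01_le (f + h) (g + h).
Proof. by move=> /leP fg; apply/leP => t; apply: lerD. Qed.
Let le_scale (a : R) f : 0 <= a -> C01_le 0 f -> C01_le 0 (a *: f).
Proof. by move=> a0 /leP f0; apply/leP => t; apply: mulr_ge0 => //; exact: f0. Qed.
Let le_normC f g :
  C01_le (C01_join f (- f)) (C01_join g (- g)) -> `|f| <= `|g| :> R.
Proof.
move=> /leP fg; apply: C01_norm_le => t; apply: le_trans (C01_norm_ge g t).
by rewrite -[leLHS]maxrN -[leRHS]maxrN; exact: fg.
Qed.

HB.instance Definition _ := isBanachLattice.Build R (C01 R)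
  lereflC leantiC letransC meetP joinP leD2r le_scale le_normC.

End C01.

(* Main.v *)
From HB Require Import structures.
Require Import Defs.
From mathcomp Require Import all_boot all_order all_algebra.
From mathcomp Require Import ring lra.
From mathcomp Require Import boolp classical_sets functions cardinality.
From mathcomp Require Import reals topology normedtype.
From mathcomp Require derive.

(**
  By the Banach-Mazur theorem X is linearly embeddable into Y = C[0,1], so that
  (1) gives (2). A linear embedding into C[0,1] is a path of functionals on X;
  it is a limit of paths which move through finite nets, under the control of
  Schoenberg's functions, so as to come close to any given norming functional.

  Conversely, let X be a sublattice of C[0,1] and T : X -> Y a linear embedding.

  - If the ratio g / e of some elements of X is not constant on some interval
    where e > 0, the functional calculus of (e, g) embeds C[0,1] into X as a
    sublattice. Then C[0,1] embeds linearly into Y, and this suffices for a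
    lattice embedding: consider in Y the images of the hat functions of a dyadic
    tree. Each branch of the tree has a state that is large on its nodes, and by
    Khintchine's inequality a state is large on few branches only. As there are
    uncountably many branches, some |T f| = e can be split by disjoint pieces
    along a full binary tree. Reading binary digits along it gives h with
    0 <= h <= e such that h / e takes all the values in [0, 1], and f(h / e) e
    is the image of f.

  - Otherwise the elements of X are determined by one scalar on each of
    countably many classes of points, which makes X a sublattice of c_0. If X
    contains infinitely many disjoint vectors, the signed sums of their images
    in Y are bounded, and Y contains disjoint positive vectors bounded below in
    norm and with bounded sums, on which the coordinates of X can be placed. If
    it does not, X has a finite basis of disjoint vectors, and Y, having at
    least the same dimension, contains as many disjoint vectors.
*)

Set Implicit Arguments.
Unset Strict Implicit.
Unset Printing Implicit Defensive.
Import Order.TTheory GRing.Theory Num.Theory.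
Import numFieldNormedType.Exports.
Local Open Scope classical_set_scope.
Local Open Scope ring_scope.

(** * Hahn-Banach theorems *)

(** The target [Y] is an arbitrary Banach lattice: pieces of a vector cannot be cut out by band
    projections, and no representation of [Y] by functions is set up. Two devices replace them.
    Lattice (in)equalities are checked on real numbers, because an element that is not negative is
    detected by a real lattice homomorphism of the sublattice at hand. Norms are bounded below by
    states, the cuts are truncations such as [lmeet x (lpos (u - e))], and their cost is measured on
    the states.

    The norm must survive the truncations at all depths of the splitting tree. Hence a piece keeps a
    fixed part of the states of uncountably many branches, and any countable set of bad branches may
    be discarded. Both bounds on the linear copy enter here: the lower one gives each branch its
    state; the upper one, through Khintchine's inequality, lets a state charge only finitely many
    branches above a given threshold.

    The Hahn-Banach theorem and the existence of real homomorphisms come from one minimality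
    argument. *)

Section sublinear.
Context {R : realType} {V : lmodType R} {T : Type}.
(** Functionals live on a type [T] of names evaluated by [ev], because the vectors to be covered
    need not form a type: [T] is [V] itself for the Hahn-Banach theorem and the type of lattice
    terms for real homomorphisms. *)
Variables (add : T -> T -> T) (scale : R -> T -> T) (ev : T -> V).
Variable J : T -> T -> T -> Prop.
Hypothesis evD : forall x y, ev (add x y) = ev x + ev y.
Hypothesis evZ : forall a x, ev (scale a x) = a *: ev x.
Hypothesis JE : forall x z, ev z = ev x -> J x x z.
Hypothesis JD : forall w x y z, J x y z -> J (add x w) (add y w) (add z w).

(* [J x y z] stands for [z <= x \/ y]; it also makes [p] depend on the value
   [ev x] only. *)
Definition sublinear (p : T -> R) :=
  [/\ forall x y, p (add x y) <= p x + p y,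
      forall (a : R) x, 0 <= a -> p (scale a x) = a * p x &
      forall x y z, J x y z -> p z <= Num.max (p x) (p y)].

Let subE p x y : sublinear p -> ev x = ev y -> p x = p y.
Proof.
move=> [_ _ pJ] xy; apply/eqP; rewrite eq_le.
by apply/andP; split; [have := pJ _ _ _ (JE xy)|have := pJ _ _ _ (JE (esym xy))];
  rewrite maxxx.
Qed.

Let sub0 p x : sublinear p -> ev x = 0 -> p x = 0.
Proof.
move=> sp x0; have [_ pZ _] := sp.
by rewrite (subE sp (y := scale 0 x)) ?pZ ?mul0r// evZ x0 scaler0.
Qed.

Let subN p x : sublinear p -> - p (scale (-1) x) <= p x.
Proof.
move=> sp; have [pD _ _] := sp; rewrite lerNl -subr_ge0 opprK.
by rewrite -(@sub0 _ (add (scale (-1) x) x) sp) ?pD// evD evZ scaleN1r addNr.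
Qed.

Let lower p q x : sublinear p -> (forall y, p y <= q y) ->
  - q (scale (-1) x) <= p x.
Proof. by move=> sp pq; rewrite (le_trans _ (subN x sp))// lerN2. Qed.

Section directed_inf.
Variables (I : Type) (i0 : I) (r : I -> T -> R).
Let m x := inf (range (r ^~ x)).
Hypothesis low : forall x, exists b, forall i, b <= r i x.

Let m_le i x : m x <= r i x.
Proof.
apply: ge_inf; last by exists i.
by have [b bx] := low x; exists b => _ [j _ <-].
Qed.

Let m_ge b x : (forall i, b <= r i x) -> b <= m x.
Proof.
by move=> bx; apply: lb_le_inf; [exists (r i0 x), i0 | move=> _ [j _ <-]].
Qed.

Let m_lt (c : R) x : m x < c -> exists i, r i x < c.
Proof.
move=> mc; apply: contrapT => /forallNP H.
by move: mc; rewrite ltNge => /negP; apply; apply: m_ge => i; rewrite leNgt; apply/negP.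
Qed.

Lemma inf_directed x y z :
  (forall i j, exists k,
    (forall x, r k x <= r i x) /\ (forall x, r k x <= r j x)) ->
  (forall i, r i z <= Num.max (r i x) (r i y)) -> m z <= Num.max (m x) (m y).
Proof.
move=> dir rJ; apply/ler_addgt0Pr => e e0.
have [i ix] : exists i, r i x < m x + e by apply: m_lt; rewrite ltrDl.
have [j jy] : exists j, r j y < m y + e by apply: m_lt; rewrite ltrDl.
have [k [ki kj]] := dir i j.
apply: le_trans (m_le k z) _; apply: le_trans (rJ k) _.
rewrite ge_max (le_trans (ki x))/=; last first.
  by rewrite (le_trans (ltW ix))// lerD2r le_max lexx.
by rewrite (le_trans (kj y))// (le_trans (ltW jy))// lerD2r le_max lexx orbT.
Qed.

(** The members of the family need not be sublinear: a sum or a multiple may call for another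
    index. *)
Lemma inf_sublinear :
  (forall x y z, J x y z -> m z <= Num.max (m x) (m y)) ->
  (forall i j x y, exists k, r k (add x y) <= r i x + r j y) ->
  (forall i (a : R) x, 0 < a -> exists k, r k (scale a x) <= a * r i x) ->
  sublinear m.
Proof.
move=> mJ rD rZ.
have mD x y : m (add x y) <= m x + m y.
  apply/ler_addgt0Pr => e e0; have e2 : 0 < e / 2 by rewrite divr_gt0.
  have [i ix] : exists i, r i x < m x + e / 2 by apply: m_lt; rewrite ltrDl.
  have [j jy] : exists j, r j y < m y + e / 2 by apply: m_lt; rewrite ltrDl.
  have [k kxy] := rD i j x y.
  by have := m_le k (add x y); lra.
have mZle (a : R) x : 0 < a -> m (scale a x) <= a * m x.
  move=> a0; rewrite -ler_pdivrMl//; apply: m_ge => i.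
  rewrite ler_pdivrMl//; have [k kx] := rZ i a x a0.
  exact: le_trans (m_le k _) kx.
have mE x y : ev x = ev y -> m x <= m y.
  by move=> xy; have := mJ _ _ _ (JE xy); rewrite maxxx.
split=> //.
move=> a x; rewrite le_eqVlt => /predU1P[<-|a0].
  rewrite mul0r; apply/eqP; rewrite eq_le; apply/andP; split.
    (* Homogeneity is known so far for positive scalars only. As [scale 0 x] has the same evaluation
       as its half and its double, its value is 0. *)
    have h2 : 0 < 2^-1 :> R by rewrite invr_gt0.
    have := mZle _ (scale 0 x) h2.
    have : m (scale 0 x) <= m (scale 2^-1 (scale 0 x)).
      by apply: mE; rewrite !evZ !scale0r scaler0.
    by lra.
  have := mZle 2 (scale 0 x) (ltr0Sn _ _).
  have : m (scale 0 x) <= m (scale 2 (scale 0 x)).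
    by apply: mE; rewrite !evZ !scale0r scaler0.
  by lra.
apply/eqP; rewrite eq_le mZle//=.
rewrite -ler_pdivlMl//; apply: le_trans (mZle _ _ _); last by rewrite invr_gt0.
by apply: mE; rewrite !evZ scalerA mulVf ?scale1r// gt_eqF.
Qed.

End directed_inf.

Let shift p u : sublinear p ->
  let q x := inf (range (fun t : {t : R | 0 <= t} =>
     p (add x (scale (sval t) u)) - sval t * p u)) in
  [/\ sublinear q, forall x, q x <= p x & q (scale (-1) u) <= - p u].
Proof.
move=> sp q; have [pD pZ pJ] := sp.
pose r (t : {t : R | 0 <= t}) x := p (add x (scale (sval t) u)) - sval t * p u.
pose z0 : {t : R | 0 <= t} := exist _ 0 (lexx 0).
pose z1 : {t : R | 0 <= t} := exist _ 1 ler01.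
(* The family decreases in [t] by subadditivity, so it is directed and its infimum inherits the
   condition on joins. *)
have mono (s t : {t : R | 0 <= t}) x : sval s <= sval t -> r t x <= r s x.
  move=> st; rewrite /r.
  have -> : p (add x (scale (sval t) u)) =
      p (add (add x (scale (sval s) u)) (scale (sval t - sval s) u)).
    apply: subE => //; rewrite !evD !evZ -addrA -scalerDl.
    by congr (_ + _ *: _); ring.
  have := pD (add x (scale (sval s) u)) (scale (sval t - sval s) u).
  by rewrite (pZ (_ - _)) ?subr_ge0//; lra.
have low x : exists b, forall i, b <= r i x.
  exists (- p (scale (-1) x)) => t; rewrite /r.
  have := pD (scale (-1) x) (add x (scale (sval t) u)).
  rewrite (subE sp (x := add _ _) (y := scale (sval t) u)).
    by rewrite pZ ?(svalP t)//; lra.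
  by rewrite !evD !evZ scaleN1r addKr.
have q_le x t : q x <= r t x.
  apply: ge_inf; last by exists t.
  by have [b bx] := low x; exists b => _ [j _ <-]; exact: bx.
split.
- apply: (@inf_sublinear _ z0 r) => //.
  + move=> x y z Jxyz; apply: (@inf_directed _ z0 r) => //.
    * move=> s t; have [st|/ltW ts] := leP (sval s) (sval t).
        by exists t; split=> // w; exact: mono.
      by exists s; split=> // w; exact: mono.
    * by move=> t; rewrite /r -addr_maxl lerD2r; apply: pJ; apply: JD.
  + move=> s t x y; have st0 : 0 <= sval s + sval t by rewrite addr_ge0// ?(svalP s) ?(svalP t).
    exists (exist (fun t => 0 <= t) _ st0); rewrite /r /=.
    have := pD (add x (scale (sval s) u)) (add y (scale (sval t) u)).
    rewrite (subE sp (x := add (add x (scale (sval s) u)) _)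
      (y := add (add x y) (scale (sval s + sval t) u))); first by lra.
    by rewrite !evD !evZ scalerDl addrACA.
  + move=> t a x a0; have at0 : 0 <= a * sval t by rewrite mulr_ge0 ?(svalP t)// ltW.
    exists (exist (fun t => 0 <= t) _ at0); rewrite /r /= mulrBr -(pZ a _ (ltW a0)) mulrA lerD2r.
    rewrite (subE sp (y := scale a (add x (scale (sval t) u))))//.
    by rewrite !(evZ, evD) scalerDr scalerA.
- move=> x; apply: le_trans (q_le x z0) _; rewrite /r /= mul0r subr0.
  by rewrite (subE sp (y := x))// evD evZ scale0r addr0.
- apply: le_trans (q_le _ z1) _; rewrite /r /= mul1r lerBlDl subrr.
  by rewrite (sub0 sp)// evD !evZ scale1r scaleN1r addNr.
Qed.

(* Hahn-Banach: a minimal sublinear functional is additive, because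
   [q x = inf_(t >= 0) p (x + t u) - t p u] is sublinear and below [p]. *)
Lemma sublinear_linear p1 w : sublinear p1 ->
  exists p, [/\ sublinear p, forall x, p x <= p1 x,
    forall x y, p (add x y) = p x + p y, forall a x, p (scale a x) = a * p x &
    p w = p1 w].
Proof.
(* The first shift gives [p0 (scale (-1) w) <= - p1 w], which forces a linear functional below [p0]
   to take the value [p1 w] at [w]. *)
move=> sp1; have [sp0 p01 p0w] := shift w sp1.
set p0 := (fun x => inf _) in sp0 p01 p0w.
pose PS (p : T -> R) := sublinear p /\ forall x, p x <= p0 x.
pose S := {p | PS p}.
pose le (p q : S) := `[< forall x, sval q x <= sval p x >].
have [|||[p [sp pp0]] pmin] := @ZL_preorder S (exist PS p0 (conj sp0 (fun=> lexx _))) le.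
- by move=> p; apply/asboolP => x.
- move=> q r s /asboolP rq /asboolP qs; apply/asboolP => x.
  exact: le_trans (qs x) (rq x).
- move=> A Atot; have [[a Aa]|A0] := pselect (A !=set0); last first.
    exists (exist PS p0 (conj sp0 (fun=> lexx _))) => s As.
    by case: A0; exists s.
  pose r (i : {s | A s}) := sval (sval i).
  have low x : exists b, forall i, b <= r i x.
    by exists (- p0 (scale (-1) x)) => i; case: (svalP (sval i)); exact: lower.
  have sr : sublinear (fun x => inf (range (r ^~ x))).
    have dir i j : exists k,
        (forall x, r k x <= r i x) /\ (forall x, r k x <= r j x).
      have [/asboolP ij|/asboolP ji] := Atot _ _ (svalP i) (svalP j).
        by exists j; split.
      by exists i; split.
    apply: (@inf_sublinear _ (exist _ a Aa) r) => //.
    + move=> x y z Jxyz; apply: (@inf_directed _ (exist _ a Aa) r) => // i.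
      by case: (svalP (sval i)) => -[_ _ iJ] _; exact: iJ.
    + move=> i j x y; have [k [ki kj]] := dir i j; exists k.
      apply: le_trans (lerD (ki x) (kj y)).
      by case: (svalP (sval k)) => -[kD _ _] _; exact: kD.
    + move=> i c x c0; exists i; case: (svalP (sval i)) => -[_ iZ _] _.
      by rewrite /r iZ// ltW.
  have r_le i x : inf (range (r ^~ x)) <= r i x.
    apply: ge_inf; last by exists i.
    by have [b bx] := low x; exists b => _ [j _ <-].
  have rp0 x : inf (range (r ^~ x)) <= p0 x.
    have [_ ap0] := svalP a; exact: le_trans (r_le (exist _ a Aa) x) (ap0 x).
  exists (exist PS _ (conj sr rp0)) => s As; apply/asboolP => x /=.
  exact: (r_le (exist _ s As)).
exists p; have [pD pZ pJ] := sp.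
(* By minimality [p] is below its own shift [q], and [q] is at most [- p u] at the opposite of
   [u]. *)
have pN u : p (scale (-1) u) = - p u.
  have [sq qp qu] := shift u sp; set q := (fun x => inf _) in sq qp qu.
  have qp0 x : q x <= p0 x by apply: le_trans (qp x) _.
  have /asboolP/= pq := pmin (exist PS q (conj sq qp0)) (asboolT qp).
  apply/eqP; rewrite eq_le.
  by rewrite (le_trans (pq _))//= lerNl subN.
split=> //.
- by move=> x; exact: le_trans (pp0 x) (p01 x).
- move=> x y; apply/eqP; rewrite eq_le pD/= -lerN2 -pN.
  rewrite (subE sp (y := add (scale (-1) x) (scale (-1) y))).
    by rewrite opprD -!pN pD.
  by rewrite !(evZ, evD) scalerDr.
- move=> a x; have [a0|/ltW a0] := leP 0 a; first exact: pZ.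
  rewrite (subE sp (y := scale (-1) (scale (- a) x))).
    by rewrite pN pZ ?oppr_ge0// mulNr opprK.
  by rewrite !evZ scalerA mulN1r opprK.
- apply/eqP; rewrite eq_le (le_trans (pp0 w) (p01 w))/=.
  by rewrite -lerN2 -pN (le_trans (pp0 _) p0w).
Qed.

End sublinear.

(** [G g c] prescribes [c <= phi g]. The infimum over [G] of [q (x + g) - c] is sublinear, and a
    linear functional below it satisfies the constraints, its value at [- g] being at most
    [q 0 - c = - c]. *)
Lemma hahn_banach_cone (R : realType) (V : lmodType R) (q : V -> R)
    (G : V -> R -> Prop) :
  (forall x y, q (x + y) <= q x + q y) ->
  (forall (a : R) x, 0 <= a -> q (a *: x) = a * q x) ->
  G 0 0 -> (forall g c g' c', G g c -> G g' c' -> G (g + g') (c + c')) ->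
  (forall (a : R) g c, 0 < a -> G g c -> G (a *: g) (a * c)) ->
  (forall g c, G g c -> c <= q g) ->
  exists phi : V -> R, [/\ forall x y, phi (x + y) = phi x + phi y,
    forall a x, phi (a *: x) = a * phi x, forall x, phi x <= q x &
    forall g c, G g c -> c <= phi g].
Proof.
move=> qD qZ G0 GD GZ Gq.
have q0 : q 0 = 0 by rewrite -(scale0r 0) qZ// mul0r.
pose I := {gc : V * R | G gc.1 gc.2}.
pose r (i : I) y := q (y + (sval i).1) - (sval i).2.
pose i0 : I := exist (fun gc => G gc.1 gc.2) (0, 0) G0.
(* There are no joins to respect; with this [J] the condition on joins is trivial. *)
pose J (x y z : V) := z = x.
pose m x := inf (range (r ^~ x)).
have low x : exists b, forall i, b <= r i x.
  exists (- q (- x)) => -[[g c] /= Ggc]; rewrite /r /=.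
  have := qD (- x) (x + g); rewrite addKr.
  by have := Gq _ _ Ggc; lra.
have m_le i x : m x <= r i x.
  apply: ge_inf; last by exists i.
  by have [b bx] := low x; exists b => _ [j _ <-]; exact: bx.
have sm : sublinear +%R *:%R J m.
  apply: (@inf_sublinear _ _ _ +%R *:%R id J _ _ _ i0 r) => //.
  - by move=> x y z ->; rewrite le_max lexx.
  - move=> [[g c] Ggc] [[g' c'] Ggc'] x y.
    exists (exist (fun gc => G gc.1 gc.2) (g + g', c + c') (GD _ _ _ _ Ggc Ggc')).
    by rewrite /r /= (addrACA x y); have := qD (x + g) (y + g'); lra.
  - move=> [[g c] Ggc] a x a0.
    exists (exist (fun gc => G gc.1 gc.2) (a *: g, a * c) (GZ _ _ _ a0 Ggc)).
    by rewrite /r /= -scalerDr (qZ _ _ (ltW a0)) mulrBr.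
have [//|//|//||phi [_ phim phiD phiZ _]] := @sublinear_linear _ _ _ _ _ id J _ _ _ _ _ 0 sm.
  by move=> w x y z ->.
exists phi; split => //.
- by move=> x; apply: le_trans (phim x) _; have := m_le i0 x; rewrite /r /= addr0 subr0.
- move=> g c Ggc.
  have := le_trans (phim (- g)) (m_le (exist (fun gc => G gc.1 gc.2) (g, c) Ggc) _).
  by rewrite /r /= addNr q0 -scaleN1r phiZ; lra.
Qed.

(** * Vector lattices and transfer from the reals *)

Definition labs (R : realType) (Y : banachLatticeType R) (x : Y) := ljoin x (- x).
Definition lpos (R : realType) (Y : banachLatticeType R) (x : Y) := ljoin x 0.

Section vector_lattice.
Context {R : realType} {Y : banachLatticeType R}.
Implicit Types x y z e : Y.

Lemma lleT y x z : lle x y -> lle y z -> lle x z.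
Proof. exact: lle_trans. Qed.

Lemma ljoin_ub x y : lle x (ljoin x y) /\ lle y (ljoin x y).
Proof. by have := lle_refl (ljoin x y); rewrite ljoinP => /andP. Qed.

Lemma lmeet_lb x y : lle (lmeet x y) x /\ lle (lmeet x y) y.
Proof. by have := lle_refl (lmeet x y); rewrite lmeetP => /andP. Qed.

Lemma lleD2 z x y : lle (x + z) (y + z) = lle x y.
Proof.
by apply/idP/idP => [/(@lleD2r _ _ (- z))|/(@lleD2r _ _ z)//]; rewrite !addrK.
Qed.

Lemma lle_sub0 x y : lle (x - y) 0 = lle x y.
Proof. by rewrite -(lleD2 y) subrK add0r. Qed.

Lemma lle_0sub x y : lle 0 (y - x) = lle x y.
Proof. by rewrite -(lleD2 x) subrK add0r. Qed.

Lemma lleD x y z t : lle x y -> lle z t -> lle (x + z) (y + t).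
Proof.
move=> xy zt; apply: (@lleT (y + z)); first by rewrite lleD2.
by rewrite ![y + _]addrC lleD2.
Qed.

Lemma lleN x y : lle (- x) (- y) = lle y x.
Proof. by rewrite -lle_0sub opprK addrC lle_0sub. Qed.

Lemma lleZ (a : R) x y : 0 <= a -> lle x y -> lle (a *: x) (a *: y).
Proof.
by move=> a0; rewrite -lle_0sub => /(lle_scaler_ge0 _ _ a0); rewrite scalerBr lle_0sub.
Qed.

Lemma lleZr (a b : R) e : lle 0 e -> a <= b -> lle (a *: e) (b *: e).
Proof.
by move=> e0 ab; rewrite -lle_0sub -scalerBl lle_scaler_ge0// subr_ge0.
Qed.

Lemma lmeetN x y : lmeet x y = - ljoin (- x) (- y).
Proof.
have [jx jy] := ljoin_ub (- x) (- y); have [mx my] := lmeet_lb x y.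
apply: (@lle_anti _ Y); apply/andP; split; last first.
  by rewrite lmeetP -lleN opprK jx -lleN opprK.
by rewrite -lleN opprK ljoinP !lleN mx.
Qed.

Lemma labs_ge0 x : lle 0 (labs x).
Proof.
have [x1 x2] := ljoin_ub x (- x).
have -> : labs x = 2^-1 *: (labs x + labs x).
  by rewrite -[labs x + labs x]mulr2n -[labs x *+ 2]scaler_nat scalerA mulVf ?pnatr_eq0// scale1r.
by apply: lle_scaler_ge0; rewrite ?invr_ge0// -[0](addrN x) lleD.
Qed.

Lemma lpos_ge0 x : lle 0 (lpos x).
Proof. by have [] := ljoin_ub x 0. Qed.

Lemma labs_le x y : lle (labs x) y = lle x y && lle (- x) y.
Proof. exact: ljoinP. Qed.

Lemma labs_id x : lle 0 x -> labs x = x.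
Proof.
move=> x0; apply: (@lle_anti _ Y); rewrite labs_le lle_refl/=.
rewrite (@lleT 0) ?(ljoin_ub x (- x)).1//.
by rewrite -[0]opprK lleN oppr0.
Qed.

Lemma norm_labs x : `|labs x| = `|x|.
Proof.
by apply/eqP; rewrite eq_le; apply/andP; split; apply: lle_norm;
  rewrite -/(labs x) -/(labs (labs x)) (labs_id (labs_ge0 x)) lle_refl.
Qed.

Lemma lle_norm_ge0 x y : lle 0 x -> lle x y -> `|x| <= `|y|.
Proof.
move=> x0 xy; apply: lle_norm; rewrite -!/(labs _) !labs_id//.
exact: lleT xy.
Qed.

Lemma lle_norm_labs x y : lle (labs x) y -> `|x| <= `|y|.
Proof. by rewrite -(norm_labs x) => /lle_norm_ge0; apply; exact: labs_ge0. Qed.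

(** The Archimedean property comes from the norm: the positive part of [x] is below every positive
    multiple of [labs e], so its norm is 0. *)
Lemma lle_archi x e : (forall a : R, 0 < a -> lle x (a *: e)) -> lle x 0.
Proof.
move=> xe; have [xp x0] := ljoin_ub x 0.
suff : ljoin x 0 = 0 by move=> <-.
apply/eqP; rewrite -normr_le0; apply/ler_addgt0Pr => a a0; rewrite add0r.
have b0 : 0 < a / (`|e| + 1) by rewrite divr_gt0// ltr_wpDl.
have : lle (ljoin x 0) ((a / (`|e| + 1)) *: labs e).
  rewrite ljoinP lle_scaler_ge0 ?labs_ge0 ?ltW// andbT.
  apply: lleT (xe _ b0) _; apply: lleZ; first exact: ltW.
  exact: (ljoin_ub _ _).1.
move/(lle_norm_ge0 x0); rewrite normrZ norm_labs gtr0_norm// => /le_trans; apply.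
by rewrite mulrAC ler_pdivrMr ?ltr_wpDl// ler_pM2l// lerDl.
Qed.

End vector_lattice.

(** Terms name the elements of the sublattice generated by the variables and can be read both in [Y]
    and in the real numbers. *)
Inductive lterm (R T : Type) :=
  | LVar of T
  | LZero
  | LAdd of lterm R T & lterm R T
  | LOpp of lterm R T
  | LScale of R & lterm R T
  | LJoin of lterm R T & lterm R T
  | LMeet of lterm R T & lterm R T.
Arguments LZero {R T}.
Arguments LVar {R T}.

Fixpoint leval (R : realType) (Y : banachLatticeType R) T (v : T -> Y) (s : lterm R T) : Y :=
  match s with
  | LVar i => v i
  | LZero => 0
  | LAdd s t => leval v s + leval v t
  | LOpp s => - leval v s
  | LScale a s => a *: leval v s
  | LJoin s t => ljoin (leval v s) (leval v t)
  | LMeet s t => lmeet (leval v s) (leval v t)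
  end.

Fixpoint reval (R : realType) T (v : T -> R) (s : lterm R T) : R :=
  match s with
  | LVar i => v i
  | LZero => 0
  | LAdd s t => reval v s + reval v t
  | LOpp s => - reval v s
  | LScale a s => a * reval v s
  | LJoin s t => Num.max (reval v s) (reval v t)
  | LMeet s t => Num.min (reval v s) (reval v t)
  end.

(* [w] extends to a real lattice homomorphism on the sublattice generated by the
   values of [v]. *)
Definition monotone_val (R : realType) (Y : banachLatticeType R) T
    (v : T -> Y) (w : T -> R) :=
  forall s t, lle (leval v s) (leval v t) -> reval w s <= reval w t.

Section yosida.
Context {R : realType} {Y : banachLatticeType R} {T : Type}.
Variables (v : T -> Y) (e : Y).
Hypothesis ve : forall i, exists c : R, lle (labs (v i)) (c *: e).
Hypothesis e0 : lle 0 e.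
Local Notation ev := (leval v).

Let dom (x : Y) := exists2 c : R, 0 <= c & lle (labs x) (c *: e).

Let domE x (c d : R) : lle x (c *: e) -> lle (- x) (d *: e) -> dom x.
Proof.
move=> xc xd; have cd0 : 0 <= Num.max 0 (Num.max c d) by rewrite le_max lexx.
exists (Num.max 0 (Num.max c d)) => //; rewrite labs_le.
by rewrite (lleT xc) ?(lleT xd)//; apply: lleZr => //; rewrite !le_max lexx !orbT.
Qed.

Let dom_le x : dom x -> exists2 c : R, lle x (c *: e) & lle (- x) (c *: e).
Proof. by move=> [c c0]; rewrite labs_le => /andP[]; exists c. Qed.

Let dom_ev s : dom (ev s).
Proof.
elim: s => [i||s /dom_le[c c1 c2] t /dom_le[d d1 d2]|s /dom_le[c c1 c2]|a s /dom_le[c c1 c2]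
  |s /dom_le[c c1 c2] t /dom_le[d d1 d2]|s /dom_le[c c1 c2] t /dom_le[d d1 d2]] /=.
- have [c] := ve i; rewrite labs_le => /andP[c1 c2]; exact: domE c1 c2.
- by apply: (@domE _ 0 0); rewrite ?oppr0 scale0r lle_refl.
- by apply: (@domE _ (c + d) (c + d)); rewrite ?opprD scalerDl lleD.
- by apply: (@domE _ c c); rewrite ?opprK.
- have [a0|/ltW a0] := leP 0 a.
    by apply: (@domE _ (a * c) (a * c)); rewrite -?scalerN -scalerA lleZ.
  have na0 : 0 <= - a by rewrite oppr_ge0.
  apply: (@domE _ (- a * c) (- a * c)); rewrite -scalerA.
    by rewrite -[a *: _]opprK -scaleNr -scalerN lleZ.
  by rewrite -scaleNr lleZ.
- have cd : lle (c *: e) (Num.max c d *: e) by rewrite lleZr// le_max lexx.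
  have dc : lle (d *: e) (Num.max c d *: e) by rewrite lleZr// le_max lexx orbT.
  apply: (@domE _ (Num.max c d) c); first by rewrite ljoinP (lleT c1)// (lleT d1).
  by apply: lleT c2; rewrite lleN (ljoin_ub _ _).1.
- have cd : lle (c *: e) (Num.max c d *: e) by rewrite lleZr// le_max lexx.
  have dc : lle (d *: e) (Num.max c d *: e) by rewrite lleZr// le_max lexx orbT.
  apply: (@domE _ c (Num.max c d)); first by apply: lleT c1; rewrite (lmeet_lb _ _).1.
  by rewrite lmeetN opprK ljoinP (lleT c2)// (lleT d2).
Qed.

Let p0 s := inf [set a : R | lle (ev s) (a *: e)].

(** The gauge [p0] of [e] is sublinear for [J], so the linear functional [p] below it does not
    exceed the maximum of [p x] and [p y] at a join; the converse is monotonicity, and [p] is a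
    lattice homomorphism. It is chosen with [p s = p0 s], which is positive by the Archimedean
    property. *)
Lemma yosida s : ~~ lle (ev s) 0 ->
  exists2 w, monotone_val v w & 0 < reval w s.
Proof.
move=> s0.
(* If multiples of [e] were not ordered as their coefficients, [e] would be 0, and with it
   everything that [e] dominates, against [s0]. *)
have le_e (a b : R) : lle (a *: e) (b *: e) -> a <= b.
  rewrite leNgt => ab; apply/negP => ba; case/negP: s0.
  have e_0 : e = 0.
    apply: (@lle_anti _ Y); rewrite e0 andbT.
    have : lle 0 ((b - a) *: e) by rewrite scalerBl lle_0sub.
    have ab' : 0 <= (a - b)^-1 by rewrite invr_ge0 subr_ge0 ltW.
    move/(lle_scaler_ge0 _ _ ab'); rewrite scalerA -[b - a]opprB mulrN mulVf ?subr_eq0 ?gt_eqF//.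
    by rewrite scaleN1r -lleN opprK oppr0.
  by have [c c1 _] := dom_le (dom_ev s); rewrite (lleT c1)// e_0 scaler0 lle_refl.
have p0_lb t : has_lbound [set a : R | lle (ev t) (a *: e)].
  have [c _ c2] := dom_le (dom_ev t); exists (- c) => a /= ta.
  by apply: le_e; apply: lleT ta; rewrite scaleNr -lleN opprK.
have p0_le t (a : R) : lle (ev t) (a *: e) -> p0 t <= a.
  by move=> ta; apply: ge_inf.
have p0_ge t (a : R) : p0 t < a -> lle (ev t) (a *: e).
  move=> ta; have [||b tb ba] := @inf_adherent _ [set a : R | lle (ev t) (a *: e)] (a - p0 t).
  - by rewrite subr_gt0.
  - by split; [have [c c1 _] := dom_le (dom_ev t); exists c | exact: p0_lb].
  apply: lleT tb _; apply: lleZr => //; apply: ltW.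
  by apply: lt_le_trans ba _; rewrite /p0 addrC subrK.
have p0_lt (a : R) t : (forall b : R, a < b -> lle (ev t) (b *: e)) -> p0 t <= a.
  move=> H; apply/ler_addgt0Pr => d d0; apply/p0_le/H; by rewrite ltrDl.
pose J (x y z : lterm R T) := lle (ev z) (ljoin (ev x) (ev y)).
have sp0 : sublinear (@LAdd R T) (@LScale R T) J p0.
  split.
  - move=> x y; apply/ler_addgt0Pr => d d0; apply: p0_le.
    have -> : p0 x + p0 y + d = (p0 x + d / 2) + (p0 y + d / 2) by lra.
    by rewrite scalerDl; apply: lleD; apply: p0_ge; rewrite ltrDl divr_gt0.
  - have Zle (a : R) x : 0 < a -> p0 (LScale a x) <= a * p0 x.
      move=> a0; apply: p0_lt => b; rewrite mulrC -ltr_pdivlMr// => /p0_ge xb.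
      by have /= := lleZ (ltW a0) xb; rewrite scalerA mulrC divfK// gt_eqF.
    move=> a x; rewrite le_eqVlt => /predU1P[<-|a0].
      rewrite mul0r; apply/eqP; rewrite eq_le; apply/andP; split.
        by apply: p0_le; rewrite /= !scale0r lle_refl.
      apply: lb_le_inf => [|b].
        by exists 0; rewrite /= !scale0r lle_refl.
      by rewrite /= scale0r -{1}(scale0r e) => /le_e.
    apply/eqP; rewrite eq_le Zle//= -ler_pdivlMl//.
    have ai0 : 0 < a^-1 by rewrite invr_gt0.
    apply: le_trans (Zle _ _ ai0); apply: p0_lt => b /p0_ge /=.
    by rewrite scalerA mulVf ?scale1r// gt_eqF.
  - move=> x y z Jxyz; apply: p0_lt => b; rewrite gt_max => /andP[/p0_ge xb /p0_ge yb].
    by apply: lleT Jxyz _; rewrite ljoinP xb.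
have JE x z : ev z = ev x -> J x x z.
  by move=> xz; rewrite /J xz (ljoin_ub _ _).1.
have JD w x y z : J x y z -> J (LAdd x w) (LAdd y w) (LAdd z w).
  rewrite /J /= => xyz; rewrite -[X in lle _ X](subrK (ev w)) lleD2.
  apply: lleT xyz _; rewrite ljoinP -!(lleD2 (ev w) _ (_ - _)) !subrK.
  by rewrite (ljoin_ub _ _).1 (ljoin_ub _ _).2.
have [||p [[_ _ pJ] pp0 pD pZ ps]] :=
  @sublinear_linear _ _ _ _ _ ev J _ _ JE JD _ s sp0; [by []|by []|].
have pmono x y : lle (ev x) (ev y) -> p x <= p y.
  move=> xy; rewrite -[p y]maxxx; apply: pJ; apply: lleT xy _.
  exact: (ljoin_ub _ _).1.
have pE x y : ev x = ev y -> p x = p y.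
  by move=> xy; apply/eqP; rewrite eq_le !pmono// xy lle_refl.
have pN x : p (LOpp x) = - p x.
  by rewrite (@pE _ (LScale (-1) x)) ?pZ ?mulN1r//= scaleN1r.
have pJoin x y : p (LJoin x y) = Num.max (p x) (p y).
  apply/eqP; rewrite eq_le pJ/=; last by rewrite /J lle_refl.
  by rewrite ge_max !pmono//= ?(ljoin_ub _ _).1 ?(ljoin_ub _ _).2.
have pr x : reval (p \o LVar) x = p x.
  elim: x => [i||x IHx y IHy|x IHx|a x IHx|x IHx y IHy|x IHx y IHy] /=; rewrite ?IHx ?IHy //.
  - by rewrite (@pE _ (LScale 0 LZero)) ?pZ ?mul0r//= scaler0.
  - rewrite (@pE (LMeet x y) (LOpp (LJoin (LOpp x) (LOpp y)))) /= ?lmeetN//.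
    by rewrite pN pJoin !pN oppr_max !opprK.
exists (p \o LVar) => [x y xy|]; first by rewrite !pr pmono.
rewrite pr ps ltNge; apply/negP => ps0; case/negP: s0.
by apply: (@lle_archi _ _ _ e) => a a0; apply: p0_ge; exact: le_lt_trans a0.
Qed.

Lemma lattice_transfer s t :
  (forall w, monotone_val v w -> reval w s <= reval w t) -> lle (ev s) (ev t).
Proof.
move=> st; rewrite -lle_sub0; apply: contraT => H.
have [w vw] := @yosida (LAdd s (LOpp t)) H.
by rewrite /= subr_gt0 ltNge st.
Qed.

End yosida.

Section transfer_seq.
Context {R : realType} {Y : banachLatticeType R}.

(** The sum of the moduli of a finite list serves as the order unit [e] of [lattice_transfer]. *)
Lemma labs_sum_ge (L : seq Y) i :
  lle (labs (nth 0 L i)) (\sum_(x <- L) labs x) /\ lle 0 (\sum_(x <- L) labs x).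
Proof.
elim: L i => [|x L IH] [|i]; rewrite ?nth_nil ?big_nil ?big_cons //=.
- by rewrite labs_id ?lle_refl.
- by rewrite labs_id ?lle_refl.
- have [_ L0] := IH 0%N; split; last by have := lleD (labs_ge0 x) L0; rewrite addr0.
  by have := lleD (lle_refl (labs x)) L0; rewrite addr0.
- have [Li L0] := IH i; split; last by have := lleD (labs_ge0 x) L0; rewrite addr0.
  by have := lleD (labs_ge0 x) Li; rewrite add0r.
Qed.

Lemma lattice_transfer_seq (L : seq Y) s t :
  (forall w, monotone_val (nth 0 L) w -> reval w s <= reval w t) ->
  lle (leval (nth 0 L) s) (leval (nth 0 L) t).
Proof.
apply: (@lattice_transfer _ _ _ _ (\sum_(x <- L) labs x)) => [i|].
  by exists 1; rewrite scale1r (labs_sum_ge L i).1.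
exact: (labs_sum_ge L 0).2.
Qed.

Lemma lattice_transfer_seq_eq (L : seq Y) s t :
  (forall w, monotone_val (nth 0 L) w -> reval w s = reval w t) ->
  leval (nth 0 L) s = leval (nth 0 L) t.
Proof.
move=> st; apply: (@lle_anti _ Y); apply/andP.
by split; apply: lattice_transfer_seq => w /st ->.
Qed.

Lemma monotone_val_eq T (v : T -> Y) w s t : monotone_val v w ->
  leval v s = leval v t -> reval w s = reval w t.
Proof.
by move=> vw st; apply/eqP; rewrite eq_le !vw// st lle_refl.
Qed.

End transfer_seq.

(** * Reification of vector lattice (in)equations *)

Ltac lmem x L :=
  lazymatch L with
  | nil => constr:(false)
  | x :: _ => constr:(true)
  | _ :: ?L' => lmem x L'
  end.

Ltac latoms L t :=
  lazymatch t with
  | (?a + ?b)%R => let L' := latoms L a in latoms L' b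
  | (- ?a)%R => latoms L a
  | (_ *: ?a)%R => latoms L a
  | ljoin ?a ?b => let L' := latoms L a in latoms L' b
  | lmeet ?a ?b => let L' := latoms L a in latoms L' b
  | labs ?a => latoms L a
  | lpos ?a => latoms L a
  | 0%R => L
  | _ => lazymatch lmem t L with
         | true => L
         | false => constr:(t :: L)
         end
  end.

Ltac lindex x L :=
  lazymatch L with
  | x :: _ => constr:(O)
  | _ :: ?L' => let n := lindex x L' in constr:(S n)
  end.

Ltac lreify R L t :=
  lazymatch t with
  | (?a + ?b)%R => let a' := lreify R L a in let b' := lreify R L b in
      constr:(@LAdd R nat a' b')
  | (- ?a)%R => let a' := lreify R L a in constr:(@LOpp R nat a')
  | (?c *: ?a)%R => let a' := lreify R L a in constr:(@LScale R nat c a')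
  | ljoin ?a ?b => let a' := lreify R L a in let b' := lreify R L b in
      constr:(@LJoin R nat a' b')
  | lmeet ?a ?b => let a' := lreify R L a in let b' := lreify R L b in
      constr:(@LMeet R nat a' b')
  | labs ?a => let a' := lreify R L a in constr:(@LJoin R nat a' (@LOpp R nat a'))
  | lpos ?a => let a' := lreify R L a in constr:(@LJoin R nat a' (@LZero R nat))
  | 0%R => constr:(@LZero R nat)
  | _ => let n := lindex t L in constr:(@LVar R nat n)
  end.

Ltac latoms_goal L G :=
  lazymatch G with
  | is_true (lle ?a ?b) -> ?G' =>
      let L1 := latoms L a in let L2 := latoms L1 b in latoms_goal L2 G'
  | ?a = ?b -> ?G' =>
      let L1 := latoms L a in let L2 := latoms L1 b in latoms_goal L2 G'
  | is_true (lle ?a ?b) => let L1 := latoms L a in latoms L1 b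
  | ?a = ?b => let L1 := latoms L a in latoms L1 b
  end.

Ltac lchange R Y L :=
  lazymatch goal with
  | |- is_true (lle ?a ?b) -> _ =>
      let s := lreify R L a in let t := lreify R L b in
      let H := fresh "H" in intro H;
      change (is_true (@lle R Y (@leval R Y nat (nth 0%R L) s) (leval (nth 0%R L) t))) in H;
      lchange R Y L; revert H
  | |- ?a = ?b -> _ =>
      let s := lreify R L a in let t := lreify R L b in
      let H := fresh "H" in intro H;
      change (@leval R Y nat (nth 0%R L) s = leval (nth 0%R L) t) in H;
      lchange R Y L; revert H
  | |- is_true (lle ?a ?b) =>
      let s := lreify R L a in let t := lreify R L b in
      change (is_true (@lle R Y (@leval R Y nat (nth 0%R L) s) (leval (nth 0%R L) t)))
  | |- ?a = ?b =>
      let s := lreify R L a in let t := lreify R L b in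
      change (@leval R Y nat (nth 0%R L) s = leval (nth 0%R L) t)
  end.

(* Turns a goal [H1 -> .. -> Hn -> H] made of vector lattice (in)equations into
   the same statement about real numbers. *)
Ltac lattice_to_real :=
  lazymatch goal with
  | |- ?G =>
    let RY := lazymatch G with
      | context [@lle ?R ?Y _ _] => constr:((R, Y))
      | context [@ljoin ?R ?Y _ _] => constr:((R, Y))
      | context [@lmeet ?R ?Y _ _] => constr:((R, Y))
      | context [@labs ?R ?Y _] => constr:((R, Y))
      | context [@lpos ?R ?Y _] => constr:((R, Y)) end in
    lazymatch RY with (?R, ?Y) =>
    let L := latoms_goal (@nil Y) G in
    lchange R Y L
    end
  end;
  intros;
  first [apply: lattice_transfer_seq | apply: lattice_transfer_seq_eq];
  let w := fresh "w" in let mw := fresh "mw" in intros w mw;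
  repeat match goal with
  | H : is_true (lle (leval _ _) (leval _ _)) |- _ => apply mw in H; revert H
  | H : leval _ _ = leval _ _ |- _ => apply (monotone_val_eq mw) in H; revert H
  end;
  cbn [reval]; clear mw.

Ltac case_minmax :=
  repeat match goal with
  | |- context [@Order.max _ _ ?a ?b] => case: (leP a b)
  | |- context [@Order.min _ _ ?a ?b] => case: (leP a b)
  end.

Ltac vlat := lattice_to_real; case_minmax; intros; lra.

(** * States and Khintchine's inequality *)

Section lattice_norm.
Context {R : realType} {Y : banachLatticeType R}.
Implicit Types x y z e : Y.

Lemma labsD x y : lle (labs (x + y)) (labs x + labs y).
Proof. by vlat. Qed.

Lemma labsN x : labs (- x) = labs x.
Proof. by vlat. Qed.

Lemma labsZ (a : R) x : 0 <= a -> labs (a *: x) = a *: labs x.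
Proof.
move=> a0; lattice_to_real; move: (w 0%N) => r.
by rewrite maxr_pMr// mulrN.
Qed.

Lemma lposD x y : lle (lpos (x + y)) (lpos x + lpos y).
Proof. by vlat. Qed.

Lemma norm_lpos x : `|lpos x| <= `|x|.
Proof. by rewrite -(norm_labs x); apply: lle_norm_ge0; [exact: lpos_ge0|vlat]. Qed.

Lemma lpos_eq0 x : lle x 0 -> lpos x = 0.
Proof. by vlat. Qed.

Lemma norm_ljoinB x x' y y' : `|ljoin x y - ljoin x' y'| <= `|x - x'| + `|y - y'|.
Proof.
rewrite -(norm_labs (x - x')) -(norm_labs (y - y')).
apply: le_trans (ler_normD _ _); apply: lle_norm_labs.
rewrite labs_le; apply/andP; split; by vlat.
Qed.

Lemma norm_lmeetB x x' y y' : `|lmeet x y - lmeet x' y'| <= `|x - x'| + `|y - y'|.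
Proof.
have := norm_ljoinB (- x) (- x') (- y) (- y'); rewrite -!opprD !normrN !lmeetN.
by rewrite -opprD normrN.
Qed.

Lemma lle_approx x y :
  (forall a : R, 0 < a -> exists2 z, `|x - z| <= a & lle z y) -> lle x y.
Proof.
move=> H; have xy : lpos (x - y) = 0.
  apply/eqP; rewrite -normr_le0; apply/ler_addgt0Pr => a /H[z xz zy].
  rewrite add0r; apply: le_trans xz; rewrite -(norm_labs (x - z)).
  by apply: lle_norm_ge0; [exact: lpos_ge0|move: zy; vlat].
by rewrite -lle_sub0 -xy; exact: (ljoin_ub _ _).1.
Qed.

Lemma norm_le_scale (a : R) x e : 0 <= a -> lle (labs x) (a *: e) -> `|x| <= a * `|e|.
Proof. by move=> a0 /lle_norm_labs; rewrite normrZ ger0_norm. Qed.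

End lattice_norm.

Section state.
Context {R : realType} {Y : banachLatticeType R}.

(** The last condition says at once that [mu] is positive and of norm at most 1. *)
Definition state (mu : Y -> R) :=
  [/\ forall x y, mu (x + y) = mu x + mu y, forall a x, mu (a *: x) = a * mu x &
      forall x, mu x <= `|lpos x|].

Lemma stateB mu x y : state mu -> mu (x - y) = mu x - mu y.
Proof. by move=> [muD muZ _]; rewrite muD -scaleN1r muZ mulN1r. Qed.

Lemma state_le mu x y : state mu -> lle x y -> mu x <= mu y.
Proof.
move=> smu; rewrite -lle_sub0 => xy; have [muD muZ mup] := smu.
by rewrite -subr_le0 -stateB// (le_trans (mup _))// lpos_eq0// normr0.
Qed.

Lemma state_norm mu x : state mu -> mu x <= `|x|.
Proof. by move=> [_ _ mup]; apply: le_trans (mup _) (norm_lpos _). Qed.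

Lemma state_sum mu I (r : seq I) (F : I -> Y) : state mu ->
  mu (\sum_(i <- r) F i) = \sum_(i <- r) mu (F i).
Proof.
move=> [muD muZ _]; elim: r => [|i r IH]; last by rewrite !big_cons muD IH.
by rewrite !big_nil -(scale0r 0) muZ mul0r.
Qed.

Lemma lposZ (a : R) (x : Y) : 0 <= a -> lpos (a *: x) = a *: lpos x.
Proof.
move=> a0; lattice_to_real; move: (w 0%N) => r.
by rewrite maxr_pMr// mulr0.
Qed.

Lemma state_cone (G : Y -> R -> Prop) :
  G 0 0 -> (forall g c g' c', G g c -> G g' c' -> G (g + g') (c + c')) ->
  (forall (a : R) g c, 0 < a -> G g c -> G (a *: g) (a * c)) ->
  (forall g c, G g c -> c <= `|lpos g|) ->
  exists2 mu, state mu & forall g c, G g c -> c <= mu g.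
Proof.
move=> G0 GD GZ Gp.
have [||mu [muD muZ mup muG]] :=
  @hahn_banach_cone R Y (fun x => `|lpos x|) G _ _ G0 GD GZ Gp.
- move=> x y; apply: le_trans (ler_normD _ _).
  by apply: lle_norm_ge0; [exact: lpos_ge0|exact: lposD].
- by move=> a x a0; rewrite lposZ// normrZ ger0_norm.
- by exists mu.
Qed.

Lemma state_norming (x : Y) : lle 0 x -> exists2 mu, state mu & mu x = `|x|.
Proof.
move=> x0; pose G (g : Y) (c : R) := exists2 a, 0 <= a & g = a *: x /\ c = a * `|x|.
have [||||mu smu muG] := @state_cone G.
- by exists 0; rewrite ?lexx// scale0r mul0r.
- move=> _ _ _ _ [a a0 [-> ->]] [b b0 [-> ->]].
  by exists (a + b); rewrite ?addr_ge0// scalerDl mulrDl.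
- move=> a _ _ a0 [b b0 [-> ->]].
  by exists (a * b); rewrite ?mulr_ge0 ?(ltW a0)// scalerA mulrA.
- move=> _ _ [a a0 [-> ->]]; rewrite lposZ// normrZ ger0_norm// ler_wpM2l//.
  by apply: lle_norm_ge0 => //; exact: (ljoin_ub _ _).1.
exists mu => //; apply/eqP; rewrite eq_le state_norm//=.
by apply: muG; exists 1; rewrite ?ler01// scale1r mul1r.
Qed.

End state.

Section khintchine.
Context {R : realType}.

(** The mean of [g] at [x] plus the sum of [ys] with independent random signs; the recursion stands
    for the probability space. *)
Fixpoint sign_avg (g : R -> R) (x : R) (ys : seq R) : R :=
  if ys is y :: ys' then 2^-1 * (sign_avg g (x + y) ys' + sign_avg g (x - y) ys')
  else g x.

Lemma sign_avg_sq x ys : sign_avg (fun u => u ^+ 2) x ys = x ^+ 2 + \sum_(y <- ys) y ^+ 2.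
Proof.
elim: ys x => [|y ys IH] x /=; first by rewrite big_nil addr0.
by rewrite !IH big_cons; field.
Qed.

Lemma sign_avg_pow4 x ys (q := \sum_(y <- ys) y ^+ 2) :
  sign_avg (fun u => u ^+ 4) x ys <= x ^+ 4 + 6 * x ^+ 2 * q + 3 * q ^+ 2.
Proof.
rewrite {}/q; elim: ys x => [|y ys IH] x /=; first by rewrite big_nil; lra.
rewrite big_cons; set q := \sum_(j <- ys) j ^+ 2.
have := IH (x + y); have := IH (x - y); rewrite -/q.
have : 0 <= y ^+ 4 by rewrite exprn_even_ge0.
by nra.
Qed.

(** For [u >= 0], [u * (u - 1) ^+ 2 * (u + 2) >= 0] bounds [u] from below by
    [(3 * u ^+ 2 - u ^+ 4) / 2]. Hence the second and fourth moments control the first one. *)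
Lemma sign_avg_norm (r : R) x ys : 0 < r ->
  (3 * sign_avg (fun u => u ^+ 2) x ys / r -
    sign_avg (fun u => u ^+ 4) x ys / r ^+ 3) / 2 <= sign_avg (fun u => `|u|) x ys.
Proof.
move=> r0; elim: ys x => [|y ys IH] x /=; last first.
  have := IH (x + y); have := IH (x - y); lra.
pose u := `|x| / r; have u0 : 0 <= u by rewrite divr_ge0// ltW.
have -> : `|x| = u * r by rewrite /u divfK// gt_eqF.
have -> : 3 * x ^+ 2 / r = 3 * u ^+ 2 * r.
  rewrite /u expr_div_n real_normK ?num_real//; field; exact: lt0r_neq0.
have -> : x ^+ 4 / r ^+ 3 = u ^+ 4 * r.
  rewrite /u expr_div_n (_ : `|x| ^+ 4 = x ^+ 4).
    by field; exact: lt0r_neq0.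
  by rewrite -normrX ger0_norm// exprn_even_ge0.
have : 0 <= u * (u - 1) ^+ 2 * (u + 2) * r.
  have u2 : 0 <= u + 2 by lra.
  by apply: mulr_ge0 (ltW r0); apply: mulr_ge0 u2; apply: mulr_ge0 u0 (sqr_ge0 _).
by lra.
Qed.

(** The Cauchy-Schwarz inequality bounds the left side by [M] times the square root of [q], and the
    moments bound that root by a multiple of the mean. The length is a square so that no root of it
    appears. *)
Lemma khintchine_real M (ys : seq R) : size ys = (M ^ 2)%N ->
  \sum_(y <- ys) `|y| <= 2 * M%:R * sign_avg (fun u => `|u|) 0 ys.
Proof.
move=> sz; set q := \sum_(y <- ys) y ^+ 2.
have q0 : 0 <= q by apply: sumr_ge0 => y _; exact: sqr_ge0.
have sum_le s : 0 < s -> \sum_(y <- ys) `|y| <= (q / s + (size ys)%:R * s) / 2.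
  move=> s0; rewrite /q; elim: ys {sz q q0} => [|y ys IH].
    by rewrite !big_nil /=; lra.
  rewrite !big_cons /= -(natr1 (size ys)).
  have -> : y ^+ 2 = `|y| ^+ 2 by rewrite real_normK ?num_real.
  have : 0 <= (`|y| / s - 1) ^+ 2 * s by rewrite mulr_ge0 ?sqr_ge0 ?ltW.
  have -> : (`|y| / s - 1) ^+ 2 * s = `|y| ^+ 2 / s - 2 * `|y| + s.
    by field; exact: lt0r_neq0.
  by move: IH; lra.
have [q_0|q_neq0] := eqVneq q 0.
  have -> : \sum_(y <- ys) `|y| = 0.
    apply/eqP; rewrite eq_le sumr_ge0// andbT; apply/ler_addgt0Pr => a a0.
    set n : R := (size ys)%:R; have n0 : 0 <= n by rewrite ler0n.
    have n1 : 0 < n + 1 by rewrite ltr_wpDl.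
    have := sum_le (2 * a / (n + 1)); rewrite -/n q_0 mul0r add0r.
    have : n * (2 * a / (n + 1)) <= 2 * a by rewrite mulrA ler_pdivrMr//; nra.
    have s0 : 0 < 2 * a / (n + 1) by rewrite divr_gt0// mulr_gt0.
    by move=> h /(_ s0); lra.
  have avg_ge0 x us : 0 <= sign_avg (fun u => `|u|) x us.
    elim: us x => //= u us IH x.
    by rewrite mulr_ge0 ?invr_ge0// addr_ge0.
  by rewrite mulr_ge0 ?mulr_ge0.
have q_gt0 : 0 < q by rewrite lt0r q_neq0.
have M0 : (0 < M)%N.
  rewrite lt0n; apply/eqP => M0; move: q_neq0; rewrite /q.
  by move: sz; rewrite M0 => /size0nil ->; rewrite big_nil eqxx.
have M0' : 0 < M%:R :> R by rewrite ltr0n.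
(* With [r ^+ 2 = 2 * q] and the parameter [r / M%:R] in [sum_le], the mean is at least [3 * r / 8]
   and the sum at most [M%:R] times [3 * r / 4]. *)
pose r := Num.sqrt (2 * q).
have r0 : 0 < r by rewrite sqrtr_gt0 mulr_gt0.
have rq : q = r ^+ 2 / 2 by rewrite sqr_sqrtr ?mulr_ge0//; field.
have := sum_le (r / M%:R) (divr_gt0 r0 M0').
have := sign_avg_norm 0 ys r0; rewrite sign_avg_sq -/q (_ : 0 ^+ 2 + q = q); last by ring.
have := sign_avg_pow4 0 ys; cbv zeta; rewrite -/q.
rewrite (_ : 0 ^+ 4 + 6 * 0 ^+ 2 * q + 3 * q ^+ 2 = 3 * q ^+ 2); last by ring.
set E4 := sign_avg _ _ _; set E1 := sign_avg _ _ _ => hE4 hE1.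
rewrite sz natrX.
have -> : (q / (r / M%:R) + M%:R ^+ 2 * (r / M%:R)) / 2 = 2 * M%:R * (3 * r / 8).
  by rewrite rq; field; rewrite !lt0r_neq0.
move=> /le_trans; apply; apply: ler_wpM2l; first by rewrite mulr_ge0 ?ltW.
apply: le_trans hE1.
have : E4 / r ^+ 3 <= 3 * q ^+ 2 / r ^+ 3 by rewrite ler_wpM2r// invr_ge0 exprn_ge0 ?ltW.
have -> : 3 * q / r = 3 * r / 2 by rewrite rq; field; rewrite lt0r_neq0.
have -> : 3 * q ^+ 2 / r ^+ 3 = 3 * r / 4 by rewrite rq; field; rewrite lt0r_neq0.
by lra.
Qed.
End khintchine.

Section khintchine_lattice.
Context {R : realType} {Y : banachLatticeType R}.

Fixpoint rad_avg (x : Y) (ys : seq Y) : Y :=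
  if ys is y :: ys' then 2^-1 *: (rad_avg (x + y) ys' + rad_avg (x - y) ys')
  else labs x.

Fixpoint tavg T (x : lterm R T) (ys : seq (lterm R T)) : lterm R T :=
  if ys is y :: ys' then
    LScale 2^-1 (LAdd (tavg (LAdd x y) ys') (tavg (LAdd x (LOpp y)) ys'))
  else LJoin x (LOpp x).

Fixpoint tsum_abs T (ys : seq (lterm R T)) : lterm R T :=
  if ys is y :: ys' then LAdd (LJoin y (LOpp y)) (tsum_abs ys') else LZero.

(** Both sides are lattice terms in the entries of [ys], so the real inequality transfers; the
    square function, which is no such term, has been eliminated. *)
Lemma khintchine M (ys : seq Y) : size ys = (M ^ 2)%N ->
  lle (\sum_(y <- ys) labs y) ((2 * M%:R) *: rad_avg 0 ys).
Proof.
move=> sz; pose v := nth 0 ys; pose ts : seq (lterm R nat) := map LVar (iota 0 (size ys)).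
have vts : map (leval v) ts = ys.
  by rewrite -map_comp -[RHS](mkseq_nth 0).
have lavg x us : leval v (tavg x us) = rad_avg (leval v x) (map (leval v) us).
  by elim: us x => //= u us IH x; rewrite !IH.
have ravg w x us : reval w (tavg x us) =
    sign_avg (fun u => `|u|) (reval w x) (map (reval w) us).
  by elim: us x => [|u us IH] x /=; rewrite ?maxrN ?IH.
have lsum us : leval v (tsum_abs us) = \sum_(y <- map (leval v) us) labs y.
  by elim: us => [|u us IH] /=; rewrite ?big_nil ?big_cons ?IH.
have rsum w us : reval w (tsum_abs us) = \sum_(y <- map (reval w) us) `|y|.
  by elim: us => [|u us IH] /=; rewrite ?big_nil ?big_cons ?IH ?maxrN.
have := @lattice_transfer_seq _ _ ys (tsum_abs ts) (LScale (2 * M%:R) (tavg LZero ts)).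
rewrite -/v /= lsum lavg vts; apply => w _; rewrite rsum ravg.
by apply: khintchine_real; rewrite !size_map size_iota.
Qed.

Lemma rad_avg_ge0 x ys : lle (labs x) (rad_avg x ys).
Proof.
elim: ys x => [|y ys IH] x /=; first exact: lle_refl.
have := IH (x + y); have := IH (x - y).
by move: (rad_avg _ _) (rad_avg _ _) => a b; vlat.
Qed.

Lemma rad_avg_ge x ys y : y \in ys -> lle (labs y) (rad_avg x ys).
Proof.
elim: ys x => // z ys IH x; rewrite inE => /predU1P[->|yys] /=.
  have := rad_avg_ge0 (x + z) ys; have := rad_avg_ge0 (x - z) ys.
  by move: (rad_avg _ _) (rad_avg _ _) => a b; vlat.
have := IH (x + z) yys; have := IH (x - z) yys.
by move: (rad_avg _ _) (rad_avg _ _) (labs y) => a b c; vlat.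
Qed.

Fixpoint signs_bounded (C : R) (x : Y) (ys : seq Y) : Prop :=
  if ys is y :: ys' then signs_bounded C (x + y) ys' /\ signs_bounded C (x - y) ys'
  else `|x| <= C.

Lemma norm_rad_avg C x ys : signs_bounded C x ys -> `|rad_avg x ys| <= C.
Proof.
elim: ys x => [|y ys IH] x /=; first by rewrite norm_labs.
move=> [/IH h1 /IH h2]; rewrite normrZ gtr0_norm ?invr_gt0//.
by have := ler_normD (rad_avg (x + y) ys) (rad_avg (x - y) ys); lra.
Qed.

Lemma khintchine_state mu C M (ys : seq Y) : state mu -> size ys = (M ^ 2)%N ->
  signs_bounded C 0 ys -> \sum_(y <- ys) mu (labs y) <= 2 * M%:R * C.
Proof.
move=> smu sz Cys; rewrite -state_sum//.
apply: le_trans (state_le smu (khintchine sz)) _.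
have [_ -> _] := smu; rewrite ler_wpM2l ?mulr_ge0//.
exact: le_trans (state_norm _ smu) (norm_rad_avg Cys).
Qed.

(** The [M ^ 2] values sum to at most [2 * M%:R * C], so one of them is at most [2 * C / M%:R]. *)
Lemma khintchine_exists mu C M (eta : R) (ys : seq Y) : state mu ->
  size ys = (M ^ 2)%N -> (0 < M)%N -> signs_bounded C 0 ys -> 2 * C < M%:R * eta ->
  exists2 y, y \in ys & mu (labs y) < eta.
Proof.
move=> smu sz M0 Cys CM; apply/hasP; apply: contraT => /hasPn H.
have : (M ^ 2)%:R * eta <= 2 * M%:R * C.
  apply: le_trans (khintchine_state smu sz Cys).
  rewrite -sz -sum1_size natr_sum mulr_suml !big_seq; apply: ler_sum => y yys.
  by rewrite mul1r leNgt H.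
rewrite natrX expr2 -mulrA [2 * _]mulrC -!mulrA ler_pM2l ?ltr0n//.
by rewrite leNgt CM.
Qed.

End khintchine_lattice.

(** * The lattice C[0,1] *)

Section geometric_limit.
Context {R : realType} {Y : completeNormedModType R}.

Lemma expr2V_small (e : R) : 0 < e -> exists n : nat, 2^-1 ^+ n <= e.
Proof.
move=> e0; have [n en] : exists n : nat, e^-1 < n%:R.
  by exists (Num.truncn e^-1).+1; rewrite truncnS_gt// invr_ge0 ltW.
exists n; rewrite exprVn -[e]invrK lef_pV2 ?posrE ?invr_gt0 ?exprn_gt0//.
apply: ltW; apply: lt_le_trans en _; rewrite -natrX ler_nat ltnW//.
exact: ltn_expl.
Qed.

Lemma ler_geometric (x y C : R) : (forall n, x <= y + C * 2^-1 ^+ n) -> x <= y.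
Proof.
move=> H; apply/ler_addgt0Pr => e e0.
have C0 : 0 < `|C| + 1 by rewrite ltr_wpDl.
have [n ne] := expr2V_small (divr_gt0 e0 C0); apply: le_trans (H n) _.
rewrite lerD2l; have p0 : 0 <= 2^-1 ^+ n :> R by rewrite exprn_ge0// invr_ge0.
move: ne; rewrite ler_pdivlMr// => ne; have := ler_norm C; nra.
Qed.

Lemma geometric_limit (u : nat -> Y) (C : R) :
  (forall n, `|u n.+1 - u n| <= C * 2^-1 ^+ n) ->
  exists l, forall n, `|l - u n| <= 2 * C * 2^-1 ^+ n.
Proof.
move=> uC.
have C0 : 0 <= C by have := uC 0%N; rewrite expr0 mulr1; apply: le_trans.
have uk n k : `|u (n + k)%N - u n| <= 2 * C * 2^-1 ^+ n - 2 * C * 2^-1 ^+ (n + k).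
  elim: k => [|k IH]; first by rewrite addn0 !subrr normr0.
  rewrite addnS; have := uC (n + k)%N.
  have := ler_normD (u (n + k).+1 - u (n + k)%N) (u (n + k)%N - u n).
  rewrite addrA subrK exprS; move: IH; lra.
have un n m : (n <= m)%N -> `|u m - u n| <= 2 * C * 2^-1 ^+ n.
  move=> nm; rewrite -(subnKC nm); apply: le_trans (uk _ _) _.
  by rewrite gerBl mulr_ge0 ?mulr_ge0// exprn_ge0// invr_ge0.
have small (e : R) : 0 < e -> exists n, 2 * C * 2^-1 ^+ n < e.
  move=> e0; have e1 : 0 < e / (2 * (2 * C + 1)).
    by rewrite divr_gt0// mulr_gt0// ltr_wpDl// mulr_ge0.
  have [n ne] := expr2V_small e1.
  have e2 : e / 2 < e by lra.
  exists n; apply: le_lt_trans e2.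
  apply: le_trans (ler_wpM2l _ ne) _; first by rewrite mulr_ge0.
  have : 0 < 2 * C + 1 by rewrite ltr_wpDl// mulr_ge0.
  move=> C1; rewrite mulrA ler_pdivrMr ?mulr_gt0//.
  have -> : e / 2 * (2 * (2 * C + 1)) = (2 * C + 1) * e by field.
  by rewrite ler_wpM2r ?ltW// ltrDl.
have cu : cvg (u @ \oo).
  apply: cauchy_cvg; apply: cauchy_exP => e e0; have [n ne] := small e e0.
  exists (u n); exists n => // m /= nm; rewrite -ball_normE /= distrC.
  exact: le_lt_trans (un _ _ nm) ne.
exists (lim (u @ \oo)) => n; apply/ler_addgt0Pr => e e0.
have /cvgrPdist_le /(_ e e0) [N _ HN] := cu.
have := HN (maxn n N) (leq_maxr _ _); have := un n (maxn n N) (leq_maxl _ _).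
have := ler_normD (lim (u @ \oo) - u (maxn n N)) (u (maxn n N) - u n).
rewrite addrA subrK; lra.
Qed.

End geometric_limit.

Section C01_interface.
Context {R : realType}.
Local Notation I := (set_type (unit_interval R)).
Implicit Types f g : C01 R.

Lemma clamp_subproof (x : R) : Num.max 0 (Num.min 1 x) \in unit_interval R.
Proof.
rewrite inE /unit_interval /= in_itv /= le_max lexx /= ge_max ler01 /=.
by rewrite ge_min lexx.
Qed.

Definition to_unit (x : R) : I :=
  exist (fun y => y \in unit_interval R) _ (clamp_subproof x).

Lemma to_unitE x : 0 <= x <= 1 -> \val (to_unit x) = x.
Proof. by move=> /andP[x0 x1]; rewrite /= min_r// max_r. Qed.

Lemma to_unit_val (t : I) : to_unit (\val t) = t.
Proof.
apply: val_inj; rewrite to_unitE//.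
by have := valP t; rewrite inE /unit_interval /= in_itv.
Qed.

Lemma unit_val (t : I) : 0 <= \val t <= 1.
Proof. by have := valP t; rewrite inE /unit_interval /= in_itv. Qed.

(** The extension of [f] to the whole line, constant on each side of the interval, so that points
    are plain real numbers. *)
Definition C01_at f (x : R) : R := f (to_unit x).

Lemma continuous_to_unit : continuous to_unit.
Proof.
apply: continuous_comp_initial => x.
apply: (@continuous_max R R (fun=> 0) (fun y => Num.min 1 y) x); first exact: cvg_cst.
by apply: (@continuous_min R R (fun=> 1) id x); [exact: cvg_cst|exact: cvg_id].
Qed.

Lemma C01_at_continuous f : continuous (C01_at f).
Proof.
move=> x; apply: (@continuous_comp _ _ _ to_unit (f : I -> R)).
  exact: continuous_to_unit.
exact: (@cts_fun _ _ (f : continuousType I R)).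
Qed.

Lemma C01_ext f g : (forall x, 0 <= x <= 1 -> C01_at f x = C01_at g x) -> f = g.
Proof.
move=> fg; apply/continuousEP => t; have := fg (\val t) (unit_val t).
by rewrite /C01_at to_unit_val.
Qed.

Lemma C01_mk (g : R -> R) : continuous g ->
  {f : C01 R | forall x, 0 <= x <= 1 -> C01_at f x = g x}.
Proof.
move=> cg; have cgv : continuous (fun t : I => g (\val t)).
  move=> t; apply: (@continuous_comp _ _ _ (fun t : I => \val t) g); last exact: cg.
  exact: (@initial_continuous I R set_val).
exists (mkcts cgv : continuousType I R) => x x01.
by change (g (\val (to_unit x)) = g x); rewrite to_unitE.
Qed.

Lemma C01_at_norm f x : `|C01_at f x| <= `|f|.
Proof. exact: C01_norm_ge. Qed.

Lemma C01_at_norm_le f c : (forall x, 0 <= x <= 1 -> `|C01_at f x| <= c) -> `|f| <= c.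
Proof.
move=> fc; apply: C01_norm_le => t; have := fc _ (unit_val t).
by rewrite /C01_at to_unit_val.
Qed.

Lemma C01_atP f g :
  reflect (forall x, 0 <= x <= 1 -> C01_at f x <= C01_at g x) (lle f g).
Proof.
apply: (iffP (asboolP _)) => [fg x _|fg t]; first exact: fg.
by have := fg _ (unit_val t); rewrite /C01_at to_unit_val.
Qed.

Lemma C01_at_norm_gt f c : c < `|f| -> exists2 x, 0 <= x <= 1 & c < `|C01_at f x|.
Proof.
move=> cf; apply: contrapT => H; move: cf; rewrite ltNge => /negP; apply.
apply: C01_at_norm_le => x x01; rewrite leNgt; apply/negP => cx.
by apply: H; exists x.
Qed.

Lemma C01_atD f g x : C01_at (f + g) x = C01_at f x + C01_at g x.
Proof. by []. Qed.
Lemma C01_atN f x : C01_at (- f) x = - C01_at f x.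
Proof. by []. Qed.
Lemma C01_at0 x : C01_at 0 x = 0.
Proof. by []. Qed.
Lemma C01_atZ a f x : C01_at (a *: f) x = a * C01_at f x.
Proof. by []. Qed.
Lemma C01_at_join f g x : C01_at (ljoin f g) x = Num.max (C01_at f x) (C01_at g x).
Proof. by []. Qed.
Lemma uniform_continuous01 (g : R -> R) (e : R) : continuous g -> 0 < e ->
  exists2 d, 0 < d & forall x y, 0 <= x <= 1 -> `|x - y| < d -> `|g x - g y| < e.
Proof.
move=> cg e0.
have /compact_near_coveringP nc := @segment_compact R 0 1.
have := nc _ (at_right (0 : R)) (fun d x => forall y, `|x - y| < d -> `|g x - g y| < e) _.
case.
  move=> x _; have e2 : 0 < e / 2 by rewrite divr_gt0.
  have /cvgrPdist_lt /(_ _ e2) := cg x; rewrite nearE => /nbhs_ballP[r /= r0 rg].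
  have rr z : `|x - z| < r -> `|g x - g z| < e / 2.
    by move=> xz; apply: rg; rewrite -ball_normE.
  have r2 : 0 < r / 2 by rewrite divr_gt0.
  exists (ball x (r / 2), [set d | d < r / 2]); first split => /=.
  - exact: nbhsx_ballx.
  - exact: nbhs_right_lt.
  - move=> [z d] /= [xz dr] y zy; rewrite -ball_normE /= in xz.
    have := rr z; have := rr y; have := ler_distD z x y.
    have := ler_distD (g x) (g z) (g y); rewrite (distrC (g z) (g x)) => h1 h2 h3 h4.
    have : `|g x - g z| < e / 2 by apply: h4; lra.
    have : `|g x - g y| < e / 2 by apply: h3; lra.
    by lra.
move=> d /= d0 H; exists (d / 2); first by rewrite divr_gt0.
move=> x y x01; apply: (H (d / 2)).
- by rewrite /= sub0r normrN gtr0_norm ?divr_gt0//; lra.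
- by rewrite divr_gt0.
- by rewrite /= in_itv.
Qed.

End C01_interface.

(** * Embeddings and functional calculus *)

Section embedding_criteria.
Context {R : realType}.

Lemma linear_of (X Y : lmodType R) (f : X -> Y) :
  (forall a x y, f (a *: x + y) = a *: f x + f y) ->
  exists T : {linear X -> Y}, forall x, T x = f x.
Proof.
move=> lf; pose T : {linear X -> Y} := HB.pack f (GRing.isLinear.Build _ _ _ _ f lf).
by exists T.
Qed.

Lemma isomorphism_onto_rangeP (X Y : normedModType R) (T : {linear X -> Y}) :
  isomorphism_onto_range T <-> exists2 c : R, 0 < c & forall x, c * `|x| <= `|T x|.
Proof.
split=> [[S [TS [M SM]]]|[c c0 Tc]].
  exists (Num.max 1 M)^-1; first by rewrite invr_gt0 lt_max ltr01.
  move=> x; rewrite ler_pdivrMl ?lt_max ?ltr01//.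
  rewrite -[x in `|x| <= _]TS; apply: le_trans (SM _ _) _; first by exists x.
  by rewrite ler_wpM2r// le_max lexx orbT.
have Tinj x y : T x = T y -> x = y.
  move=> xy; apply/eqP; rewrite -subr_eq0 -normr_le0 -(ler_pM2l c0) mulr0.
  by rewrite (le_trans (Tc _))// linearB /= xy subrr normr0.
pose S y := xget 0 [set x | T x = y].
have TS x : S (T x) = x by apply: Tinj; apply: (@xgetPex _ 0 [set z | T z = T x]); exists x.
exists S; split=> //; exists c^-1 => _ [x _ <-].
by rewrite TS ler_pdivlMl.
Qed.

Lemma lattice_embeddable_of (X Y : banachLatticeType R) (f : X -> Y) (c C : R) :
  (forall a x y, f (a *: x + y) = a *: f x + f y) ->
  (forall x y, f (ljoin x y) = ljoin (f x) (f y)) ->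
  (forall x, `|f x| <= C * `|x|) -> 0 < c -> (forall x, c * `|x| <= `|f x|) ->
  lattice_embeddable X Y.
Proof.
move=> lf fj fC c0 fc; have [T Tf] := linear_of lf.
exists T; split.
- by exists C => x; rewrite Tf.
- by apply/isomorphism_onto_rangeP; exists c => // x; rewrite Tf.
- have Tj x y : T (ljoin x y) = ljoin (T x) (T y) by rewrite !Tf.
  by split=> // x y; rewrite !lmeetN linearN /= Tj !linearN.
Qed.

Lemma lattice_embeddable_linear (X Y : banachLatticeType R) :
  lattice_embeddable X Y -> linearly_embeddable X Y.
Proof. by move=> [T [bT iT _]]; exists T. Qed.

Lemma bounded_operatorP (X Y : normedModType R) (T : {linear X -> Y}) :
  bounded_operator T -> exists2 C : R, 0 < C & forall x, `|T x| <= C * `|x|.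
Proof.
move=> [M TM]; exists (Num.max 1 M); first by rewrite lt_max ltr01.
by move=> x; rewrite (le_trans (TM x))// ler_wpM2r// le_max lexx orbT.
Qed.

Lemma linearly_embeddable_trans (X Y Z : completeNormedModType R) :
  linearly_embeddable X Y -> linearly_embeddable Y Z -> linearly_embeddable X Z.
Proof.
move=> [T [/bounded_operatorP[C C0 TC] /isomorphism_onto_rangeP[c c0 Tc]]].
move=> [U [/bounded_operatorP[D D0 UD] /isomorphism_onto_rangeP[d d0 Ud]]].
exists (U \o T : {linear X -> Z}); split.
  exists (D * C) => x; apply: le_trans (UD _) _.
  by rewrite -mulrA ler_pM2l.
apply/isomorphism_onto_rangeP; exists (d * c) => [|x]; first exact: mulr_gt0.
by rewrite -mulrA (le_trans _ (Ud _))// ler_pM2l.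
Qed.

Lemma lattice_embeddable_trans (X Y Z : banachLatticeType R) :
  lattice_embeddable X Y -> lattice_embeddable Y Z -> lattice_embeddable X Z.
Proof.
move=> [T [bT iT [Tj _]]] [U [bU iU [Uj _]]].
have [S [/bounded_operatorP[C C0 SC] /isomorphism_onto_rangeP[c c0 Sc]]] :
  linearly_embeddable X Z by apply: linearly_embeddable_trans; [exists T|exists U].
have /bounded_operatorP[C1 C10 TC] := bT; have /isomorphism_onto_rangeP[c1 c10 Tc] := iT.
have /bounded_operatorP[C2 C20 UC] := bU; have /isomorphism_onto_rangeP[c2 c20 Uc] := iU.
apply: (@lattice_embeddable_of _ _ (U \o T) (c2 * c1) (C2 * C1)).
- by move=> a x y /=; rewrite !linearP.
- by move=> x y /=; rewrite Tj Uj.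
- by move=> x /=; rewrite (le_trans (UC _))// -mulrA ler_pM2l.
- exact: mulr_gt0.
- by move=> x /=; rewrite -mulrA (le_trans _ (Uc _))// ler_pM2l.
Qed.

End embedding_criteria.

Lemma reval_homo (R : realType) T (w : T -> R) (a : R) s : 0 <= a ->
  reval (fun i => a * w i) s = a * reval w s.
Proof.
move=> a0; elim: s => [i||s IHs t IHt|s IH|b s IH|s IHs t IHt|s IHs t IHt] //=.
- by rewrite mulr0.
- by rewrite IHs IHt mulrDr.
- by rewrite IH mulrN.
- by rewrite IH mulrCA.
- by rewrite IHs IHt maxr_pMr.
- by rewrite IHs IHt minr_pMr.
Qed.

Lemma reval_continuous (R : realType) T (w : R -> T -> R) s :
  (forall i, continuous (w ^~ i)) -> continuous (fun x => reval (w x) s).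
Proof.
move=> cw; elim: s => [i||s IHs t IHt|s IH|b s IH|s IHs t IHt|s IHs t IHt] //= x.
- exact: cvg_cst.
- exact: (cvgD (IHs x) (IHt x)).
- exact: (cvgN (IH x)).
- exact: (cvgM (cvg_cst b) (IH x)).
- exact: (continuous_max (IHs x) (IHt x)).
- exact: (continuous_min (IHs x) (IHt x)).
Qed.

Fixpoint lmap (R S T : Type) (f : S -> T) (s : lterm R S) : lterm R T :=
  match s with
  | LVar i => LVar (f i)
  | LZero => LZero
  | LAdd s t => LAdd (lmap f s) (lmap f t)
  | LOpp s => LOpp (lmap f s)
  | LScale a s => LScale a (lmap f s)
  | LJoin s t => LJoin (lmap f s) (lmap f t)
  | LMeet s t => LMeet (lmap f s) (lmap f t)
  end.

Lemma leval_map (R : realType) (Y : banachLatticeType R) S T (f : S -> T) v s :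
  leval v (lmap f s) = leval (v \o f : S -> Y) s.
Proof. by elim: s => //= [s -> t ->|s ->|a s ->|s -> t ->|s -> t ->]. Qed.

Lemma reval_map (R : realType) S T (f : S -> T) w s :
  reval w (lmap f s) = reval (w \o f : S -> R) s.
Proof. by elim: s => //= [s -> t ->|s ->|a s ->|s -> t ->|s -> t ->]. Qed.

(* The spectrum of [h / e] contains [0, 1]: some [z] of norm at least [d] lives
   where [h] is within [r e] of [t e]. *)
Definition good_pair (R : realType) (Y : banachLatticeType R) (e h : Y) (d : R) :=
  [/\ lle 0 h, lle h e, 0 < d &
   forall t r : R, 0 <= t <= 1 -> 0 < r -> exists z,
     [/\ lle 0 z, lle z e, d <= `|z| & lmeet z (lpos (labs (h - t *: e) - r *: e)) = 0]].

Section functional_calculus.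
Context {R : realType} {Y : banachLatticeType R}.
Variables (e h : Y) (d : R).
Hypothesis eh : good_pair e h d.

Let h0 : lle 0 h. Proof. by case: eh. Qed.
Let he : lle h e. Proof. by case: eh. Qed.
Let e0 : lle 0 e. Proof. exact: lleT h0 he. Qed.
Let d0 : 0 < d. Proof. by case: eh. Qed.

Let v (b : bool) : Y := if b then e else h.
Let w (x : R) (b : bool) : R := if b then 1 else x.

(** A real homomorphism sends [(e, h)] to a nonnegative multiple of [(1, x)] with [x] in the unit
    interval, so only these values need be tested. *)
Let term_le s t : (forall x, 0 <= x <= 1 -> reval (w x) s <= reval (w x) t) ->
  lle (leval v s) (leval v t).
Proof.
move=> st; apply: (@lattice_transfer _ _ _ _ e) => //.
  by move=> b; exists 1; rewrite scale1r; case: b; rewrite /v /=; [move: e0|move: h0 he]; vlat.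
move=> u mu.
have u0 : 0 <= u false by have := mu LZero (LVar false) h0.
have u1 : u false <= u true by have := mu (LVar false) (LVar true) he.
(* Where [u true] is 0, so is [u false], and the quotient, 0 by convention, is admissible. *)
have -> : u = (fun b => u true * w (u false / u true) b).
  apply/funext => -[] /=; first by rewrite mulr1.
  have [ut|ut] := eqVneq (u true) 0; last by rewrite mulrC divfK.
  by rewrite ut mul0r; apply/eqP; rewrite eq_le u0 andbT -ut.
rewrite !reval_homo ?(le_trans u0)//; apply: ler_wpM2l; first exact: le_trans u1.
apply: st; have [ut|ut] := eqVneq (u true) 0; first by rewrite ut invr0 mulr0 lexx ler01.
have ut0 : 0 < u true by rewrite lt0r ut (le_trans u0).
by rewrite divr_ge0 ?(ltW ut0)//= ler_pdivrMr// mul1r.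
Qed.

Let term_dist s t (a : R) : 0 <= a ->
  (forall x, 0 <= x <= 1 -> `|reval (w x) s - reval (w x) t| <= a) ->
  `|leval v s - leval v t| <= a * `|e|.
Proof.
move=> a0 H; apply: norm_le_scale => //.
pose u := LAdd s (LOpp t).
apply: (@term_le (LJoin u (LOpp u)) (LScale a (LVar true))) => x x01 /=.
by rewrite mulr1 maxrN; exact: H.
Qed.

(** The term is a minimum of cones of slope [M] with vertices on the graph of [f] over a grid. Near
    a vertex the uniform continuity of [f] decides; at distance [r] the cone has risen by twice the
    norm of [f] and cannot interfere. *)
Let approx (f : C01 R) (a : R) : 0 < a ->
  exists s, forall x, 0 <= x <= 1 -> `|C01_at f x - reval (w x) s| <= a.
Proof.
move=> a0; have a2 : 0 < a / 2 by rewrite divr_gt0.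
have [r r0 fr] := uniform_continuous01 (@C01_at_continuous _ f) a2.
pose M := 2 * `|f| / r; have M0 : 0 <= M by rewrite mulr_ge0 ?mulr_ge0// invr_ge0 ltW.
(* The mesh must be less than [r], and a cone must rise by less than [a / 2] over it. *)
pose N := (Num.truncn (Num.max r^-1 (2 * M / a))).+1.
have NN : Num.max r^-1 (2 * M / a) < N%:R.
  by rewrite /N truncnS_gt// le_max invr_ge0 ltW.
have N0 : 0 < N%:R :> R by rewrite ltr0n.
have N1 : N%:R^-1 < r by rewrite invf_plt ?posrE//; apply: le_lt_trans NN; rewrite le_max lexx.
have N2 : M / N%:R < a / 2.
  rewrite ltr_pdivrMr// mulrC -ltr_pdivrMr//; apply: le_lt_trans NN.
  by rewrite le_max invf_div mulrA [M * 2]mulrC lexx orbT.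
pose q k : R := k%:R / N%:R.
pose tm k : lterm R bool :=
  let u := LAdd (LVar false) (LScale (- q k) (LVar true)) in
  LAdd (LScale (C01_at f (q k)) (LVar true)) (LScale M (LJoin u (LOpp u))).
have rtm k x : reval (w x) (tm k) = C01_at f (q k) + M * `|x - q k|.
  by rewrite /= !mulr1 maxrN.
pose s := foldr (fun k => LMeet (tm k)) (tm 0%N) (iota 0 N.+1).
have s_le k x : (k <= N)%N -> reval (w x) s <= reval (w x) (tm k).
  rewrite /s; have : (k \in iota 0 N.+1) = (k <= N)%N by rewrite mem_iota add0n ltnS.
  move=> <-; elim: (iota 0 N.+1) => // j l IH; rewrite inE => /predU1P[->|/IH kl].
    by rewrite [leLHS]/= ge_min lexx.
  by rewrite [leLHS]/= ge_min kl orbT.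
have s_ge c x : (forall k, (k <= N)%N -> c <= reval (w x) (tm k)) -> c <= reval (w x) s.
  move=> H; rewrite /s; have : forall k, k \in iota 0 N.+1 -> (k <= N)%N.
    by move=> k; rewrite mem_iota add0n ltnS.
  elim: (iota 0 N.+1) => [_|j l IH jl]; first exact: H.
  rewrite [leRHS]/= le_min H ?jl ?inE ?eqxx//=; apply: IH => k kl.
  by apply: jl; rewrite inE kl orbT.
have q01 k : (k <= N)%N -> 0 <= q k <= 1.
  by move=> kN; rewrite divr_ge0//= ler_pdivrMr// mul1r ler_nat.
exists s => x /andP[x0 x1]; rewrite ler_norml; apply/andP; split.
  pose k := Num.truncn (x * N%:R).
  have xN0 : 0 <= x * N%:R by rewrite mulr_ge0// ltW.
  have kx : k%:R <= x * N%:R by rewrite /k truncn_le.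
  have xk : x * N%:R < k%:R + 1 by rewrite natr1 /k truncnS_gt.
  have kN : (k <= N)%N by rewrite -(ler_nat R) (le_trans kx)// ler_piMl// ltW.
  have qx : q k <= x by rewrite ler_pdivrMr.
  have xq : x - q k <= N%:R^-1.
    rewrite -(ler_pM2r N0) mulVf ?gt_eqF// mulrBl divfK ?gt_eqF//; lra.
  have := s_le k x kN; rewrite rtm ger0_norm ?subr_ge0// => sk.
  have := fr (q k) x (q01 k kN); rewrite distrC ger0_norm ?subr_ge0//.
  move=> /(_ (le_lt_trans xq N1)); rewrite ltr_norml => /andP[f1 f2].
  have := ler_wpM2l M0 xq; move: sk N2; lra.
rewrite lerBlDr -lerBlDl; apply: s_ge => k kN; rewrite rtm.
have [rx|rx] := ltP `|q k - x| r.
  have := fr (q k) x (q01 k kN) rx; rewrite ltr_norml => /andP[f1 f2].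
  by have := mulr_ge0 M0 (normr_ge0 (x - q k)); lra.
have : 2 * `|f| <= M * `|x - q k|.
  have -> : 2 * `|f| = M * r by rewrite /M divfK// gt_eqF.
  by rewrite distrC ler_wpM2l.
have := C01_at_norm f x; have := C01_at_norm f (q k).
by rewrite !ler_norml => /andP[? ?] /andP[? ?]; lra.
Qed.

(** [z] is [f(h / e) e]. Its distance to every term close to [f] is controlled, not only to the
    sequence defining it, so the identities of the calculus can be read on any approximations. *)
Let J_ex (f : C01 R) : exists z, forall s (a : R), 0 <= a ->
  (forall x, 0 <= x <= 1 -> `|C01_at f x - reval (w x) s| <= a) ->
  `|z - leval v s| <= a * `|e|.
Proof.
have p0 n : 0 < 2^-1 ^+ n :> R by rewrite exprn_gt0// invr_gt0.
have [s sP] := choice (fun n => approx f (p0 n)).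
have dist t n (a : R) : 0 <= a ->
    (forall x, 0 <= x <= 1 -> `|C01_at f x - reval (w x) t| <= a) ->
    `|leval v t - leval v (s n)| <= (a + 2^-1 ^+ n) * `|e|.
  move=> a0 ft; apply: term_dist => [|x x01]; first by rewrite addr_ge0// ltW.
  apply: le_trans (ler_distD (C01_at f x) _ _) _.
  by rewrite lerD ?sP// distrC ft.
have [|l lP] := @geometric_limit _ _ (fun n => leval v (s n)) (2 * `|e|).
  move=> n; apply: le_trans (dist (s n.+1) n (2^-1 ^+ n.+1) _ (sP n.+1)) _.
    exact: ltW.
  rewrite exprS; have := mulr_ge0 (ltW (p0 n)) (normr_ge0 e); lra.
exists l => t a a0 ft; apply: (@ler_geometric _ _ _ (5 * `|e|)) => n.
have := lP n; have := dist t n a a0 ft; have := ler_distD (leval v (s n)) l (leval v t).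
by rewrite (distrC (leval v t)) mulrDl; lra.
Qed.

Let eq_small (x y : Y) (K : R) : (forall a, 0 < a -> `|x - y| <= K * a) -> x = y.
Proof.
move=> H; apply/eqP; rewrite -subr_eq0 -normr_le0; apply/ler_addgt0Pr => a a0.
have K0 : 0 < `|K| + 1 by rewrite ltr_wpDl.
apply: le_trans (H _ (divr_gt0 a0 K0)) _; rewrite add0r mulrA ler_pdivrMr//.
by rewrite mulrC ler_wpM2l ?ltW//; have := ler_norm K; lra.
Qed.

Lemma good_pair_embeddable : lattice_embeddable (C01 R) Y.
Proof.
have [J JP] := choice J_ex.
apply: (@lattice_embeddable_of _ _ _ J (d / 2) `|e|).
- move=> a f g; apply: (@eq_small _ _ ((`|a| + 1) * (2 * `|e|))) => b b0.
  have [s fs] := approx f b0; have [t gt] := approx g b0.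
  have h1 := JP f s b (ltW b0) fs; have h2 := JP g t b (ltW b0) gt.
  have h3 : `|J (a *: f + g) - (a *: leval v s + leval v t)| <= (`|a| * b + b) * `|e|.
    apply: (JP _ (LAdd (LScale a s) t)) => [|x x01].
      by rewrite addr_ge0 ?mulr_ge0 ?(ltW b0).
    rewrite C01_atD C01_atZ /= opprD addrACA -mulrBr.
    apply: le_trans (ler_normD _ _) _; rewrite normrM lerD ?gt//.
    by rewrite ler_wpM2l// fs.
  rewrite -[J _](subrK (a *: leval v s + leval v t)) -addrA.
  apply: le_trans (ler_normD _ _) _.
  have -> : a *: leval v s + leval v t - (a *: J f + J g) =
      a *: (leval v s - J f) + (leval v t - J g).
    by rewrite scalerBr [in LHS]opprD addrACA.
  have := ler_normD (a *: (leval v s - J f)) (leval v t - J g).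
  rewrite normrZ (distrC _ (J f)) (distrC _ (J g)).
  have := ler_wpM2l (normr_ge0 a) h1; move: h2 h3; lra.
- move=> f g; apply: (@eq_small _ _ (4 * `|e|)) => b b0.
  have [s fs] := approx f b0; have [t gt] := approx g b0.
  have h1 := JP f s b (ltW b0) fs; have h2 := JP g t b (ltW b0) gt.
  have h3 : `|J (ljoin f g) - ljoin (leval v s) (leval v t)| <= (b + b) * `|e|.
    apply: (JP _ (LJoin s t)) => [|x x01]; first by rewrite addr_ge0 ?(ltW b0).
    rewrite C01_at_join /=; have := fs x x01; have := gt x x01.
    rewrite !ler_norml; move: (C01_at f x) (C01_at g x) (reval _ _) (reval _ _) => p q p' q'.
    by move=> /andP[? ?] /andP[? ?]; apply/andP; split;
      case: (leP p q) => ?; case: (leP p' q') => ?; lra.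
  have := norm_ljoinB (leval v s) (J f) (leval v t) (J g).
  rewrite (distrC _ (J f)) (distrC _ (J g)).
  have := ler_distD (ljoin (leval v s) (leval v t)) (J (ljoin f g)) (ljoin (J f) (J g)).
  by move: h1 h2 h3; lra.
- move=> f; rewrite mulrC -[J f]subr0; apply: (JP f LZero) => // x _ /=.
  by rewrite subr0; exact: C01_at_norm.
- by rewrite divr_gt0.
move=> f; have [f0|f0] := eqVneq `|f| 0; first by rewrite f0 mulr0.
set c := `|f| in f0 *; have c0 : 0 < c by rewrite lt0r f0 normr_ge0.
have [|x0 x001 fx0] := @C01_at_norm_gt _ f (3 / 4 * c); first by rewrite -/c; lra.
pose b := Num.min (c / 16) (d * c / (16 * (`|e| + 1))).
have e1 : 0 < `|e| + 1 by rewrite ltr_wpDl.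
have b0 : 0 < b.
  by rewrite lt_min; apply/andP; split; apply: divr_gt0 => //; apply: mulr_gt0.
have bc : b <= c / 16 by rewrite ge_min lexx.
have be : b * `|e| <= d * c / 16.
  have : b <= d * c / (16 * (`|e| + 1)) by rewrite ge_min lexx orbT.
  by rewrite !ler_pdivlMr ?mulr_gt0//; nra.
have [s fs] := approx f b0.
have cs : continuous (fun x => reval (w x) s).
  by apply: reval_continuous => -[] x /=; [exact: cvg_cst|exact: cvg_id].
have c16 : 0 < c / 16 by rewrite divr_gt0.
have /cvgrPdist_lt /(_ _ c16) := cs x0; rewrite nearE => /nbhs_ballP[r /= r0 rs].
have r2 : 0 < r / 2 by rewrite divr_gt0.
have [_ _ _ /(_ x0 _ x001 r2)[z [z0 ze dz zh]]] := eh.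
(* [z] lives where [h / e] is near [x0]. There the term exceeds [3 / 4 * c] less [c / 16] for the
   approximation and [c / 16] for continuity. In [v'], [None] is a variable for [z]. *)
have sz : lle ((5 / 8 * c) *: z) (labs (leval v s)).
  pose v' (i : option bool) := if i is Some b then v b else z.
  have vs : leval v s = leval v' (lmap Some s) by rewrite leval_map.
  rewrite vs.
  apply: (@lattice_transfer _ _ _ v' e _ e0 (LScale (5 / 8 * c) (LVar None))
    (LJoin (lmap Some s) (LOpp (lmap Some s)))) => [i|u mu].
    exists 1; rewrite scale1r; case: i => [[]|]; rewrite /v' /v; first by move: e0; vlat.
      by move: h0 he; vlat.
    by move: z0 ze; vlat.
  rewrite /= maxrN reval_map.
  have u0 : 0 <= u None by have := mu LZero (LVar None) z0.
  have u1 : u None <= u (Some true) by have := mu (LVar None) (LVar (Some true)) ze.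
  have uh0 : 0 <= u (Some false) by have := mu LZero (LVar (Some false)) h0.
  have uh1 : u (Some false) <= u (Some true).
    by have := mu (LVar (Some false)) (LVar (Some true)) he.
  pose dt := LAdd (LVar (Some false)) (LOpp (LScale x0 (LVar (Some true)))).
  have := @monotone_val_eq _ _ _ v' u
    (LMeet (LVar None) (LJoin (LAdd (LJoin dt (LOpp dt))
      (LOpp (LScale (r / 2) (LVar (Some true))))) LZero)) LZero mu zh.
  rewrite /= maxrN; move: u0; rewrite le_eqVlt => /predU1P[<-|u0].
    by rewrite mulr0.
  have ut : 0 < u (Some true) by exact: lt_le_trans u1.
  set x := u (Some false) / u (Some true).
  have uhx : u (Some false) = x * u (Some true) by rewrite divfK// gt_eqF.
  move=> mz; have xx0 : `|x - x0| <= r / 2.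
    rewrite -(ler_pM2r ut) -[X in _ * X <= _](gtr0_norm ut) -normrM mulrBl -uhx.
    by move: mz; case_minmax => *; lra.
  have x01 : 0 <= x <= 1 by rewrite /x divr_ge0// ?(ltW ut)//= ler_pdivrMr// mul1r.
  have -> : u \o Some = (fun b => u (Some true) * w x b).
    by apply/funext => -[] /=; rewrite ?mulr1// uhx mulrC.
  rewrite reval_homo ?(ltW ut)// normrM (gtr0_norm ut).
  have : `|reval (w x0) s - reval (w x) s| < c / 16.
    by apply: rs; rewrite -ball_normE /= distrC; lra.
  have := fs x0 x001.
  have := ler_distD (reval (w x0) s) (C01_at f x0) (reval (w x) s).
  have := ler_normD (C01_at f x0 - reval (w x) s) (reval (w x) s); rewrite subrK.
  move=> k1 k2 k3 k4; have : 5 / 8 * c <= `|reval (w x) s| by lra.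
  by move=> k5; rewrite mulrC; apply: ler_pM => //; rewrite ?ltW//; lra.
have := lle_norm_ge0 _ sz; rewrite norm_labs normrZ gtr0_norm; last by lra.
have -> : lle 0 ((5 / 8 * c) *: z) by apply: lle_scaler_ge0 => //; lra.
move=> /(_ isT) k1; have k2 := JP f s b (ltW b0) fs.
have := ler_normD (leval v s - J f) (J f); rewrite subrK distrC => k3.
have : 5 / 8 * c * d <= 5 / 8 * c * `|z| by rewrite ler_wpM2l//; lra.
have := mulr_gt0 c0 d0; lra.
Qed.

End functional_calculus.

(** * Linear copies of C[0,1] *)

Lemma infinite_injection (T : pointedType) (A : set T) : infinite_set A ->
  exists2 g : nat -> T, injective g & forall i, A (g i).
Proof.
move=> /infiniteP /pcard_leP/unsquash g; exists g.
  by move=> i j; apply: inj; rewrite inE.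
by move=> i; exact: funS.
Qed.

Section hats.
Context {R : realType}.

(* The hats of two words of the same length have disjoint supports, and the hat
   of [rcons s b] lives where the one of [s] is equal to [1]. *)
Fixpoint hat (s : seq bool) (u : R) : R :=
  if s is b :: s' then hat s' (8 * u + (if b then - 2 else 2))
  else Num.max 0 (Num.min 1 (2 - 2 * `|u|)).

Lemma hat_continuous s : continuous (hat s).
Proof.
elim: s => [|b s IH] x /=.
  have c2 : {for x, continuous (fun u : R => 2 - 2 * `|u|)}.
    apply: cvgB; first exact: cvg_cst.
    by apply: cvgM; [exact: cvg_cst|apply: cvg_norm; exact: cvg_id].
  have cst (a : R) : {for x, continuous (fun _ : R => a)} by exact: cvg_cst.
  exact: (continuous_max (cst 0) (continuous_min (cst 1) c2)).
apply: (@continuous_comp _ _ _ (fun u : R => 8 * u + (if b then - 2 else 2)) (hat s));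
  last exact: IH.
by apply: cvgD; [apply: cvgM; [exact: cvg_cst|exact: cvg_id]|exact: cvg_cst].
Qed.

Lemma hat_ge0 s u : 0 <= hat s u.
Proof. by elim: s u => //= u; rewrite le_max lexx. Qed.

Lemma hat_le1 s u : hat s u <= 1.
Proof. by elim: s u => //= u; rewrite ge_max ler01 ge_min lexx. Qed.

Lemma hat_supp s u : hat s u != 0 -> `|u| < 1.
Proof.
elim: s u => [|b s IH] u /=.
  by apply: contraNT; rewrite -leNgt => u1; apply/eqP; case_minmax => *; lra.
move=> /IH; rewrite !ltr_norml; case: b => /andP[? ?]; lra.
Qed.

Lemma hat_child b s u : hat (b :: s) u != 0 ->
  if b then 1 / 8 < u < 3 / 8 else - (3 / 8) < u < - (1 / 8).
Proof.
rewrite /= => /hat_supp; rewrite ltr_norml.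
by case: b => /andP[? ?]; apply/andP; split; lra.
Qed.

(** The head of a word fixes the coarsest scale and an appended letter acts at the finest one, so
    the claim reduces to the empty word, whose hat is 1 on the supports of its children. *)
Lemma hat_rcons s b u : hat (rcons s b) u <= hat s u.
Proof.
elim: s u => [|c s IH] u; last exact: IH.
have [->|h] := eqVneq (hat (rcons [::] b) u) 0; first exact: hat_ge0.
have := @hat_child b [::] u h; have -> : hat [::] u = 1; last by rewrite hat_le1.
have : `|u| < 3 / 8.
  move: (hat_child h); rewrite ltr_norml.
  by case: b {h} => /andP[? ?]; apply/andP; split; lra.
by move=> u3 /=; case_minmax => *; lra.
Qed.

Lemma hat_disjoint s s' u : size s = size s' -> s != s' -> hat s u = 0 \/ hat s' u = 0.
Proof.
elim: s s' u => [|b s IH] [|b' s'] u //= [ss'].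
have [<-|bb' _] := eqVneq b b'.
  by rewrite eqseq_cons eqxx => /(IH _ _ ss').
have [h|h] := eqVneq (hat (b :: s) u) 0; first by left.
have [h'|h'] := eqVneq (hat (b' :: s') u) 0; first by right.
have := hat_child h; have := hat_child h'.
by case: b b' bb' {h h'} => -[] // _ /andP[? ?] /andP[? ?]; lra.
Qed.

Lemma hat_top s : exists2 u, `|u| <= 1 & hat s u = 1.
Proof.
elim: s => [|b s [u u1 su]].
  exists 0; first by rewrite normr0 ler01.
  by rewrite /= normr0; case_minmax => *; lra.
exists ((u - (if b then - 2 else 2)) / 8).
  by move: u1; rewrite !ler_norml; case: b => /andP[? ?]; apply/andP; split; lra.
by rewrite /= mulrC divfK ?pnatr_eq0// subrK.
Qed.

End hats.

Section bounded_signs.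
Context {R : realType}.

Lemma signs_bounded_map (X : lmodType R) (Y : banachLatticeType R)
    (Phi : {linear X -> C01 R}) (T : {linear X -> Y}) (C : R) x xs :
  (forall z, `|T z| <= C * `|Phi z|) -> 0 <= C ->
  (forall u, 0 <= u <= 1 ->
     `|C01_at (Phi x) u| + \sum_(z <- xs) `|C01_at (Phi z) u| <= 1) ->
  signs_bounded C (T x) (map T xs).
Proof.
move=> TC C0; elim: xs x => [|z xs IH] x H /=.
  apply: le_trans (TC _) _; rewrite -[leRHS]mulr1 ler_wpM2l//.
  apply: C01_at_norm_le => u /H; rewrite big_nil addr0; apply.
rewrite -linearD -linearB; split; apply: IH => u u01; apply: le_trans (H u u01);
  rewrite big_cons addrA lerD2r.
  by rewrite linearD C01_atD; exact: ler_normD.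
by rewrite linearB; exact: ler_normB.
Qed.

End bounded_signs.

Section hat_tree.
Context {R : realType}.

Let hat_tree_continuous s : continuous (fun x : R => hat s (2 * x - 1)).
Proof.
move=> x; apply: (@continuous_comp _ _ _ (fun x : R => 2 * x - 1) (hat s)).
  by apply: cvgB; [apply: cvgM; [exact: cvg_cst|exact: cvg_id]|exact: cvg_cst].
exact: hat_continuous.
Qed.

Definition hat_tree (s : seq bool) : C01 R := sval (C01_mk (@hat_tree_continuous s)).

Lemma hat_treeE s x : 0 <= x <= 1 -> C01_at (hat_tree s) x = hat s (2 * x - 1).
Proof. exact: (svalP (C01_mk (@hat_tree_continuous s))). Qed.

Lemma hat_tree_ge1 s : 1 <= `|hat_tree s|.
Proof.
have [u u1 su] := hat_top (R := R) s.
have u01 : 0 <= (u + 1) / 2 <= 1.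
  by move: u1; rewrite ler_norml => /andP[? ?]; apply/andP; split; lra.
have := C01_at_norm (hat_tree s) ((u + 1) / 2); rewrite hat_treeE//.
by rewrite mulrC divfK ?pnatr_eq0// addrK su normr1.
Qed.

Definition branch := nat -> bool.

Lemma hat_tree_antitone (t : branch) n m x : 0 <= x <= 1 -> (n <= m)%N ->
  C01_at (hat_tree (mkseq t m)) x <= C01_at (hat_tree (mkseq t n)) x.
Proof.
move=> x01; rewrite !hat_treeE// => /subnKC <-.
elim: (m - n)%N => [|k IH]; first by rewrite addn0.
by rewrite addnS mkseqS (le_trans (hat_rcons _ _ _)).
Qed.

Lemma hat_tree_ge0 s x : 0 <= x <= 1 -> 0 <= C01_at (hat_tree s) x.
Proof. by move=> x01; rewrite hat_treeE// hat_ge0. Qed.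

Lemma hat_tree_le1 s x : 0 <= x <= 1 -> C01_at (hat_tree s) x <= 1.
Proof. by move=> x01; rewrite hat_treeE// hat_le1. Qed.

Lemma hat_tree_level (ss : seq (seq bool)) n x : 0 <= x <= 1 -> uniq ss ->
  all (fun s => size s == n) ss -> \sum_(s <- ss) `|C01_at (hat_tree s) x| <= 1.
Proof.
move=> x01; elim: ss => [|s ss IH] /=; first by rewrite big_nil ler01.
move=> /andP[sss uss] /andP[/eqP sn ssn]; rewrite big_cons.
have [->|s0] := eqVneq (C01_at (hat_tree s) x) 0.
  by rewrite normr0 add0r IH.
rewrite big_seq big1 ?addr0 => [|s' s'ss].
  by rewrite ger0_norm ?hat_tree_ge0 ?hat_tree_le1.
have ss' : s != s' by apply: contraNneq sss => ->.
have sz : size s = size s' by have /allP/(_ _ s'ss)/eqP := ssn; rewrite sn.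
have [] := hat_disjoint (2 * x - 1) sz ss'; rewrite -!hat_treeE//.
  by move=> h; rewrite h eqxx in s0.
by move=> ->; rewrite normr0.
Qed.

Lemma mkseq_separate (ts : seq branch) : uniq ts ->
  exists m0, forall m, (m0 <= m)%N -> uniq [seq mkseq t m | t <- ts].
Proof.
elim: ts => [|t ts IH] /=; first by exists 0%N.
move=> /andP[tts /IH[m0 H0]].
have [m1 H1] : exists m1, forall m t', (m1 <= m)%N -> t' \in ts -> mkseq t m != mkseq t' m.
  elim: ts tts {IH H0} => [|t' ts IH]; first by exists 0%N.
  rewrite inE negb_or => /andP[tt' /IH[m1 H1]].
  have [i ti] : exists i, t i != t' i.
    apply: contrapT => /forallNP H; case/eqP: tt'; apply/funext => i.
    by apply/eqP; have /negP := H i; rewrite negbK.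
  exists (maxn m1 i.+1) => m t''; rewrite geq_max => /andP[m1m im].
  rewrite inE => /predU1P[->|t''ts]; last exact: H1.
  by apply: contraNneq ti => /(congr1 (nth false ^~ i)); rewrite !nth_mkseq// => ->.
exists (maxn m0 m1) => m; rewrite geq_max => /andP[m0m m1m]; rewrite H0// andbT.
by apply/mapP => -[t' t'ts]; apply/eqP; exact: H1.
Qed.

End hat_tree.

(** * States along the branches of a dyadic tree *)

Section tree_states.
Context {R : realType} {Y : banachLatticeType R}.
Variables (T : {linear C01 R -> Y}) (C : R).
Hypothesis C0 : 0 < C.
Hypothesis T_le : forall f, `|T f| <= C * `|f|.
Hypothesis T_ge : forall f, `|f| <= `|T f|.

Let y (t : branch) n := T (hat_tree (mkseq t n)).

(** One state has to see all the nodes of the branch. If [u] is above [c] times a node and the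
    modulus of [T u] is below [g], the positive part of [g] has norm at least [c]; such pairs
    [(g, c)] form a cone because the nodes decrease along the branch. *)
Lemma branch_state (t : branch) : exists2 mu, state mu & forall n, 1 <= mu (labs (y t n)).
Proof.
pose G (g : Y) (c : R) := 0 <= c /\ exists u N,
  lle (labs (T u)) g /\ lle (c *: hat_tree (mkseq t N)) u.
have [||||mu smu muG] := @state_cone _ _ G.
- split=> //; exists 0, 0%N; rewrite linear0 scale0r lle_refl.
  by rewrite labs_id ?lle_refl.
- move=> g c g' c' [c0 [u [N [ug fu]]]] [c0' [u' [N' [ug' fu']]]].
  split; first exact: addr_ge0.
  exists (u + u'), (maxn N N'); split.
    rewrite linearD; apply: lleT (labsD _ _) _; exact: lleD.
  rewrite scalerDl; apply: lleD.
    apply: lleT fu; apply: lleZ => //; apply/C01_atP => x x01.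
    by apply: hat_tree_antitone => //; rewrite leq_maxl.
  apply: lleT fu'; apply: lleZ => //; apply/C01_atP => x x01.
  by apply: hat_tree_antitone => //; rewrite leq_maxr.
- move=> a g c a0 [c0 [u [N [ug fu]]]]; split; first by rewrite mulr_ge0// ltW.
  exists (a *: u), N; split; last by rewrite -scalerA lleZ// ltW.
  rewrite linearZ /=; apply: lleT (lleZ (ltW a0) ug).
  by rewrite labsZ ?(ltW a0)// lle_refl.
- move=> g c [c0 [u [N [ug fu]]]].
  have f0 : lle 0 (hat_tree (R := R) (mkseq t N)).
    by apply/C01_atP => x x01; exact: hat_tree_ge0.
  have ug' : `|T u| <= `|lpos g|.
    by apply: lle_norm_labs; apply: lleT ug _; exact: (ljoin_ub _ _).1.
  apply: le_trans ug'; apply: le_trans (T_ge u).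
  apply: le_trans (lle_norm_ge0 (lle_scaler_ge0 _ _ c0 f0) fu).
  by rewrite normrZ ger0_norm// ler_peMr// hat_tree_ge1.
exists mu => // n; apply: muG; split=> //; exists (hat_tree (mkseq t n)), n.
by rewrite scale1r !lle_refl.
Qed.

Let signs_level (ss : seq (seq bool)) n : uniq ss -> all (fun s => size s == n) ss ->
  signs_bounded C 0 (map T (map hat_tree ss)).
Proof.
move=> uss ssn; rewrite -(linear0 T).
apply: (@signs_bounded_map _ _ _ idfun) => //; first exact: ltW.
move=> u u01; rewrite C01_at0 normr0 add0r big_map.
exact: hat_tree_level u01 uss ssn.
Qed.

(** Otherwise arbitrarily many successive differences along the branch would keep at least [eta] on
    [mu]. They telescope to at most 1 at every point, so their images have bounded signed sums,
    against Khintchine's inequality. *)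
Lemma state_cauchy mu (t : branch) (eta : R) : state mu -> 0 < eta ->
  exists n0, forall n m, (n0 <= n)%N -> (n0 <= m)%N -> mu (labs (y t n - y t m)) <= eta.
Proof.
move=> smu eta0; apply: contrapT => /forallNP H.
have {}H n0 : exists n m, [/\ (n0 <= n)%N, (n <= m)%N & eta <= mu (labs (y t n - y t m))].
  have /existsNP[n /existsNP[m /not_implyP[nn /not_implyP[mn /negP]]]] := H n0.
  rewrite -ltNge => /ltW; have [nm|/ltnW mn'] := leqP n m; first by exists n, m.
  by move=> h; exists m, n; split=> //; rewrite -(opprB (y t n)) labsN.
have chain N n0 : exists fs : seq (C01 R), [/\ size fs = N,
    forall f, f \in fs -> eta <= mu (labs (T f)) &
    forall x, 0 <= x <= 1 -> \sum_(f <- fs) `|C01_at f x| <=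
      C01_at (hat_tree (mkseq t n0)) x].
  elim: N n0 => [|N IH] n0.
    by exists [::]; split=> // x x01; rewrite big_nil hat_tree_ge0.
  have [n [m [n0n nm nmeta]]] := H n0; have [fs [fsN fseta fsx]] := IH m.
  exists ((hat_tree (mkseq t n) - hat_tree (mkseq t m)) :: fs); split.
  - by rewrite /= fsN.
  - by move=> f; rewrite inE => /predU1P[->|/fseta//]; rewrite linearB.
  - move=> x x01; rewrite big_cons C01_atD C01_atN ger0_norm; last first.
      by rewrite subr_ge0 hat_tree_antitone.
    have := fsx x x01; have := hat_tree_antitone t x01 n0n; lra.
pose M := (Num.truncn (2 * C / eta)).+1.
have [fs [fsN fseta fsx]] := chain (M ^ 2)%N 0%N.
have [] := @khintchine_exists _ _ mu C M eta (map T fs) smu.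
- by rewrite size_map.
- by [].
- rewrite -(linear0 T); apply: (@signs_bounded_map _ _ _ idfun) => //; first exact: ltW.
  move=> u u01; rewrite C01_at0 normr0 add0r; apply: le_trans (fsx u u01) _.
  exact: hat_tree_le1.
- by rewrite -ltr_pdivrMr// truncnS_gt// divr_ge0 ?mulr_ge0 ?ltW.
by move=> _ /mapP[f /fseta fe ->]; rewrite ltNge fe.
Qed.

(* Khintchine's inequality bounds the number of branches a state can charge. *)
Let edge (eta : R) mu t := forall m0, exists2 m, (m0 <= m)%N & eta <= mu (labs (y t m)).

(** An edge reaches [eta] at arbitrarily late levels only; by [state_cauchy] it keeps [eta / 2] at
    all late levels. Finitely many charged branches then share a level where their nodes are
    distinct, hence disjoint. *)
Let edges_bound eta : 0 < eta -> exists N, forall mu (ts : seq branch), state mu ->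
  uniq ts -> size ts = N -> exists2 t, t \in ts & ~ edge eta mu t.
Proof.
move=> eta0; pose M := (Num.truncn (2 * C / (eta / 2))).+1; exists (M ^ 2)%N => mu ts smu uts tsM.
apply: contrapT => H.
have {}H t : t \in ts -> edge eta mu t.
  by move=> tts; apply: contrapT => nedge; apply: H; exists t.
have eta2 : 0 < eta / 2 by rewrite divr_gt0.
have [m0 H0] : exists m0, forall m t, (m0 <= m)%N -> t \in ts -> eta / 2 <= mu (labs (y t m)).
  elim: ts H {uts tsM} => [|t ts IH] H; first by exists 0%N.
  have [t' t'ts|m1 H1] := IH; first by apply: H; rewrite inE t'ts orbT.
  have [n0 Hn0] := state_cauchy t smu eta2.
  have [n n0n etan] := H t (mem_head _ _) n0.
  exists (maxn m1 n0) => m t'; rewrite geq_max => /andP[m1m n0m].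
  rewrite inE => /predU1P[->|t'ts]; last exact: H1.
  have := Hn0 n m n0n n0m.
  have := state_le smu (labsD (y t n - y t m) (y t m)); rewrite subrK.
  have [-> _ _] := smu; lra.
have [m1 H1] := mkseq_separate uts; pose m := maxn m0 m1.
have [] := @khintchine_exists _ _ mu C M (eta / 2)
  (map T (map hat_tree [seq mkseq t m | t <- ts])) smu.
- by rewrite !size_map.
- by [].
- apply: (@signs_level _ m); first by apply: H1; rewrite leq_maxr.
  by apply/allP => _ /mapP[t _ ->]; rewrite size_mkseq.
- by rewrite -ltr_pdivrMr// truncnS_gt// divr_ge0 ?mulr_ge0 ?ltW.
rewrite -!map_comp => _ /mapP[t tts ->] /=.
by rewrite ltNge H0// leq_maxl.
Qed.

(** The states of a sequence in [E] charge countably many branches together, and [t1] is taken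
    outside of these. Its own state charges fewer than [N] branches, so it misses one of the first
    [N] members of the sequence. *)
Let free_pair (mu : branch -> Y -> R) (E : set branch) (eta : R) :
  (forall t, state (mu t)) -> 0 < eta -> ~ countable E ->
  exists t0 t1, [/\ E t0, E t1, ~ edge eta (mu t0) t1 & ~ edge eta (mu t1) t0].
Proof.
move=> smu eta0 Ec; have [N HN] := edges_bound eta0.
have infE : infinite_set E by move=> /finite_set_countable.
have [g ginj gE] := infinite_injection infE.
have fin i : finite_set [set t | edge eta (mu (g i)) t].
  apply: contrapT => /infinite_injection[f finj fE].
  have [||t /mapP[j _ ->]] := HN (mu (g i)) (map f (iota 0 N)) (smu _).
  - by rewrite map_inj_uniq ?iota_uniq.
  - by rewrite size_map size_iota.
  - by apply; exact: fE.
pose B := \bigcup_(i in [set: nat]) [set t | edge eta (mu (g i)) t].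
have [t1 [Et1 Bt1]] : exists t1, E t1 /\ ~ B t1.
  apply: contrapT => /forallNP H; apply: Ec.
  apply: (@sub_countable _ _ _ B); last first.
    by apply: bigcup_countable => // i _; exact: finite_set_countable.
  apply: subset_card_le => t Et; apply: contrapT => Bt; exact: (H t).
have [||t0 /mapP[j _ ->] t10] := HN (mu t1) (map g (iota 0 N)) (smu _).
- by rewrite map_inj_uniq ?iota_uniq.
- by rewrite size_map size_iota.
exists (g j), t1; split=> //.
by move=> ed; apply: Bt1; exists j.
Qed.

Lemma uncountable_branch : ~ countable [set: branch].
Proof.
move=> /countable_injP[f finj].
pose t : branch := fun n => ~~ xget point [set t : branch | f t = n] n.
have ft : xget point [set t' | f t' = f t] = t.
  by apply: finj; rewrite ?inE//; apply: (@xgetPex _ point [set t' | f t' = f t]); exists t.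
have : t (f t) = ~~ t (f t) by rewrite {1}/t ft.
by case: (t _).
Qed.

Section states.
Variable mu : branch -> Y -> R.
Hypothesis smu : forall t, state (mu t).
Hypothesis mu_ge1 : forall t n, 1 <= mu t (labs (y t n)).

Let good (x : Y) (d : R) t :=
  exists n0, forall n, (n0 <= n)%N -> d <= mu t (lmeet (labs (y t n)) x).
Let thick x d := ~ countable [set t | good x d t].

(** Every branch is good for the modulus of the image of one of its own nodes; words are countable
    and branches are not, so some node serves uncountably many. *)
Let thick_start : exists2 e, lle 0 e & thick e (1 / 2).
Proof.
apply: contrapT => H; apply: uncountable_branch.
have cs (s : seq bool) : countable [set t | good (labs (T (hat_tree s))) (1 / 2) t].
  by apply: contrapT => th; apply: H; exists (labs (T (hat_tree s))) => //; exact: labs_ge0.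
apply: (@sub_countable _ _ _ (\bigcup_(s in [set: seq bool])
  [set t | good (labs (T (hat_tree s))) (1 / 2) t])); last first.
  by apply: bigcup_countable => // s _; exact: cs.
apply: subset_card_le => t _.
have half : 0 < 1 / 2 :> R by rewrite divr_gt0.
have [n0 Hn0] := state_cauchy t (smu t) half.
exists (mkseq t n0) => //; exists n0 => n n0n; rewrite -/(y t n0).
have := Hn0 _ _ n0n (leqnn n0); have := mu_ge1 t n.
have : lle (labs (y t n) - labs (y t n - y t n0)) (lmeet (labs (y t n)) (labs (y t n0))).
  by vlat.
by move/(state_le (smu t)); rewrite stateB//; lra.
Qed.

(** Where [2 * e <= u], truncating by [u + - e] changes nothing, as [x <= e]. Elsewhere [b] itself
    is at most [c * u + s1 + d], hence at most the error terms. *)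
Let split_real (c b s0 s1 d x e u : R) : 0 <= c -> s0 + - s1 = c * u -> b <= s0 + d ->
  0 <= s1 -> 0 <= d -> 0 <= b -> 0 <= x -> x <= e ->
  Num.min b x <= Num.min b (Num.min x (Num.max (u + - e) 0)) + d + s1 + (2 * c) * e.
Proof.
move=> c0 su bs s10 d0 b0 x0 xe; have ce : 0 <= c * e by rewrite mulr_ge0// (le_trans x0).
have [ue|/ltW ue] := leP (2 * e) u.
  rewrite (max_l (_ : 0 <= u + - e)); last by lra.
  by rewrite (min_l (_ : x <= u + - e)); lra.
have := ler_wpM2l c0 ue => cu; case_minmax => *; lra.
Qed.

Let split_ineq (c : R) (B S0 S1 D x e u : Y) : 0 <= c -> lle B (S0 + D) ->
  lle 0 S1 -> lle 0 D -> lle 0 B -> lle 0 x -> lle x e -> S0 - S1 = c *: u ->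
  lle (lmeet B x) (lmeet B (lmeet x (lpos (u - e))) + D + S1 + (2 * c) *: e).
Proof. by move=> c0; lattice_to_real; exact: split_real. Qed.

(* Some two branches [t0] and [t1] of the uncountable set are not charged by the
   states of each other, and [u] is a multiple of the difference of their late
   nodes. *)
Lemma thick_split e x (d k : R) : lle 0 x -> lle x e -> 0 < k -> thick x d ->
  exists u, thick (lmeet x (lpos (u - e))) (d - k) /\
            thick (lmeet x (lpos (- u - e))) (d - k).
Proof.
(* The loss [k] is shared equally between the variation along the branch, the mass seen on the other
   branch and the truncation, which costs [2 * c] times the norm of [e]. *)
move=> x0 xe k0 th; pose c := k / (6 * (`|e| + 1)).
have e1 : 0 < `|e| + 1 by rewrite ltr_wpDl.
have c0 : 0 < c by rewrite divr_gt0// mulr_gt0.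
have ce : 2 * c * `|e| <= k / 3.
  have -> : k / 3 = 2 * c * (`|e| + 1) by rewrite /c; field; rewrite gt_eqF.
  by apply: ler_wpM2l; [rewrite mulr_ge0// ltW|rewrite lerDl].
have k3 : 0 < k / 3 by rewrite divr_gt0.
pose b s := labs (T (hat_tree s)).
pose u (ss : seq bool * seq bool) := c^-1 *: (b ss.1 - b ss.2).
pose G ss := [set t | good (lmeet x (lpos (u ss - e))) (d - k) t].
(* The candidates [u ss] are countably many. Discarding the branches good for a candidate that has
   only countably many of them leaves an uncountable set, where a single good branch makes its
   candidate thick. *)
pose D := \bigcup_(ss in [set ss | countable (G ss)]) G ss.
have Ec : ~ countable ([set t | good x d t] `\` D).
  move=> Ec; apply: th.
  pose F o := if o is Some ss then if `[< countable (G ss) >] then G ss else set0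
              else [set t | good x d t] `\` D.
  apply: (@sub_countable _ _ _ (\bigcup_(o in [set: option (seq bool * seq bool)]) F o)).
    apply: subset_card_le => t gt; have [[ss ssc tss]|Dt] := pselect (D t).
      by exists (Some ss) => //; rewrite /F asboolT.
    by exists None.
  apply: bigcup_countable => // -[ss|] _ //=; case: asboolP => // _.
have [t0 [t1 [[g0 D0] [g1 D1] n01 n10]]] := free_pair smu k3 Ec.
have nedge t t' : ~ edge (k / 3) (mu t) t' ->
    exists m0, forall m, (m0 <= m)%N -> mu t (labs (y t' m)) <= k / 3.
  move=> /existsNP[m0 H]; exists m0 => m mm; rewrite leNgt; apply/negP => /ltW h.
  by apply: H; exists m.
have [m1 H1] := nedge _ _ n01; have [m2 H2] := nedge _ _ n10.
have [m3 H3] := state_cauchy t0 (smu t0) k3; have [m4 H4] := state_cauchy t1 (smu t1) k3.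
pose m := maxn (maxn m1 m2) (maxn m3 m4).
have mm1 : (m1 <= m)%N by rewrite /m !leq_max leqnn.
have mm2 : (m2 <= m)%N by rewrite /m !leq_max leqnn !orbT.
have mm3 : (m3 <= m)%N by rewrite /m !leq_max leqnn !orbT.
have mm4 : (m4 <= m)%N by rewrite /m !leq_max leqnn !orbT.
have key t t' p : mu t (labs (y t' m)) <= k / 3 -> (p <= m)%N ->
    (forall n n', (p <= n)%N -> (p <= n')%N -> mu t (labs (y t n - y t n')) <= k / 3) ->
    good x d t -> good (lmeet x (lpos (u (mkseq t m, mkseq t' m) - e))) (d - k) t.
  move=> tt' pm tn [n0 Hn0]; exists (maxn n0 m) => n; rewrite geq_max => /andP[n0n mn].
  have := Hn0 n n0n; have := tn _ _ (leq_trans pm mn) pm.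
  have hb : lle (labs (y t n)) (labs (y t m) + labs (y t n - y t m)) by vlat.
  have hu : labs (y t m) - labs (y t' m) = c *: u (mkseq t m, mkseq t' m).
    by rewrite /u scalerA mulfV ?gt_eqF// scale1r.
  have := state_le (smu t) (split_ineq (ltW c0) hb (labs_ge0 _) (labs_ge0 _)
    (labs_ge0 _) x0 xe hu).
  have [muD muZ _] := smu t; rewrite !muD muZ.
  have := ler_wpM2l (_ : 0 <= 2 * c) (state_norm e (smu t)).
  by rewrite mulr_ge0// ?(ltW c0)// => /(_ isT); move: tt' ce; lra.
have fin t t' : ~ D t -> good (lmeet x (lpos (u (mkseq t m, mkseq t' m) - e))) (d - k) t ->
    thick (lmeet x (lpos (u (mkseq t m, mkseq t' m) - e))) (d - k).
  by move=> Dt gt cc; apply: Dt; exists (mkseq t m, mkseq t' m).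
exists (u (mkseq t0 m, mkseq t1 m)); split.
  by apply: (fin t0) => //; apply: (key _ _ m3) => //; exact: H1.
have -> : - u (mkseq t0 m, mkseq t1 m) = u (mkseq t1 m, mkseq t0 m).
  by rewrite /u -scalerN opprB.
by apply: (fin t1) => //; apply: (key _ _ m4) => //; exact: H2.
Qed.

Lemma thick_norm x d : lle 0 x -> thick x d -> d <= `|x|.
Proof.
move=> x0 th; have [t [n0 Hn0]] : exists t, good x d t.
  apply: contrapT => /forallNP H; apply: th.
  by rewrite (_ : [set t | _] = set0) ?countable0// -subset0 => t /H.
apply: le_trans (Hn0 n0 (leqnn _)) _; apply: le_trans (state_norm _ (smu t)) _.
apply: lle_norm_ge0; last by rewrite (lmeet_lb _ _).2.
by rewrite lmeetP labs_ge0.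
Qed.

Lemma splitting_tree : exists2 e : Y, lle 0 e &
  exists P : nat -> Y -> Prop, [/\ P 0%N e,
    forall n x, P n x -> [/\ lle 0 x, lle x e & 1 / 4 <= `|x|] &
    forall n x, P n x -> exists u,
      P n.+1 (lmeet x (lpos (u - e))) /\ P n.+1 (lmeet x (lpos (- u - e)))].
Proof.
have [e e0 the] := thick_start.
(* Step [n] loses [2^-1 ^+ n / 8]; all the losses add up to [1 / 4], half of the initial [1 / 2]. *)
pose d n : R := 1 / 4 + 2^-1 ^+ n / 4.
exists e => //; exists (fun n x => [/\ lle 0 x, lle x e & thick x (d n)]); split.
- split=> //; first exact: lle_refl.
  by have -> : d 0%N = 1 / 2 by rewrite /d expr0; lra.
- move=> n x [x0 xe thx]; split=> //; apply: le_trans (thick_norm x0 thx).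
  by rewrite /d lerDl divr_ge0// exprn_ge0// invr_ge0.
- move=> n x [x0 xe thx].
  have k0 : 0 < 2^-1 ^+ n / 8 :> R by rewrite divr_gt0// exprn_gt0// invr_gt0.
  have [u [th1 th2]] := thick_split x0 xe k0 thx; exists u.
  have dS : d n - 2^-1 ^+ n / 8 = d n.+1 by rewrite /d exprS; lra.
  rewrite dS in th1 th2.
  by split; split=> //; rewrite ?lmeetP ?x0 ?lpos_ge0//; apply: lleT xe;
    rewrite (lmeet_lb _ _).1.
Qed.

End states.

End tree_states.

(** * Binary digits along a splitting tree *)

Section glue.
Context {R : realType} {Y : banachLatticeType R}.
Implicit Types x y z e u : Y.

(* [(e + b) / 2] where [u >= e], and [a / 2] where [u <= - e] *)
Definition glue u e a b : Y :=
  2^-1 *: (lmeet a (lmeet (lpos (- u)) e) + lmeet (lpos u) e + lmeet b (lmeet (lpos u) e)).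

Let glue_real (u e a b : R) : 0 <= a -> 0 <= b -> 0 <= e ->
  2^-1 * (Num.min a (Num.min (Num.max (- u) 0) e) + Num.min (Num.max u 0) e +
          Num.min b (Num.min (Num.max u 0) e)) =
  if 0 <= u then 2^-1 * (Num.min u e + Num.min b (Num.min u e))
  else 2^-1 * Num.min a (Num.min (- u) e).
Proof.
move=> a0 b0 e0; have [u0|/ltW u0] := leP 0 u.
  rewrite (max_r (_ : - u <= 0)) ?oppr_le0// (min_l e0) (min_r a0).
  by rewrite add0r.
rewrite (max_l (_ : 0 <= - u)) ?oppr_ge0// (min_l e0) (min_r b0) !addr0.
by [].
Qed.

Lemma glue_bounds u e a b : lle 0 e -> lle 0 a -> lle a e -> lle 0 b -> lle b e ->
  lle 0 (glue u e a b) /\ lle (glue u e a b) e.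
Proof.
move=> e0 a0 ae b0 be; split; move: e0 a0 ae b0 be; rewrite /glue;
  lattice_to_real => e0 a0 ae b0 be; rewrite glue_real//.
  by case: ifP => u0; case_minmax => *; lra.
by case: ifP => u0; case_minmax => *; lra.
Qed.

Lemma glue_lip u e a b a' b' r : lle 0 e -> lle 0 a -> lle 0 a' -> lle 0 b -> lle 0 b' ->
  lle (labs (a - a')) r -> lle (labs (b - b')) r ->
  lle (labs (glue u e a b - glue u e a' b')) (2^-1 *: r).
Proof.
rewrite /glue; lattice_to_real; rewrite !maxrN => e0 a0 a0' b0 b0' ar br.
rewrite !glue_real//; move: ar br; rewrite !ler_norml => /andP[? ?] /andP[? ?].
by apply/andP; split; case: ifP => _; case_minmax => *; lra.
Qed.

Let far (z b t r : R) : 0 < z -> Num.min z (Num.max (`|b - t| - r) 0) = 0 ->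
  Num.min z (Num.max (`|2^-1 * b - 2^-1 * t| - 2^-1 * r) 0) = 0.
Proof.
rewrite -mulrBr normrM (ger0_norm (_ : 0 <= 2^-1)) ?invr_ge0// -mulrBr.
by case_minmax => *; lra.
Qed.

Let glueR (u e a b : R) :=
  2^-1 * (Num.min a (Num.min (Num.max (- u) 0) e) + Num.min (Num.max u 0) e +
          Num.min b (Num.min (Num.max u 0) e)).

Let glue_true_real (u e a b z t r : R) :
  Num.min z (Num.max (`|b - t| - r) 0) = 0 -> 0 <= e -> 0 <= a -> 0 <= b -> b <= e ->
  0 <= z -> z <= Num.max (u - e) 0 ->
  Num.min z (Num.max (`|glueR u e a b - 2^-1 * (e + t)| - 2^-1 * r) 0) = 0.
Proof.
move=> zb e0 a0 b0 be z0 zu; rewrite /glueR glue_real//.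
move: z0; rewrite le_eqVlt => /predU1P[<-|z0]; first by rewrite min_l// le_max lexx orbT.
have [eu u0] : e <= u /\ 0 <= u by move: zu; case: (leP (u - e) 0) => *; split; lra.
rewrite u0 (min_r eu) (min_l be) mulrDr mulrDr.
have -> : 2^-1 * e + 2^-1 * b - (2^-1 * e + 2^-1 * t) = 2^-1 * b - 2^-1 * t by ring.
exact: far.
Qed.

Let glue_false_real (u e a b z t r : R) :
  Num.min z (Num.max (`|a - t| - r) 0) = 0 -> 0 <= e -> 0 <= a -> 0 <= b -> a <= e ->
  0 <= z -> z <= Num.max (- u - e) 0 ->
  Num.min z (Num.max (`|glueR u e a b - 2^-1 * t| - 2^-1 * r) 0) = 0.
Proof.
move=> zb e0 a0 b0 ae z0 zu; rewrite /glueR glue_real//.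
move: z0; rewrite le_eqVlt => /predU1P[<-|z0]; first by rewrite min_l// le_max lexx orbT.
have [eu u0] : e <= - u /\ u < 0 by move: zu; case: (leP (- u - e) 0) => *; split; lra.
by rewrite leNgt u0 /= (min_r eu) (min_l ae); exact: far.
Qed.

(** Where [z] does not vanish, [u >= e] and the glued vector is exactly half of [e + b]; the error
    is halved with it. *)
Lemma glue_true u e a b z t r : lle 0 e -> lle 0 a -> lle 0 b -> lle b e -> lle 0 z ->
  lle z (lpos (u - e)) -> lmeet z (lpos (labs (b - t) - r)) = 0 ->
  lmeet z (lpos (labs (glue u e a b - 2^-1 *: (e + t)) - 2^-1 *: r)) = 0.
Proof. by rewrite /glue; lattice_to_real; rewrite !maxrN; exact: glue_true_real. Qed.

Lemma glue_false u e a b z t r : lle 0 e -> lle 0 a -> lle 0 b -> lle a e -> lle 0 z ->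
  lle z (lpos (- u - e)) -> lmeet z (lpos (labs (a - t) - r)) = 0 ->
  lmeet z (lpos (labs (glue u e a b - 2^-1 *: t) - 2^-1 *: r)) = 0.
Proof. by rewrite /glue; lattice_to_real; rewrite !maxrN; exact: glue_false_real. Qed.

End glue.

Lemma lmeet_lpos_le (R : realType) (Y : banachLatticeType R) (z a b : Y) :
  lle a b -> lle 0 z -> lmeet z (lpos b) = 0 -> lmeet z (lpos a) = 0.
Proof. by vlat. Qed.

Section tree_to_pair.
Context {R : realType} {Y : banachLatticeType R}.
Variables (e : Y) (P : nat -> Y -> Prop) (d : R).
Hypothesis e0 : lle 0 e.
Hypothesis Pe : P 0%N e.
Hypothesis Pd : forall n x, P n x -> [/\ lle 0 x, lle x e & d <= `|x|].
Hypothesis Psplit : forall n x, P n x -> exists u,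
  P n.+1 (lmeet x (lpos (u - e))) /\ P n.+1 (lmeet x (lpos (- u - e))).

(* The binary digits of [h / e] at a node of the tree are the path to that node. *)
Lemma splitting_tree_good_pair : 0 < d -> exists h, good_pair e h d.
Proof.
move=> d0.
have /choice[u uP] : forall nx : nat * Y, exists v, P nx.1 nx.2 ->
    P nx.1.+1 (lmeet nx.2 (lpos (v - e))) /\ P nx.1.+1 (lmeet nx.2 (lpos (- v - e))).
  move=> [n x] /=; have [/Psplit[v Pv]|nP] := pselect (P n x); first by exists v.
  by exists 0.
pose child (b : bool) n x :=
  lmeet x (lpos ((if b then u (n, x) else - u (n, x)) - e)).
have Pchild b n x : P n x -> P n.+1 (child b n x).
  by move=> /(uP (n, x))[]; case: b.
pose node := fix node n x (s : seq bool) :=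
  if s is b :: s' then node n.+1 (child b n x) s' else x.
(* [H k n x] computes the first [k] digits below the node [x], the remaining ones being 0. *)
pose H := fix H k n x := if k is k'.+1 then
    glue (u (n, x)) e (H k' n.+1 (child false n x)) (H k' n.+1 (child true n x))
  else 0.
pose val := fix val (s : seq bool) : R :=
  if s is b :: s' then 2^-1 * (b%:R + val s') else 0.
have Hb k n x : lle 0 (H k n x) /\ lle (H k n x) e.
  elim: k n x => [|k IH] n x; first by rewrite lle_refl.
  have [a0 ae] := IH n.+1 (child false n x); have [b0 be] := IH n.+1 (child true n x).
  by rewrite /=; apply: glue_bounds.
have HS k n x : lle (labs (H k.+1 n x - H k n x)) (2^-1 ^+ k *: e).
  elim: k n x => [|k IH] n x.
    have [h0 he] := Hb 1%N n x; rewrite [H 0%N n x]/= subr0 expr0 scale1r.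
    by rewrite labs_id.
  rewrite exprS -scalerA; apply: glue_lip;
    [exact: e0|exact: (Hb k.+1 n.+1 _).1|exact: (Hb k n.+1 _).1
    |exact: (Hb k.+1 n.+1 _).1|exact: (Hb k n.+1 _).1|exact: IH|exact: IH].
have node_le s n x : lle (node n x s) x.
  elim: s n x => [|b s IH] n x /=; first exact: lle_refl.
  by apply: lleT (IH _ _) _; exact: (lmeet_lb _ _).1.
have Pnode s n x : P n x -> exists m, P m (node n x s).
  by elim: s n x => [|b s IH] n x Px /=; [exists n|apply: IH; exact: Pchild].
(* A node lives where the choices of its path are made, so there [H] has the digits of the path, up
   to the weight of the later ones. *)
have Hnode s k n x : P n x -> (size s <= k)%N ->
    lmeet (node n x s) (lpos (labs (H k n x - val s *: e) - 2^-1 ^+ size s *: e)) = 0.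
  elim: s k n x => [|b s IH] k n x Px sk.
    rewrite [val _]/= scale0r subr0 expr0 scale1r [node _ _ _]/=.
    have [h0 he] := Hb k n x; have [x0 _ _] := Pd Px.
    by rewrite labs_id// (lpos_eq0 (x := _ - _)) ?lle_sub0//; move: x0; vlat.
  case: k sk => // k sk; have Pc := Pchild b n x Px.
  have := IH k _ _ Pc sk; have := node_le s n.+1 (child b n x).
  have [m /Pd[z0 _ _]] := Pnode s _ _ Pc.
  have [a0 ae] := Hb k n.+1 (child false n x); have [b0 be] := Hb k n.+1 (child true n x).
  rewrite [node _ _ (b :: s)]/= [val (b :: s)]/= [size (b :: s)]/= exprS -!scalerA.
  rewrite [H k.+1 n x]/=; set z := node _ _ s in z0 *.
  move=> zc; have {zc} : lle z (lpos ((if b then u (n, x) else - u (n, x)) - e)).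
    by apply: lleT zc _; exact: (lmeet_lb _ _).2.
  case: b sk Pc @z z0 => _ Pc z z0 zu IHz.
    by rewrite scalerDl scale1r; apply: glue_true.
  by rewrite add0r; apply: glue_false.
have dyadic n (t : R) : 0 <= t <= 1 -> exists2 s, size s = n & `|t - val s| <= 2^-1 ^+ n.
  elim: n t => [|n IH] t t01.
    by exists [::] => //=; rewrite subr0 expr0 ger0_norm; case/andP: t01.
  have [t2|/ltW t2] := leP (2 * t) 1.
    have [|s sn ts] := IH (2 * t); first by apply/andP; split=> //; case/andP: t01; lra.
    exists (false :: s); first by rewrite /= sn.
    rewrite /= add0r exprS -[t in `|t - _|](@mulKf _ 2) ?pnatr_eq0//.
    by rewrite -mulrBr normrM ger0_norm ?invr_ge0// ler_wpM2l ?invr_ge0.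
  have [|s sn ts] := IH (2 * t - 1); first by apply/andP; split=> //; case/andP: t01; lra.
  exists (true :: s); first by rewrite /= sn.
  have -> : t - val (true :: s) = 2^-1 * (2 * t - 1 - val s) by rewrite /=; field.
  by rewrite exprS normrM ger0_norm ?invr_ge0// ler_wpM2l ?invr_ge0.
have [|h hP] := @geometric_limit _ Y (fun k => H k 0%N e) `|e|.
  move=> k; rewrite mulrC; apply: norm_le_scale (HS _ _ _).
  by rewrite exprn_ge0// invr_ge0.
have e1 : 0 < 2 * `|e| + 1 by rewrite ltr_wpDl// mulr_ge0.
have happrox (a : R) : 0 < a -> exists k0, forall k, (k0 <= k)%N -> `|h - H k 0%N e| <= a.
  move=> a0; have [k0 hk0] := expr2V_small (divr_gt0 a0 e1).
  exists k0 => k k0k; apply: le_trans (hP k) _.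
  have : 2^-1 ^+ k <= a / (2 * `|e| + 1).
    by apply: le_trans hk0; apply: ler_wiXn2l => //; rewrite ?invr_ge0// invf_le1// ler1n.
  rewrite ler_pdivlMr// => h1; have p0 : 0 <= 2^-1 ^+ k :> R by rewrite exprn_ge0// invr_ge0.
  by nra.
exists h; split=> //.
- apply: lle_approx => a /happrox[k0 /(_ k0 (leqnn _)) hk].
  exists (h - H k0 0%N e); first by rewrite sub0r normrN.
  by have [h0 _] := Hb k0 0%N e; move: (H _ _ _) h0 => g; vlat.
- apply: lle_approx => a /happrox[k0 /(_ k0 (leqnn _)) hk].
  by exists (H k0 0%N e) => //; exact: (Hb _ _ _).2.
(* Half of [r] allows for the dyadic approximation of [t], the other half for the digits after the
   path. *)
move=> t r t01 r0; have [n nr] := expr2V_small (divr_gt0 r0 (ltr0Sn _ 1)).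
have [s sn ts] := dyadic n t t01; have [m Pz] := Pnode s 0%N e Pe.
have [z0 ze zd] := Pd Pz; exists (node 0%N e s); split=> //.
set z := node 0%N e s in Pz z0 ze zd *.
have Hz k : (n <= k)%N -> lmeet z (lpos (labs (H k 0%N e - t *: e) - r *: e)) = 0.
  rewrite -sn => nk; have := Hnode s k 0%N e Pe nk; rewrite sn -/z.
  have : lle (labs (t *: e - val s *: e)) (2^-1 ^+ n *: e).
    rewrite labs_le -scalerBl -scaleNr; move: ts; rewrite ler_norml => /andP[? ?].
    by rewrite !lleZr//; lra.
  have : lle (2^-1 ^+ n *: e + 2^-1 ^+ n *: e) (r *: e) by rewrite -scalerDl lleZr//; lra.
  move: (t *: e) (val s *: e) (r *: e) (2^-1 ^+ n *: e) (H _ _ _) => te ve re q g qre tv.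
  apply: lmeet_lpos_le z0; move: qre tv; vlat.
apply/eqP; rewrite -normr_le0; apply/ler_addgt0Pr => a a0; rewrite add0r.
have [|k0 /(_ (maxn n k0) (leq_maxr _ _)) hk] := happrox (a / 2); first by rewrite divr_gt0.
rewrite -[X in `|X|]subr0 -(Hz (maxn n k0) (leq_maxl _ _)).
apply: le_trans (norm_lmeetB _ _ _ _) _; rewrite subrr normr0 add0r.
apply: le_trans (norm_ljoinB _ _ _ _) _; rewrite subrr normr0 addr0.
set g := H _ _ _ in hk *.
have -> : labs (h - t *: e) - r *: e - (labs (g - t *: e) - r *: e) =
   labs (h - t *: e) - labs (g - t *: e) by rewrite opprB addrA subrK.
apply: le_trans (norm_ljoinB _ _ _ _) _.
rewrite -opprD normrN opprB addrA subrK; lra.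
Qed.

End tree_to_pair.

Lemma C01_linearly_embeddable (R : realType) (Y : banachLatticeType R) :
  linearly_embeddable (C01 R) Y -> lattice_embeddable (C01 R) Y.
Proof.
move=> [T0 [/bounded_operatorP[C0 C00 TC0] /isomorphism_onto_rangeP[c c0 Tc]]].
have [T TE] : exists T : {linear C01 R -> Y}, forall f, T f = c^-1 *: T0 f.
  by apply: linear_of => a f g; rewrite linearP scalerDr !scalerA mulrC.
have c1 : 0 < c^-1 by rewrite invr_gt0.
have T_le f : `|T f| <= c^-1 * C0 * `|f|.
  by rewrite TE normrZ gtr0_norm// -mulrA ler_pM2l.
have T_ge f : `|f| <= `|T f|.
  by rewrite TE normrZ gtr0_norm// -[leLHS](mulKf (lt0r_neq0 c0)) ler_pM2l.
have C1 : 0 < c^-1 * C0 by rewrite mulr_gt0.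
have /choice[mu muP] : forall t : branch, exists mu : Y -> R,
    state mu /\ forall n, 1 <= mu (labs (T (hat_tree (mkseq t n)))).
  by move=> t; have [mu] := branch_state T_ge t; exists mu.
have [e e0 [P [Pe Pd Psplit]]] :=
  splitting_tree C1 T_le (fun t => (muP t).1) (fun t => (muP t).2).
have [|h eh] := splitting_tree_good_pair e0 Pe Pd Psplit; first by rewrite divr_gt0.
exact: good_pair_embeddable eh.
Qed.

(** * Sublattices of C[0,1] *)

Section sublattice_of_C01.
Context {R : realType} {X : banachLatticeType R}.
Variables (Phi : {linear X -> C01 R}) (C : R).
Hypothesis C0 : 0 < C.
Hypothesis Phi_le : forall x, `|Phi x| <= C * `|x|.
Hypothesis Phi_join : forall x y, Phi (ljoin x y) = ljoin (Phi x) (Phi y).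
Local Notation val x t := (C01_at (Phi x) t).

Let valD x y t : val (x + y) t = val x t + val y t.
Proof. by rewrite linearD. Qed.
Let valN x t : val (- x) t = - val x t.
Proof. by rewrite linearN. Qed.
Let valZ a x t : val (a *: x) t = a * val x t.
Proof. by rewrite linearZ. Qed.
Let val0 t : val 0 t = 0.
Proof. by rewrite linear0. Qed.
Let val_join x y t : val (ljoin x y) t = Num.max (val x t) (val y t).
Proof. by rewrite Phi_join. Qed.
Let val_meet x y t : val (lmeet x y) t = Num.min (val x t) (val y t).
Proof. by rewrite lmeetN valN val_join !valN oppr_max !opprK. Qed.

Lemma val_le x y t : lle x y -> val x t <= val y t.
Proof.
move=> xy; have -> : y = ljoin x y.
  apply: (@lle_anti _ X); rewrite ljoinP xy lle_refl.
  by rewrite (ljoin_ub _ _).2.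
by rewrite val_join le_max lexx.
Qed.

Lemma lmeet_scale_pos (a : R) (w : X) : 0 <= a ->
  lmeet (a *: lpos w) (lpos (- w)) = 0.
Proof.
move=> a0; lattice_to_real; move: (w0 0%N) => r.
have [r0|/ltW r0] := leP 0 r.
  by rewrite (max_r (_ : - r <= 0)) ?oppr_le0// min_r// mulr_ge0// le_max r0.
by rewrite mulr0 min_l// le_max lexx orbT.
Qed.

(* [h / e] is an affine function of [g / e] truncated to [0, 1]; by the
   intermediate value theorem it takes all these values. *)
Lemma ratio_good_pair e g p q : lle 0 e -> 0 <= p -> p <= q -> q <= 1 ->
  (forall t, p <= t <= q -> 0 < val e t) -> val g p * val e q < val g q * val e p ->
  exists h d, good_pair e h d.
Proof.
move=> e0 p0 pq q1 epos gpq.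
have ep : 0 < val e p by apply: epos; rewrite lexx pq.
have eq : 0 < val e q by apply: epos; rewrite lexx pq.
have within f : {within `[p, q], continuous (C01_at f)}.
  exact: continuous_subspaceT (@C01_at_continuous R f).
pose a := val g p / val e p; pose b := val g q / val e q.
have ab : a < b by rewrite /a /b ltr_pdivrMr// mulrAC ltr_pdivlMr.
have ba0 : 0 < b - a by rewrite subr_gt0.
(* Affine normalisation: [k / e] is 0 at [p] and 1 at [q]. *)
pose k := (b - a)^-1 *: (g - a *: e).
pose h := lmeet (lpos k) e.
have [c cpq ce] := derive.EVT_min pq (within (Phi e)).
have c0 : 0 < val e c by apply: epos; move: cpq; rewrite in_itv.
have ivt t : 0 <= t <= 1 -> exists2 x, p <= x <= q & val k x = t * val e x.
  move=> /andP[t0 t1]; pose v := a + t * (b - a).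
  have := @IVT R (C01_at (Phi (g - v *: e))) p q 0 pq (within _).
  have gp : val g p = a * val e p by rewrite divfK// gt_eqF.
  have gq : val g q = b * val e q by rewrite divfK// gt_eqF.
  rewrite !(valD, valN, valZ) gp gq -!mulrBl ge_min le_max.
  have -> : (a - v) * val e p <= 0 by rewrite pmulr_lle0// /v; nra.
  have -> : 0 <= (b - v) * val e q by rewrite pmulr_lge0// /v; nra.
  rewrite orbT => /(_ isT)[x xpq gx]; exists x; first by move: xpq; rewrite in_itv.
  have {}gx : val g x = v * val e x.
    by apply/eqP; rewrite -subr_eq0 -gx valD valN valZ.
  rewrite valZ valD valN valZ gx /v -mulrBl addrAC subrr add0r mulrA mulrCA.
  by rewrite mulVf ?gt_eqF// mulr1.
have h0 : lle 0 h by rewrite lmeetP lpos_ge0.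
have he : lle h e by rewrite (lmeet_lb _ _).2.
(* At a point where [h / e = t], the witness for [t] has the value of [e], which is at least the
   minimum [val e c]; dividing by [C] passes from the norm in [C01 R] to the norm in [X]. *)
exists h, (val e c / C); split=> //; first by rewrite divr_gt0.
move=> t r t01 r0; pose w := r *: e - labs (h - t *: e).
have re0 : lle 0 (r *: e) by apply: lle_scaler_ge0 => //; exact: ltW.
exists (r^-1 *: lpos w); split.
- by apply: lle_scaler_ge0; rewrite ?invr_ge0 ?ltW// lpos_ge0.
- have : lle (lpos w) (r *: e) by rewrite /w; move: re0; move: (labs_ge0 (h - t *: e)); vlat.
  move/(lleZ (_ : 0 <= r^-1)); rewrite scalerA mulVf ?gt_eqF// scale1r.
  by apply; rewrite invr_ge0 ltW.
- have [x /andP[px xq] kx] := ivt t t01; rewrite ler_pdivrMr//.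
  rewrite mulrC; apply: le_trans (Phi_le _).
  apply: le_trans (C01_at_norm _ x).
  have xpq : p <= x <= q by rewrite px.
  have hx : val h x = t * val e x.
    have /andP[t0 t1] := t01; have ex := ltW (epos x xpq).
    rewrite val_meet val_join val0 kx max_l ?mulr_ge0// min_l//.
    by rewrite ler_piMl.
  have -> : val (r^-1 *: lpos w) x = val e x.
    rewrite valZ val_join val0 valD valN val_join !(valN, valD, valZ) hx subrr oppr0.
    rewrite maxxx subr0 max_l; last by rewrite mulr_ge0 ?ltW// epos.
    by rewrite mulrA mulVf ?gt_eqF// mul1r.
  apply: le_trans (ler_norm _); apply: ce; by rewrite in_itv /= px.
- have -> : labs (h - t *: e) - r *: e = - w by rewrite /w opprB.
  by apply: lmeet_scale_pos; rewrite invr_ge0 ltW.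
Qed.

Lemma ratio_constant_or_good_pair :
  (exists e h d, good_pair (Y := X) e h d) \/
  (forall e g p q, lle 0 e -> 0 <= p -> p <= q -> q <= 1 ->
    (forall t, p <= t <= q -> 0 < val e t) -> val g p * val e q = val g q * val e p).
Proof.
have [|H] := pselect (exists e h d, good_pair (Y := X) e h d); first by left.
right=> e g p q e0 p0 pq q1 epos; apply: contrapT => /eqP; rewrite neq_lt.
case/orP => gpq; apply: H; exists e.
  exact: ratio_good_pair gpq.
apply: (@ratio_good_pair e (- g) p q) => //.
by rewrite !valN !mulNr ltrN2.
Qed.

End sublattice_of_C01.

Section limits.
Context {R : realType}.

Lemma geometric_sum (Y : banachLatticeType R) (b : nat -> Y) (C : R) :
  (forall n, lle 0 (b n)) -> (forall n, `|b n| <= C) ->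
  exists e, [/\ lle 0 e, `|e| <= 2 * C & forall n, lle (2^-1 ^+ n *: b n) e].
Proof.
move=> b0 bC; pose u N := \sum_(i < N) 2^-1 ^+ i *: b i.
have p0 n : 0 <= 2^-1 ^+ n :> R by rewrite exprn_ge0// invr_ge0.
have uS N : u N.+1 = u N + 2^-1 ^+ N *: b N by rewrite /u big_ord_recr.
have u_mono n k : lle (u n) (u (n + k)%N).
  elim: k => [|k IH]; first by rewrite addn0 lle_refl.
  apply: lleT IH _; rewrite addnS uS -[X in lle X _]addr0.
  by rewrite lleD ?lle_refl ?lle_scaler_ge0.
have [|e eP] := @geometric_limit _ Y u C.
  by move=> n; rewrite uS addrAC subrr add0r normrZ ger0_norm// mulrC ler_wpM2r.
have ue n : lle (u n) e.
  apply: lle_approx => a a0; have C1 : 0 < 2 * C + 1.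
    by rewrite ltr_wpDl// mulr_ge0// (le_trans _ (bC 0%N)).
  have [k ka] := expr2V_small (divr_gt0 a0 C1).
  exists (e - (u (n + k)%N - u n)).
    rewrite opprB addrC addrAC subrK distrC; apply: le_trans (eP _) _.
    move: ka; rewrite ler_pdivlMr// => ka; have := p0 (n + k)%N.
    have : 2^-1 ^+ (n + k) <= 2^-1 ^+ k :> R.
      by rewrite exprD ler_piMl// exprn_ile1// ?invr_ge0// invf_le1// ler1n.
    by move: C1; nra.
  by rewrite -lle_0sub opprB addrCA subrr addr0 lle_0sub.
exists e; split.
- by have := ue 0%N; rewrite /u big_ord0.
- by have := eP 0%N; rewrite /u big_ord0 subr0 expr0 mulr1.
- move=> n; apply: lleT (ue n.+1); rewrite uS -[X in lle X _]add0r.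
  by rewrite lleD ?lle_refl//; have := u_mono 0%N n; rewrite /u big_ord0.
Qed.

Lemma dense_sequence (X : completeNormedModType R) : separable_space X ->
  exists d : nat -> X, forall g (r : R), 0 < r -> exists n, `|g - d n| < r.
Proof.
move=> [D [/countable_injP[f finj] dD]].
pose d n := xget 0 (D `&` [set x | f x = n]).
exists d => g r r0; have [|x [gx Dx]] := dD (ball g r) _ (ball_open _ _).
  by exists g; exact: ballxx.
exists (f x); have [Dd fd] : (D `&` [set z | f z = f x]) (d (f x)).
  by apply: xgetPex; exists x.
have -> : d (f x) = x by apply: finj; rewrite ?inE.
by move: gx; rewrite -ball_normE.
Qed.

End limits.

Lemma cauchy_limit (R : realType) (Y : completeNormedModType R) (u : nat -> Y) :
  (forall e : R, 0 < e -> exists n, forall m, (n <= m)%N -> `|u m - u n| <= e) ->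
  exists l, forall e : R, 0 < e -> exists n, forall m, (n <= m)%N -> `|l - u m| <= e.
Proof.
move=> H; have cu : cvg (u @ \oo).
  apply: cauchy_cvg; apply: cauchy_exP => e e0.
  have e2 : 0 < e / 2 by rewrite divr_gt0.
  have [n ne] := H _ e2; exists (u n); exists n => // m /= nm.
  by rewrite -ball_normE /= distrC (le_lt_trans (ne _ nm))//; lra.
exists (lim (u @ \oo)) => e e0; have /cvgrPdist_le /(_ e e0) [n _ Hn] := cu.
by exists n => m nm; exact: Hn.
Qed.

(** * Disjoint vectors and sublattices of c_0 *)

Section disjoint.
Context {R : realType} {Y : banachLatticeType R}.
Implicit Types (x y z : Y) (a b : R).

Lemma lmeetC x y : lmeet x y = lmeet y x.
Proof. by vlat. Qed.

Let disjoint_real (x z : R) : 0 <= z -> Num.min `|x| z = 0 -> z = 0 \/ x = 0 /\ 0 < z.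
Proof.
rewrite le_eqVlt => /predU1P[<-|z0] xz; first by left.
right; split=> //; apply/eqP; rewrite -normr_le0 leNgt; apply/negP => x0.
by have : 0 < Num.min `|x| z; [rewrite lt_min x0|rewrite xz ltxx].
Qed.

Lemma disjointD x a y z : lle 0 y -> lle 0 z -> lmeet (labs x) z = 0 -> lmeet y z = 0 ->
  lmeet (labs (x + a *: y)) z = 0.
Proof.
lattice_to_real; rewrite !maxrN => xz yz y0 z0; have [->|[x0 zp]] := disjoint_real z0 xz.
  by rewrite min_r.
rewrite x0 add0r; move: yz; case: leP => [_ ->|_ z_0]; last by rewrite z_0 ltxx in zp.
by rewrite mulr0 normr0 min_l// ltW.
Qed.

Lemma disjoint_joinD x y z a b : lle 0 z -> lmeet (labs x) z = 0 -> lmeet (labs y) z = 0 ->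
  ljoin (x + a *: z) (y + b *: z) = ljoin x y + Num.max a b *: z.
Proof.
lattice_to_real; rewrite !maxrN => xz yz z0; have [->|[-> _]] := disjoint_real z0 xz.
  by rewrite !mulr0 !addr0.
have [->|[-> _]] := disjoint_real z0 yz; first by rewrite !mulr0 !addr0.
by rewrite !add0r maxr_pMl// maxxx add0r.
Qed.

Variable z : nat -> Y.
Hypothesis z0 : forall n, lle 0 (z n).
Hypothesis zdisj : forall i j, i != j -> lmeet (z i) (z j) = 0.

Lemma disjoint_sum N m : (N <= m)%N ->
  forall c : nat -> R, lmeet (labs (\sum_(i < N) c i *: z i)) (z m) = 0.
Proof.
move=> Nm c; elim: N Nm => [|N IH] Nm.
  by rewrite big_ord0; move: (z0 m); vlat.
rewrite big_ord_recr /=; apply: disjointD => //; first by apply: IH; exact: ltnW.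
by apply: zdisj; rewrite ltn_eqF.
Qed.

Lemma disjoint_join N (c d : nat -> R) :
  ljoin (\sum_(i < N) c i *: z i) (\sum_(i < N) d i *: z i) =
  \sum_(i < N) Num.max (c i) (d i) *: z i.
Proof.
elim: N => [|N IH]; first by rewrite !big_ord0 -[RHS](labs_id (lle_refl _)) /labs oppr0.
rewrite !big_ord_recr /= -IH; apply: disjoint_joinD => //; exact: disjoint_sum.
Qed.

Lemma labs_disjoint_sum N (c : nat -> R) :
  labs (\sum_(i < N) c i *: z i) = \sum_(i < N) `|c i| *: z i.
Proof.
have E : - (\sum_(i < N) c i *: z i) = \sum_(i < N) - c i *: z i.
  by rewrite -sumrN; apply: eq_bigr => i _; rewrite scaleNr.
rewrite /labs E (disjoint_join N c (fun i => - c i)).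
by apply: eq_bigr => i _; rewrite maxrN.
Qed.

Lemma lle_sum N (f g : nat -> Y) : (forall i, (i < N)%N -> lle (f i) (g i)) ->
  lle (\sum_(i < N) f i) (\sum_(i < N) g i).
Proof.
elim: N => [|N IH] H; first by rewrite !big_ord0 lle_refl.
by rewrite !big_ord_recr lleD ?H ?IH// => i iN; apply: H; rewrite ltnS ltnW.
Qed.

(** The sum of disjoint positive vectors is also their join. *)
Lemma disjoint_sum_ub w N : lle 0 w -> (forall i, (i < N)%N -> lle (z i) w) ->
  lle (\sum_(i < N) z i) w.
Proof.
move=> w0; have sum0 k : lle 0 (\sum_(i < k) z i).
  have := @lle_sum k (fun=> 0) z (fun i _ => z0 i).
  by rewrite big1.
elim: N => [|k IH] zw; first by rewrite big_ord0.
rewrite big_ord_recr /=; have := IH (fun i ik => zw i (ltnW ik)); have := zw k (ltnSn k).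
have : lmeet (\sum_(i < k) z i) (z k) = 0.
  rewrite -[RHS](disjoint_sum (leqnn k) (fun=> 1)) -(labs_id (sum0 k)).
  by congr (lmeet (labs _) _); apply: eq_bigr => i _; rewrite scale1r.
by move: (\sum_(i < k) _) (z k) (w) => p q r; vlat.
Qed.

Lemma norm_disjoint_sum_le N (c : nat -> R) r : 0 <= r ->
  (forall i, (i < N)%N -> `|c i| <= r) ->
  `|\sum_(i < N) c i *: z i| <= r * `|\sum_(i < N) z i|.
Proof.
move=> r0 cr; apply: norm_le_scale => //; rewrite labs_disjoint_sum scaler_sumr.
by apply: (@lle_sum N (fun i => `|c i| *: z i) (fun i => r *: z i)) => i iN;
  apply: lleZr => //; exact: cr.
Qed.

Lemma norm_disjoint_sum_ge N (c : nat -> R) i : (i < N)%N ->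
  `|c i| * `|z i| <= `|\sum_(i < N) c i *: z i|.
Proof.
move=> iN; have -> : `|c i| * `|z i| = `| `|c i| *: z i| by rewrite normrZ normr_id.
rewrite -[leRHS]norm_labs labs_disjoint_sum; apply: lle_norm_ge0.
  exact: lle_scaler_ge0.
have -> : `|c i| *: z i = \sum_(j < N) (if j == i :> nat then `|c j| *: z j else 0).
  rewrite (bigD1 (Ordinal iN)) //= eqxx big1 ?addr0// => j /negPf.
  by rewrite -val_eqE /= => ->.
apply: (@lle_sum N (fun j => if j == i then `|c j| *: z j else 0) (fun j => `|c j| *: z j)).
by move=> j _; case: eqP => _; rewrite ?lle_refl ?lle_scaler_ge0.
Qed.

End disjoint.

(** The embedding is the sum of the [a n x *: z n], which converges because the coordinates tend to
    0 and the partial sums of [z] are bounded. The norm of [z n] is bounded below only at a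
    coordinate witnessing the norm of [x], so that [z] may vanish from some index on. *)
Lemma c0_embeddable (R : realType) (X Y : banachLatticeType R)
    (a : nat -> X -> R) (z : nat -> Y) (C K c d : R) :
  (forall n r x y, a n (r *: x + y) = r * a n x + a n y) ->
  (forall n x y, a n (ljoin x y) = Num.max (a n x) (a n y)) ->
  (forall x (r : R), 0 < r -> exists N, forall n, (N <= n)%N -> `|a n x| <= r) ->
  (forall n x, `|a n x| <= K * `|x|) ->
  0 < c -> 0 < d ->
  (forall x, x != 0 -> exists n, c * `|x| <= `|a n x| /\ d <= `|z n|) ->
  (forall n, lle 0 (z n)) -> (forall i j, i != j -> lmeet (z i) (z j) = 0) ->
  (forall N, `|\sum_(i < N) z i| <= C) ->
  lattice_embeddable X Y.
Proof.
move=> alin ajoin a0 aK c0 d0 az z0 zdisj zC.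
have C0 : 0 <= C by apply: le_trans (zC 0%N).
pose S N x := \sum_(i < N) a i x *: z i.
have Scauchy x : exists l, forall e : R, 0 < e ->
    exists n, forall m, (n <= m)%N -> `|l - S m x| <= e.
  apply: (@cauchy_limit _ _ (fun N => S N x)) => e e0.
  have C1 : 0 < C + 1 by rewrite ltr_wpDl.
  have eC : 0 < e / (C + 1) by rewrite divr_gt0.
  have [N HN] := a0 x _ eC; exists N => m Nm.
  have -> : S m x - S N x = \sum_(i < m) (if (i < N)%N then 0 else a i x) *: z i.
    rewrite /S -(subnKC Nm) !big_split_ord /= addrAC -sumrB big1 ?add0r.
      rewrite [X in _ = X + _]big1 ?add0r => [|i _]; last by rewrite ltn_ord scale0r.
      by apply: eq_bigr => i _; rewrite ltnNge leq_addr.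
    by move=> i _; rewrite subrr.
  have ai i : (i < m)%N -> `|if (i < N)%N then 0 else a i x| <= e / (C + 1).
    by move=> im; case: ltnP => [_|iN]; [rewrite normr0 ltW|exact: HN].
  apply: le_trans (norm_disjoint_sum_le z0 zdisj (ltW eC) ai) _.
  apply: le_trans (_ : e / (C + 1) * (C + 1) <= _); last by rewrite divfK// gt_eqF.
  by rewrite ler_wpM2l ?(ltW eC)// (le_trans (zC m))// lerDl.
have [F FP] := choice Scauchy.
have F2 x y (e : R) : 0 < e -> exists n, `|F x - S n x| <= e /\ `|F y - S n y| <= e.
  move=> e0; have [n Hn] := FP x e e0; have [m Hm] := FP y e e0.
  by exists (maxn n m); rewrite Hn ?leq_maxl// Hm ?leq_maxr.
have eq_small (x y : Y) (k : R) : (forall e, 0 < e -> `|x - y| <= k * e) -> x = y.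
  move=> H; apply/eqP; rewrite -subr_eq0 -normr_le0; apply/ler_addgt0Pr => e e0.
  have K0 : 0 < `|k| + 1 by rewrite ltr_wpDl.
  apply: le_trans (H _ (divr_gt0 e0 K0)) _; rewrite add0r mulrA ler_pdivrMr//.
  by rewrite mulrC ler_wpM2l ?ltW//; have := ler_norm k; lra.
apply: (@lattice_embeddable_of _ _ _ F (c * d) (K * C)).
- move=> r x y; apply: (@eq_small _ _ (`|r| + 2)) => e e0.
  have [n Hn] := FP (r *: x + y) e e0; have [m Hm] := FP x e e0; have [p Hp] := FP y e e0.
  pose q := maxn n (maxn m p).
  have {}Hn := Hn q (leq_maxl _ _).
  have {}Hm : `|F x - S q x| <= e by apply: Hm; rewrite /q !leq_max leqnn orbT.
  have {}Hp : `|F y - S q y| <= e by apply: Hp; rewrite /q !leq_max leqnn !orbT.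
  have SE : S q (r *: x + y) = r *: S q x + S q y.
    rewrite /S scaler_sumr -big_split; apply: eq_bigr => i _.
    by rewrite alin scalerDl scalerA.
  have -> : F (r *: x + y) - (r *: F x + F y) =
     (F (r *: x + y) - S q (r *: x + y)) - (r *: (F x - S q x) + (F y - S q y)).
    by rewrite SE scalerBr (addrACA (r *: F x)) -opprD opprB addrA subrK.
  apply: le_trans (ler_normB _ _) _; have := ler_normD (r *: (F x - S q x)) (F y - S q y).
  rewrite normrZ; have := ler_wpM2l (normr_ge0 r) Hm; lra.
- move=> x y; apply: (@eq_small _ _ 3) => e e0.
  have [n Hn] := FP (ljoin x y) e e0; have [m Hm] := FP x e e0; have [p Hp] := FP y e e0.
  pose q := maxn n (maxn m p).
  have {}Hn := Hn q (leq_maxl _ _).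
  have {}Hm : `|F x - S q x| <= e by apply: Hm; rewrite /q !leq_max leqnn orbT.
  have {}Hp : `|F y - S q y| <= e by apply: Hp; rewrite /q !leq_max leqnn !orbT.
  have SE : S q (ljoin x y) = ljoin (S q x) (S q y).
    rewrite /S (disjoint_join z0 zdisj q (fun i => a i x) (fun i => a i y)).
    by apply: eq_bigr => i _; rewrite ajoin.
  have := norm_ljoinB (S q x) (F x) (S q y) (F y); rewrite -SE !(distrC _ (F _)).
  have := ler_distD (S q (ljoin x y)) (F (ljoin x y)) (ljoin (F x) (F y)); lra.
- move=> x; have K0 : 0 <= K * `|x| by apply: le_trans (aK 0%N x).
  apply/ler_addgt0Pr => e e0; have [n /(_ n (leqnn _)) Hn] := FP x e e0.
  have := norm_disjoint_sum_le z0 zdisj K0 (fun i _ => aK i x) : `|S n x| <= _.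
  have := ler_wpM2l K0 (zC n); have := ler_normD (F x - S n x) (S n x); rewrite subrK.
  lra.
- exact: mulr_gt0.
- move=> x; have [->|x0] := eqVneq x 0; first by rewrite normr0 mulr0.
  have [n [cn dn]] := az x x0; apply/ler_addgt0Pr => e e0; have [m Hm] := FP x e e0.
  pose q := maxn m n.+1; have {}Hm := Hm q (leq_maxl _ _).
  have nq : (n < q)%N by rewrite leq_maxr.
  have := norm_disjoint_sum_ge z0 zdisj (fun i => a i x) nq; rewrite -/(S q x).
  have : c * `|x| * d <= `|a n x| * `|z n|.
    by apply: ler_pM => //; rewrite ?mulr_ge0 ?(ltW c0)// ltW.
  have := ler_normB (F x) (F x - S q x); rewrite opprB addrC subrK; lra.
Qed.

Section c0_coordinates.
Context {R : realType} {X : banachLatticeType R}.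
Variables (Phi : {linear X -> C01 R}) (C c : R).
Hypothesis C0 : 0 < C.
Hypothesis Phi_le : forall x, `|Phi x| <= C * `|x|.
Hypothesis c0 : 0 < c.
Hypothesis Phi_ge : forall x, c * `|x| <= `|Phi x|.
Hypothesis Phi_join : forall x y, Phi (ljoin x y) = ljoin (Phi x) (Phi y).
Hypothesis X_separable : separable_space X.
Local Notation val x t := (C01_at (Phi x) t).
Hypothesis ratio_constant : forall e g p q, lle 0 e -> 0 <= p -> p <= q -> q <= 1 ->
  (forall t, p <= t <= q -> 0 < val e t) -> val g p * val e q = val g q * val e p.

Let val_dist x y t : `|val x t - val y t| <= C * `|x - y|.
Proof.
have -> : val x t - val y t = val (x - y) t by rewrite linearB.
exact: le_trans (C01_at_norm _ _) (Phi_le _).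
Qed.

Let val_labs x t : val (labs x) t = `|val x t|.
Proof. by rewrite Phi_join linearN C01_at_join C01_atN maxrN. Qed.

(** [e] is a weighted sum of the moduli of a dense sequence: an element that does not vanish at [t]
    is close to some [d n] that does not vanish there. *)
Let maximal_support : exists2 e, lle 0 e & forall g t, val g t != 0 -> 0 < val e t.
Proof.
have [d dP] := dense_sequence X_separable.
have d1 n : 0 < 1 + `|d n| by rewrite ltr_wpDr.
have [| |e [e0 _ eP]] := @geometric_sum R X (fun n => (1 + `|d n|)^-1 *: labs (d n)) 1.
- by move=> n; apply: lle_scaler_ge0; rewrite ?labs_ge0// invr_ge0 ltW.
- move=> n; rewrite normrZ norm_labs gtr0_norm ?invr_gt0//.
  by rewrite ler_pdivrMl// mulr1 lerDr.
exists e => // g t gt0; have gt1 : 0 < `|val g t| / C by rewrite divr_gt0// normr_gt0.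
have [n gn] := dP g _ gt1.
have dn : val (d n) t != 0.
  apply: contraTN gn => /eqP dn0; rewrite -leNgt ler_pdivrMr// mulrC.
  by have := val_dist g (d n) t; rewrite dn0 subr0.
have := val_le Phi_join t (eP n); apply: lt_le_trans.
rewrite !linearZ !C01_atZ val_labs !mulr_gt0 ?normr_gt0//.
  by rewrite exprn_gt0// invr_gt0.
by rewrite invr_gt0.
Qed.

(** The rational points of the interval, with repetitions. They are enough because values are
    continuous, and they make the classes countable. *)
Let q (n : nat) : R := if @unpickle rat n is Some r then Num.max 0 (Num.min 1 (ratr r)) else 0.

Let q01 n : 0 <= q n <= 1.
Proof.
rewrite /q; case: unpickle => [r|]; last by rewrite lexx ler01.
by rewrite le_max lexx/= ge_max ler01 ge_min lexx.
Qed.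

Let q_dense t r : 0 <= t <= 1 -> 0 < r -> exists n, `|t - q n| < r.
Proof.
move=> /andP[t0 t1] r0; have [|s] := @rat_in_itvoo R t (t + r); first by rewrite ltrDl.
rewrite in_itv /= => /andP[ts sr]; exists (pickle s); rewrite /q pickleK ltr_norml.
by apply/andP; split; case_minmax => *; lra.
Qed.

(* Two points are equivalent when the values there of the elements of [X] are
   proportional. A coordinate is the value on a class, scaled to the supremum of
   [e] over it. Coordinates tend to [0] because near a point where [e] does not
   vanish there is only one class. *)
Lemma c0_coordinates : exists a : nat -> X -> R, [/\
  forall n r x y, a n (r *: x + y) = r * a n x + a n y,
  forall n x y, a n (ljoin x y) = Num.max (a n x) (a n y),
  forall x (r : R), 0 < r -> exists N, forall n, (N <= n)%N -> `|a n x| <= r,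
  forall n x, `|a n x| <= C * `|x| &
  forall x, x != 0 -> exists n, c / 2 * `|x| <= `|a n x|].
Proof.
have [e e0 epos] := maximal_support; pose E n := val e (q n).
pose lam n g := val g (q n) / E n.
(* A class is represented by its first index. The other indices get the coordinate 0, lest a class
   be repeated infinitely often. *)
pose valid n := 0 < E n /\ forall k, (k < n)%N -> 0 < E k -> lam k <> lam n.
pose cls n := [set E k | k in [set k | 0 < E k /\ lam k = lam n]].
pose M n := sup (cls n).
pose a n g := if `[< valid n >] then lam n g * M n else 0.
have clsE n : valid n -> has_sup (cls n).
  move=> [En _]; split; first by exists (E n), n.
  exists (C * `|e|) => _ [k _ <-].
  exact: le_trans (ler_norm _) (le_trans (C01_at_norm _ _) (Phi_le _)).
have M_ge n k : valid n -> 0 < E k -> lam k = lam n -> E k <= M n.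
  by move=> vn Ek kn; apply: sup_upper_bound; [exact: clsE|exists k].
have M0 n : valid n -> 0 <= M n.
  by move=> vn; have [En _] := vn; apply: le_trans (M_ge n n vn En erefl); exact: ltW.
(* [lam] is common to a class, and [lam k g * E k] is the value at [q k]: up to sign, a coordinate
   is the supremum of the moduli of these values. *)
have M_bound n g r : valid n -> 0 <= r ->
    (forall k, 0 < E k -> lam k = lam n -> `|val g (q k)| <= r) -> `|lam n g * M n| <= r.
  move=> vn r0 H; rewrite normrM (ger0_norm (M0 n vn)).
  have [l0|l0] := eqVneq (lam n g) 0; first by rewrite l0 normr0 mul0r.
  have l1 : 0 < `|lam n g| by rewrite normr_gt0.
  rewrite -ler_pdivlMl//; apply: ge_sup; first by case: (clsE n vn).
  move=> _ [k [Ek kn] <-]; rewrite ler_pdivlMl// -kn /lam.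
  by rewrite -[X in _ * X](gtr0_norm Ek) -normrM divfK ?gt_eqF// H.
exists a; split.
- move=> n r x y; rewrite /a; case: asboolP => _; last by rewrite mulr0 addr0.
  by rewrite /lam linearP C01_atD C01_atZ mulrDl mulrDl !mulrA.
- move=> n x y; rewrite /a; case: asboolP => vn; last by rewrite maxxx.
  have [En _] := vn; have Ei : 0 <= (E n)^-1 by rewrite invr_ge0 ltW.
  by rewrite /lam Phi_join C01_at_join (maxr_pMl _ _ Ei) (maxr_pMl _ _ (M0 n vn)).
- move=> g r r0.
  (* By compactness it is enough that, near each [t], only finitely many classes have points where
     the modulus of [g] reaches [r]. *)
  pose P N t := forall n k, (N <= n)%N -> valid n -> 0 < E k -> lam k = lam n ->
    r <= `|val g (q k)| -> q k <> t.
  have /compact_near_coveringP nc := @segment_compact R 0 1.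
  have [|N _ HN] := nc _ \oo P _; last first.
    exists N => n Nn; rewrite /a; case: asboolP => vn; last by rewrite normr0 ltW.
    apply: M_bound => //; first exact: ltW.
    move=> k Ek kn; rewrite leNgt; apply/negP => /ltW rg.
    have qI : `[0, 1]%classic (q k) by rewrite /= in_itv /= q01.
    exact: (HN n Nn (q k) qI n k (leqnn n) vn Ek kn rg erefl).
  move=> t _.
  suff [s [N0 [s0 H]]] : exists s N0, 0 < s /\ forall t' N, `|t - t'| < s -> (N0 <= N)%N -> P N t'.
    exists (ball t s, [set N | (N0 <= N)%N]); first split => /=.
    - exact: nbhsx_ballx.
    - by exists N0.
    - by move=> [t' N] /= [tt' NN]; apply: H => //; move: tt'; rewrite -ball_normE.
  have [gt|gt] := ltP `|val g t| r.
    have := @C01_at_continuous R (Phi g) t; move/cvgrPdist_lt.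
    have rg : 0 < r - `|val g t| by rewrite subr_gt0.
    move=> /(_ _ rg); rewrite nearE => /nbhs_ballP[s /= s0 sg].
    exists s, 0%N; split=> // t' N tt' _ n k _ _ _ _ rgk qt'; move: rgk; apply/negP.
    rewrite -ltNge qt'; have /sg : ball t s t' by rewrite -ball_normE.
    have := ler_normB (val g t) (val g t - val g t'); rewrite opprB addrC subrK; lra.
  have et : 0 < val e t by apply: (epos g); rewrite -normr_gt0; exact: lt_le_trans gt.
  have := @C01_at_continuous R (Phi e) t; move/cvgrPdist_lt => /(_ _ et).
  rewrite nearE => /nbhs_ballP[s /= s0 se].
  have {}se t' : `|t - t'| < s -> 0 < val e t'.
    move=> tt'; have /se : ball t s t' by rewrite -ball_normE.
    by rewrite ltr_norml => /andP[? ?]; lra.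
  (* [e] is positive on the whole segment between two points close to [t], so [ratio_constant] makes
     them equivalent. *)
  have same k k' : `|t - q k| < s -> `|t - q k'| < s -> lam k = lam k'.
    move=> tk tk'; have Ek := se _ tk; have Ek' := se _ tk'.
    wlog kk' : k k' tk tk' Ek Ek' / q k <= q k'.
      by move=> W; have [|/ltW] := leP (q k) (q k'); [exact: W|move=> ?; apply/esym; exact: W].
    apply/funext => g'; apply/eqP; rewrite eqr_div ?lt0r_neq0//; apply/eqP.
    have /andP[k0 _] := q01 k; have /andP[_ k1] := q01 k'.
    apply: (@ratio_constant e g' (q k) (q k')) => // t' /andP[kt' t'k']; apply: se.
    by move: tk tk'; rewrite !ltr_norml => /andP[? ?] /andP[? ?]; apply/andP; split; lra.
  (* At most one valid index has points near [t]; the bound is taken beyond it. *)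
  have [[n0 [k0 [vn0 Ek0 kn0 tk0]]]|none] := pselect (exists n0 k0,
      [/\ valid n0, 0 < E k0, lam k0 = lam n0 & `|t - q k0| < s]).
    exists s, n0.+1; split=> // t' N tt' NN n k Nn [En vn] Ek kn _ qt'.
    have [En0 _] := vn0; apply: (vn n0) => //; first exact: leq_trans NN Nn.
    by rewrite -kn0 -kn; apply: same; rewrite ?qt'.
  exists s, 0%N; split=> // t' N tt' _ n k _ vn Ek kn _ qt'; apply: none.
  by exists n, k; split=> //; rewrite qt'.
- move=> n x; rewrite /a; case: asboolP => vn; last by rewrite normr0 mulr_ge0// ltW.
  apply: M_bound => // [|k _ _]; first by rewrite mulr_ge0// ltW.
  exact: le_trans (C01_at_norm _ _) (Phi_le _).
- move=> x x0; have x1 : 0 < `|x| by rewrite normr_gt0.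
  have half : c / 2 * `|x| < `|Phi x|.
    by have := Phi_ge x; have := mulr_gt0 c0 x1; lra.
  have [t t01 xt] := C01_at_norm_gt half.
  have := @C01_at_continuous R (Phi x) t; move/cvgrPdist_lt.
  have rg : 0 < `|val x t| - c / 2 * `|x| by rewrite subr_gt0.
  move=> /(_ _ rg); rewrite nearE => /nbhs_ballP[s /= s0 sx].
  have [k tk] := q_dense t01 s0.
  have xk : c / 2 * `|x| < `|val x (q k)|.
    have /sx : ball t s (q k) by rewrite -ball_normE.
    have := ler_normD (val x t - val x (q k)) (val x (q k)); rewrite subrK; lra.
  have Ek : 0 < E k.
    apply: (epos x); rewrite -normr_gt0; apply: le_lt_trans xk.
    by rewrite mulr_ge0// divr_ge0// ltW.
  have ex : exists n, `[< 0 < E n /\ lam n = lam k >] by exists k; apply/asboolP.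
  case: (ex_minnP ex) => n /asboolP[En nk] nmin; exists n.
  have vn : valid n.
    split=> // j jn Ej jn'.
    have Pj : `[< 0 < E j /\ lam j = lam k >] by apply/asboolP; rewrite jn'.
    by have := nmin j Pj; rewrite leqNgt jn.
  rewrite /a; case: asboolP => // _; rewrite nk normrM (ger0_norm (M0 n vn)).
  apply: ltW; apply: lt_le_trans xk _.
  have -> : `|val x (q k)| = `|lam k x| * E k.
    by rewrite /lam normrM (gtr0_norm (_ : 0 < (E k)^-1)) ?invr_gt0// divfK ?gt_eqF.
  by rewrite ler_wpM2l// M_ge.
Qed.

End c0_coordinates.

(** * Disjoint sequences *)

Lemma history_choice (T : pointedType) (Q : seq T -> T -> Prop) :
  (forall s, exists x, Q s x) -> exists j : nat -> T, forall m, Q (mkseq j m) (j m).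
Proof.
move=> /choice[f fQ].
pose S := fix S m := if m is m'.+1 then rcons (S m') (f (S m')) else [::].
exists (fun m => f (S m)) => m.
suff -> : mkseq (fun m => f (S m)) m = S m by exact: fQ.
by elim: m => // m IH; rewrite mkseqS IH.
Qed.

Section disjoint_selection.
Context {R : realType} {Y : banachLatticeType R}.
Variables (y : nat -> Y) (B d : R).
Hypothesis d0 : 0 < d.
Hypothesis y_ge : forall n, d <= `|y n|.
Hypothesis y_signs : forall ns, uniq ns -> signs_bounded B 0 (map y ns).
Local Notation b n := (labs (y n)).

Let b_le n : `|b n| <= B.
Proof.
by rewrite norm_labs; have := y_signs (ns := [:: n]) isT; rewrite /= add0r => -[].
Qed.

Let B0 : 0 < B.
Proof. by apply: lt_le_trans d0 _; apply: le_trans (y_ge 0%N) _; rewrite -norm_labs. Qed.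

(** The average over signs of the [y (j i)] dominates each [b (j i)], hence each [z i], hence their
    sum, which is a join of disjoint vectors. *)
Let bounded_sums (z : nat -> Y) (j : nat -> nat) N :
  (forall n, lle 0 (z n)) -> (forall m n, m != n -> lmeet (z m) (z n) = 0) ->
  injective j -> (forall n, lle (z n) (b (j n))) -> `|\sum_(i < N) z i| <= B.
Proof.
move=> z0 zdisj jinj zb; pose w := rad_avg 0 (map y (map j (iota 0 N))).
have sum0 : lle 0 (\sum_(i < N) z i).
  have := @lle_sum _ _ N (fun=> 0) z (fun i _ => z0 i).
  by rewrite big1.
have w0 : lle 0 w by apply: lleT (rad_avg_ge0 _ _); exact: labs_ge0.
have zw : lle (\sum_(i < N) z i) w.
  apply: disjoint_sum_ub => // i iN; apply: lleT (zb i) _; apply: rad_avg_ge.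
  by rewrite -map_comp; apply: map_f; rewrite mem_iota add0n.
apply: le_trans (lle_norm_ge0 sum0 zw) _; apply: norm_rad_avg.
by apply: y_signs; rewrite map_inj_uniq ?iota_uniq.
Qed.

Let concl := exists (z : nat -> Y) (r K : R), [/\ 0 < r, forall n, lle 0 (z n),
  forall m n, m != n -> lmeet (z m) (z n) = 0, forall n, r <= `|z n| &
  forall N, `|\sum_(i < N) z i| <= K].

Let symmetric_disjoint (z : nat -> Y) : (forall l m, (l < m)%N -> lmeet (z l) (z m) = 0) ->
  forall l m, l != m -> lmeet (z l) (z m) = 0.
Proof.
by move=> H l m; rewrite neq_ltn => /orP[/H//|/H]; rewrite lmeetC.
Qed.

Let injective_of_lt (j : nat -> nat) : (forall l m, (l < m)%N -> (j l < j m)%N) -> injective j.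
Proof.
move=> H l m lm; apply/eqP; case: (ltngtP l m) => // /H; by rewrite lm ltnn.
Qed.

Let partial_ge (f : nat -> Y) l m : (forall n, lle 0 (f n)) -> (l < m)%N ->
  lle (f l) (\sum_(i < m) f i).
Proof.
move=> f0 lm; have := @lle_sum _ _ m (fun i => if i == l then f l else 0) f _.
rewrite (bigD1 (Ordinal lm)) //= eqxx big1 ?addr0; last first.
  by move=> i /negPf; rewrite -val_eqE /= => ->.
by apply=> i _; case: eqP => [->|_]; rewrite ?lle_refl.
Qed.

(** Where [p > k], one has [qs >= N * p > N * k >= q] and the second part vanishes; elsewhere the
    first one does. *)
Let almost_real (N p q ps qs k : R) : 0 < N -> N * p <= qs -> q <= N * k ->
  0 <= ps -> 0 <= qs -> 0 <= k -> 0 <= p -> 0 <= q ->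
  Num.min (Num.max (p - ps - k) 0) (Num.max (q - qs - k) 0) = 0.
Proof.
move=> N0 pqs qk ps0 qs0 k0 p0 q0; have [pk|pk] := leP p k.
  by rewrite (max_r (_ : p - ps - k <= 0)) ?min_l ?le_max ?lexx ?orbT//; lra.
rewrite (max_r (_ : q - qs - k <= 0)) ?min_r ?le_max ?lexx ?orbT//.
by have := ler_wpM2l (ltW N0) (ltW pk); lra.
Qed.

(* If the [b n] escape every [e], a subsequence of them is made disjoint by
   subtracting multiples of the previous terms and of a common majorant. *)
Let almost_disjoint : (forall e (r : R), lle 0 e -> 0 < r ->
  exists N, forall n, (N <= n)%N -> `|lmeet (b n) e| < r) -> concl.
Proof.
(* The majorant [e] below has norm at most [2 * B], so subtracting [k *: e] costs at most
   [d / 4]. *)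
move=> small; pose k := d / (8 * (B + 1)).
have B1 : 0 < B + 1 by rewrite ltr_wpDl// ltW.
have k0 : 0 < k by rewrite divr_gt0// mulr_gt0.
have kB : k * (2 * B) <= d / 4.
  have -> : d / 4 = k * (2 * (B + 1)) by rewrite /k; field; rewrite gt_eqF.
  by rewrite ler_pM2l//; lra.
(* [M m *: (k *: e)] is [2 ^+ m *: e], a majorant of [b (j m)]. *)
pose M m : R := 2 ^+ m / k.
have M0 m : 0 < M m by rewrite divr_gt0// exprn_gt0.
have [s|j jP] := @history_choice nat (fun s n => all (fun l => (l < n)%N) s /\
    `|lmeet (b n) (M (size s) *: \sum_(l <- s) b l)| < d / 4).
  have e0 : lle 0 (M (size s) *: \sum_(l <- s) b l).
    apply: lle_scaler_ge0; first exact: ltW.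
    by have := (labs_sum_ge (map y s) 0).2; rewrite big_map.
  have [|N HN] := small _ (d / 4) e0; first by rewrite divr_gt0.
  exists (maxn N (\sum_(l <- s) l.+1)); split; last by apply: HN; rewrite leq_maxl.
  apply/allP => l ls; rewrite leq_max; apply/orP; right.
  by rewrite (big_rem l) //= leq_addr.
have jlt l m : (l < m)%N -> (j l < j m)%N.
  move=> lm; have [/allP H _] := jP m; apply: H; apply/mapP; exists l => //.
  by rewrite mem_iota.
have [e [e0 eB eb]] := @geometric_sum _ Y (fun m => b (j m)) B (fun=> labs_ge0 _) (fun=> b_le _).
pose S m := \sum_(i < m) b (j i).
have S_ge l m : (l < m)%N -> lle (b (j l)) (S m).
  by apply: (@partial_ge (fun i => b (j i))) => n; exact: labs_ge0.
have S0 m : lle 0 (S m).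
  by have := @lle_sum _ _ m (fun=> 0) (fun i => b (j i)) (fun i _ => labs_ge0 _); rewrite big1.
have jS m : `|lmeet (b (j m)) (M m *: S m)| < d / 4.
  have [_] := jP m; rewrite size_mkseq.
  by rewrite (_ : \sum_(l <- mkseq j m) b l = S m)// /mkseq big_map -val_enum_ord big_map big_enum.
pose z m := lpos (b (j m) - M m *: S m - k *: e).
have MS m : lle 0 (M m *: S m) by apply: lle_scaler_ge0 => //; exact: ltW.
have ke : lle 0 (k *: e) by apply: lle_scaler_ge0 => //; exact: ltW.
have zb m : lle (z m) (b (j m)).
  rewrite /z; move: (labs_ge0 (y (j m))) (MS m) ke.
  by move: (b _) (_ *: S m) (k *: e) => p q r; vlat.
have zdisj l m : (l < m)%N -> lmeet (z l) (z m) = 0.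
  move=> lm; have h1 : lle (M m *: b (j l)) (M m *: S m) by apply: lleZ; rewrite ?S_ge// ltW.
  have h2 : lle (b (j m)) (M m *: (k *: e)).
    have := lleZ (_ : 0 <= 2 ^+ m) (eb m); rewrite exprn_ge0// => /(_ isT).
    rewrite [X in lle X _]scalerA exprVn mulfV ?expf_neq0 ?pnatr_eq0// scale1r.
    by rewrite (scalerA (M m)) /M divfK// gt_eqF.
  rewrite /z; move: h1 h2 (MS l) (MS m) ke (labs_ge0 (y (j l))) (labs_ge0 (y (j m))).
  move: (M m) (M0 m) (b (j l)) (b (j m)) (M l *: S l) (M m *: S m) (k *: e).
  by move=> N N0 p q ps qs ke'; lattice_to_real; exact: almost_real.
exists z, (d / 2), B; split.
- by rewrite divr_gt0.
- by move=> n; exact: lpos_ge0.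
- exact: symmetric_disjoint.
- move=> m; have zm : lle (b (j m)) (z m + lmeet (b (j m)) (M m *: S m) + k *: e).
    by rewrite /z; move: ke (MS m); move: (b _) (_ *: S m) (k *: e) => p q r; vlat.
  have := lle_norm_ge0 (labs_ge0 _) zm; rewrite norm_labs.
  have := ler_normD (z m + lmeet (b (j m)) (M m *: S m)) (k *: e).
  have := ler_normD (z m) (lmeet (b (j m)) (M m *: S m)).
  rewrite normrZ (gtr0_norm k0); have := y_ge (j m); have := jS m.
  have := ler_wpM2l (ltW k0) eB; lra.
- by move=> N; apply: bounded_sums => //; [move=> n; exact: lpos_ge0
    |exact: symmetric_disjoint|exact: injective_of_lt].
Qed.

Let unbounded (I : nat -> Prop) := forall N, exists2 n, (N <= n)%N & I n.

Let unbounded_pigeonhole (I : nat -> Prop) (P : nat -> nat -> Prop) (ns : seq nat) :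
  unbounded I -> (forall i, I i -> exists2 n, n \in ns & P n i) ->
  exists2 n, n \in ns & unbounded (fun i => I i /\ P n i).
Proof.
move=> Iinf; elim: ns I Iinf => [|n ns IH] I Iinf H.
  by have [i _ /H[]] := Iinf 0%N.
have [nP|nP] := pselect (unbounded (fun i => I i /\ P n i)).
  by exists n; rewrite ?mem_head.
have [N HN] : exists N, forall i, (N <= i)%N -> I i -> ~ P n i.
  have /existsNP[N /forall2NP HN] := nP; exists N => i Ni Ii Pi.
  by have [] := HN i; [rewrite Ni|apply].
have [||m mns minf] := IH (fun i => I i /\ (N <= i)%N).
- move=> k; have [i ki Ii] := Iinf (maxn k N); exists i.
    by apply: leq_trans ki; rewrite leq_maxl.
  by split=> //; apply: leq_trans ki; rewrite leq_maxr.
- move=> i [Ii Ni]; have [m] := H i Ii; rewrite inE => /predU1P[->|mns Pm]; last by exists m.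
  by move=> /(HN i Ni Ii).
exists m; first by rewrite inE mns orbT.
by move=> k; have [i ki [[Ii _] Pi]] := minf k; exists i.
Qed.

(* Otherwise the [b n] are cut by [e]; by Khintchine's inequality, the state
   norming a late term is small on some early one, so that subtracting multiples
   of the early terms keeps the norm. *)
Let overlapping e (r : R) : lle 0 e -> 0 < r ->
  (forall N, exists2 n, (N <= n)%N & r <= `|lmeet (b n) e|) -> concl.
Proof.
move=> e0 r0 big; pose a n := lmeet (b n) e.
have a0 n : lle 0 (a n) by rewrite lmeetP labs_ge0.
have ab n : lle (a n) (b n) by rewrite (lmeet_lb _ _).1.
have ae n : lle (a n) e by rewrite (lmeet_lb _ _).2.
have /choice[mu muP] : forall n, exists mu : Y -> R, state mu /\ mu (a n) = `|a n|.
  by move=> n; have [mu] := state_norming (a0 n); exists mu.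
pose k := r / (4 * (`|e| + 1)); have e1 : 0 < `|e| + 1 by rewrite ltr_wpDl.
have k0 : 0 < k by rewrite divr_gt0// mulr_gt0.
have ke4 : k * `|e| <= r / 4.
  have -> : r / 4 = k * (`|e| + 1) by rewrite /k; field; rewrite gt_eqF.
  by rewrite ler_pM2l// lerDl.
(* The sums of the [eta m] stay below [k * (r / 4)], so on a state the subtraction of [k^-1] times
   the earlier terms costs at most [r / 4], and that of [k *: e] as much. *)
pose eta m : R := k * r / 8 * 2^-1 ^+ m.
have eta0 m : 0 < eta m.
  by rewrite /eta mulr_gt0 ?exprn_gt0 ?invr_gt0// divr_gt0// mulr_gt0.
pose next (I : nat -> Prop) m (n : nat) (I' : nat -> Prop) :=
  [/\ I n, unbounded I' & forall i, I' i -> [/\ I i, (n < i)%N & mu i (a n) <= eta m]].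
(* Each state is small on one of [K ^ 2] candidates, and by the pigeonhole principle infinitely many
   states share the same one. *)
have step I m : unbounded I -> exists n I', next I m n I'.
  move=> Iinf; pose K := (Num.truncn (2 * B / eta m)).+1.
  have [ns [uns nsK nsI]] : exists ns, [/\ uniq ns, size ns = (K ^ 2)%N &
      forall n, n \in ns -> I n].
    elim: (K ^ 2)%N => [|N [ns [uns nsN nsI]]]; first by exists [::].
    have [n nns In] := Iinf (\sum_(l <- ns) l.+1)%N; exists (n :: ns); split=> /=.
    - rewrite uns andbT; apply/negP => nin.
      by move: nns; rewrite (big_rem n nin) /= addSn ltnNge leq_addr.
    - by rewrite nsN.
    - by move=> l; rewrite inE => /predU1P[->|/nsI].
  have [i _|n nns ninf] := @unbounded_pigeonhole I (fun n i => mu i (a n) <= eta m) ns Iinf.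
    have [si _] := muP i.
    have [||||_ /mapP[n nns ->] h] := @khintchine_exists _ _ (mu i) B K (eta m) (map y ns) si.
    - by rewrite size_map.
    - by [].
    - exact: y_signs.
    - by rewrite -ltr_pdivrMr// truncnS_gt// divr_ge0 ?mulr_ge0 ?ltW.
    by exists n => //; apply: le_trans (state_le si (ab n)) (ltW h).
  exists n, (fun i => (I i /\ mu i (a n) <= eta m) /\ (n < i)%N); split.
  - exact: nsI.
  - move=> N; have [i Ni Ii] := ninf (maxn N n.+1); exists i.
      by apply: leq_trans Ni; rewrite leq_maxl.
    by split=> //; apply: leq_trans Ni; rewrite leq_maxr.
  - by move=> i [[Ii mi] ni].
pose I0 n : Prop := r <= `|a n|.
pose last_set (s : seq (nat * (nat -> Prop))) := last I0 (map snd s).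
have [s|j jP] := @history_choice (nat * (nat -> Prop))%type (fun s x =>
    unbounded (last_set s) -> next (last_set s) (size s) x.1 x.2).
  have [/(step _ (size s))[n [I' nI]]|ninf] := pselect (unbounded (last_set s)).
    by exists (n, I').
  by exists (0%N, I0).
pose I m := last_set (mkseq j m).
have IS m : I m.+1 = (j m).2 by rewrite /I /last_set mkseqS map_rcons last_rcons.
have Iinf m : unbounded (I m).
  elim: m => [|m IH]; first exact: big.
  by rewrite IS; have [] := jP m IH.
have jn m : next (I m) m (j m).1 (I m.+1).
  by rewrite IS; have := jP m (Iinf m); rewrite size_mkseq.
have Isub l m : (l <= m)%N -> forall i, I m i -> I l i.
  move=> /subnKC <-; elim: (m - l)%N => [|p IH] i; first by rewrite addn0.
  by rewrite addnS => Ii; apply: IH; have [_ _ /(_ i Ii)[]] := jn (l + p)%N.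
have jI l m : (l < m)%N -> I l.+1 (j m).1.
  by move=> lm; apply: (Isub _ _ lm); have [] := jn m.
have jlt l m : (l < m)%N -> ((j l).1 < (j m).1)%N.
  by move=> lm; have [_ _ /(_ _ (jI l m lm))[]] := jn l.
have jmu l m : (l < m)%N -> mu (j m).1 (a (j l).1) <= eta l.
  by move=> lm; have [_ _ /(_ _ (jI l m lm))[]] := jn l.
have jr m : r <= `|a (j m).1|.
  by have [h _ _] := jn m; exact: (Isub 0%N m (leq0n m) _ h).
pose S m := \sum_(i < m) a (j i).1.
have S0 m : lle 0 (S m).
  by have := @lle_sum _ _ m (fun=> 0) (fun i => a (j i).1) (fun i _ => a0 _); rewrite big1.
(* All the [a n] are below [e], so the constant factor [k^-1] is enough for disjointness. *)
pose z m := lpos (a (j m).1 - k^-1 *: S m - k *: e).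
have kS m : lle 0 (k^-1 *: S m) by apply: lle_scaler_ge0 => //; rewrite invr_ge0 ltW.
have ke : lle 0 (k *: e) by apply: lle_scaler_ge0 => //; exact: ltW.
have za m : lle (z m) (a (j m).1).
  by rewrite /z; move: (a0 (j m).1) (kS m) ke; move: (a _) (_ *: S m) (k *: e) => p q t; vlat.
have ki0 : 0 < k^-1 by rewrite invr_gt0.
have zdisj l m : (l < m)%N -> lmeet (z l) (z m) = 0.
  move=> lm; have h1 : lle (k^-1 *: a (j l).1) (k^-1 *: S m).
    by apply: lleZ; [exact: ltW|exact: (@partial_ge (fun i => a (j i).1))].
  have h2 : lle (a (j m).1) (k^-1 *: (k *: e)).
    by rewrite scalerA mulVf ?gt_eqF// scale1r.
  rewrite /z; move: h1 h2 (kS l) (kS m) ke (a0 (j l).1) (a0 (j m).1).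
  move: (k^-1) ki0 (a (j l).1) (a (j m).1) (S l) (S m) (k *: e).
  move=> N N0 p q s t ke'; move: (N *: s) (N *: t) => ps qs.
  by lattice_to_real; exact: almost_real.
exists z, (r / 2), B; split.
- by rewrite divr_gt0.
- by move=> n; exact: lpos_ge0.
- exact: symmetric_disjoint.
- move=> m; have [smu muE] := muP (j m).1; have [muD muZ _] := smu.
  apply: le_trans (state_norm (z m) smu).
  have /(state_le smu) : lle (a (j m).1 - k^-1 *: S m - k *: e) (z m).
    by rewrite /z (ljoin_ub _ _).1.
  rewrite !stateB// !muZ muE; apply: le_trans.
  have mS : mu (j m).1 (S m) <= k * (r / 4).
    rewrite /S state_sum//; have : \sum_(i < m) mu (j m).1 (a (j i).1) <= \sum_(i < m) eta i.
      by apply: ler_sum => i _; exact: jmu.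
    move=> /le_trans; apply.
    suff -> : \sum_(i < m) eta i = k * (r / 4) - k * (r / 4) * 2^-1 ^+ m.
      rewrite gerBl; apply: mulr_ge0; last by rewrite exprn_ge0// invr_ge0.
      by apply: mulr_ge0; [exact: ltW|rewrite divr_ge0// ltW].
    elim: m {smu muE muD muZ} => [|m IH]; first by rewrite big_ord0 expr0 mulr1 subrr.
    by rewrite big_ord_recr /= IH /eta exprS; field.
  have me : mu (j m).1 e <= `|e| by exact: state_norm.
  have := ler_wpM2l (ltW k0) me; have := ler_wpM2l (ltW ki0) mS.
  rewrite (mulrA k^-1) mulVf ?gt_eqF// mul1r; have := jr m; lra.
- move=> N; apply: (@bounded_sums _ (fun m => (j m).1)).
  + by move=> n; exact: lpos_ge0.
  + exact: symmetric_disjoint.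
  + exact: injective_of_lt.
  + by move=> n; exact: lleT (za n) (ab _).
Qed.

(** A dichotomy in the manner of Kadec and Pelczynski: either the meets of the [b n] with every
    positive vector tend to 0, or some [e] keeps a part of infinitely many of them. *)
Lemma disjoint_selection : exists (z : nat -> Y) (r K : R), [/\ 0 < r, forall n, lle 0 (z n),
  forall m n, m != n -> lmeet (z m) (z n) = 0, forall n, r <= `|z n| &
  forall N, `|\sum_(i < N) z i| <= K].
Proof.
have [small|] := pselect (forall e (r : R), lle 0 e -> 0 < r ->
  exists N, forall n, (N <= n)%N -> `|lmeet (b n) e| < r); first exact: almost_disjoint.
move=> /existsNP[e /existsNP[r /not_implyP[e0 /not_implyP[r0 /forallNP H]]]].
apply: (overlapping e0 r0) => N; have /existsNP[n /not_implyP[Nn /negP]] := H N.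
by rewrite -leNgt; exists n.
Qed.

End disjoint_selection.

(** * Atoms and finite disjoint bases *)

Section disjoint_systems.
Context {R : realType} {Y : banachLatticeType R}.
Implicit Types x y z w : Y.

Definition atom z := [/\ lle 0 z, z != 0 &
  forall p q, lle 0 p -> lle p z -> lle 0 q -> lle q z -> lmeet p q = 0 -> p = 0 \/ q = 0].

Definition disjoint_family (f : nat -> Y) :=
  (forall n, lle 0 (f n)) /\ (forall m n, m != n -> lmeet (f m) (f n) = 0).

Lemma lmeet_eq0_le x y x' y' : lle 0 x' -> lle 0 y' -> lle x' x -> lle y' y ->
  lmeet x y = 0 -> lmeet x' y' = 0.
Proof. by vlat. Qed.

Lemma lmeetZ_eq0 (a b : R) x y : 0 <= a -> 0 <= b -> lle 0 x -> lle 0 y ->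
  lmeet x y = 0 -> lmeet (a *: x) (b *: y) = 0.
Proof.
move=> a0 b0; lattice_to_real; rewrite minEle; case: ifP => _ ->; rewrite mulr0 => h0 h1.
  by rewrite min_l// mulr_ge0.
by rewrite min_r// mulr_ge0.
Qed.

Lemma disjoint_familyP (f : nat -> Y) : (forall n, lle 0 (f n)) ->
  (forall l m, (l < m)%N -> lmeet (f l) (f m) = 0) -> disjoint_family f.
Proof.
by move=> f0 H; split=> // l m; rewrite neq_ltn => /orP[/H//|/H]; rewrite lmeetC.
Qed.

(** [c] is the largest coefficient with [c *: z] below [y]. The vectors [w - r *: z] and
    [r *: z - w] have disjoint positive parts, one of which vanishes since [z] is an atom. A
    multiple [r *: z] below [w] would contradict the choice of [c], so [w] is below [r *: z] for
    every [r > 0]. *)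
Lemma atom_multiple z y : atom z -> lle 0 y -> exists c : R,
  [/\ 0 <= c, lle (c *: z) y & lmeet (y - c *: z) z = 0].
Proof.
move=> [z0 zn0 zatom] y0; pose A := [set c : R | 0 <= c /\ lle (c *: z) y].
have nz : 0 < `|z| by rewrite normr_gt0.
have supA : has_sup A.
  split; first by exists 0; split=> //; rewrite scale0r.
  exists (`|y| / `|z|) => c [c0 cy]; rewrite ler_pdivlMr//.
  have := lle_norm_ge0 (lle_scaler_ge0 _ _ c0 z0) cy.
  by rewrite normrZ ger0_norm.
pose c := sup A; have c0 : 0 <= c.
  by apply: sup_upper_bound => //; split=> //; rewrite scale0r.
have cy : lle (c *: z) y.
  apply: lle_approx => r r0; have rz : 0 < r / `|z| by rewrite divr_gt0.
  have [c' [c'0 c'y] cc'] := sup_adherent rz supA; exists (c' *: z) => //.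
  rewrite -scalerBl normrZ -ler_pdivlMr// ger0_norm; last first.
    by rewrite subr_ge0; apply: sup_upper_bound.
  by rewrite lerBlDl -lerBlDr ltW.
exists c; split=> //; set w := lmeet _ _.
have w0 : lle 0 w by rewrite lmeetP lle_0sub cy.
have wz : lle w z by rewrite (lmeet_lb _ _).2.
have wy : lle w (y - c *: z) by rewrite (lmeet_lb _ _).1.
apply: (@lle_anti _ Y); rewrite w0 andbT; apply: (@lle_archi _ _ _ z) => r r0.
have rz0 : lle 0 (r *: z) by apply: lle_scaler_ge0 => //; exact: ltW.
have [|||||p0|q0] := zatom (lpos (w - r *: z)) (lmeet (lpos (r *: z - w)) z).
- exact: lpos_ge0.
- by move: rz0 w0 wz; move: (r *: z) => rz; vlat.
- by rewrite lmeetP lpos_ge0.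
- by rewrite (lmeet_lb _ _).2.
- by move: rz0 w0 wz; move: (r *: z) => rz; vlat.
- by move: p0; move: (r *: z) => rz; vlat.
have rw : lle (r *: z) w.
  move: q0 z0 w0; lattice_to_real => q0; rewrite le_eqVlt => /predU1P[<-|z1] w1.
    by rewrite mulr0.
  by move: q0; case_minmax => *; lra.
have : A (c + r).
  split; first by rewrite addr_ge0// ltW.
  by rewrite scalerDl addrC -[y](subrK (c *: z)) lleD2; exact: lleT rw wy.
by move/(sup_upper_bound supA); rewrite gerDl leNgt r0.
Qed.

(** Every nonzero piece splits into two disjoint nonzero ones; one is kept for the sequence and the
    other is split again. *)
Let split_sequence z : lle 0 z -> z != 0 -> (forall w, lle w z -> ~ atom w) ->
  exists2 f, disjoint_family f & forall n, f n != 0.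
Proof.
move=> z0 zn0 noatom; pose nice w := [/\ lle 0 w, lle w z & w != 0].
have /choice[pq pqP] : forall w, exists pq : Y * Y, nice w ->
    [/\ nice pq.1, nice pq.2, lle pq.1 w, lle pq.2 w & lmeet pq.1 pq.2 = 0].
  move=> w; have [[w0 wz wn0]|] := pselect (nice w); last by exists (0, 0).
  suff [p [q H]] : exists p q, [/\ nice p, nice q, lle p w, lle q w & lmeet p q = 0].
    by exists (p, q).
  apply: contrapT => H; apply: (noatom w wz); split=> // p q p0 pw q0 qw pq0.
  have [->|pn0] := eqVneq p 0; first by left.
  have [->|qn0] := eqVneq q 0; first by right.
  case: H; exists p, q; split=> //; split=> //; exact: lleT wz.
pose W := fix W n := if n is n'.+1 then (pq (W n')).2 else z.
have niceW n : nice (W n).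
  elim: n => [|n IH]; first by split=> //; exact: lle_refl.
  by have [] := pqP _ IH.
have Wmono l k : lle (W (l + k)%N) (W l).
  elim: k => [|k IH]; first by rewrite addn0 lle_refl.
  by rewrite addnS; apply: lleT IH; have [] := pqP _ (niceW (l + k)%N).
exists (fun n => (pq (W n)).1); last by move=> n; have [[]] := pqP _ (niceW n).
apply: disjoint_familyP => [n|l m lm]; first by have [[]] := pqP _ (niceW n).
have [[p0 _ _] [q0 _ _] _ _ pq0] := pqP _ (niceW l).
have [[p0' _ _] _ pw _ _] := pqP _ (niceW m).
apply: lmeet_eq0_le pq0 => //; first exact: lle_refl.
by apply: lleT pw _; rewrite -(subnKC lm); exact: (Wmono l.+1).
Qed.

(** If every nonzero positive vector dominates an atom, a finite disjoint system of atoms that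
    cannot be enlarged is a basis: a positive vector minus its components is disjoint from the
    system, and an atom below a nonzero remainder would enlarge it. *)
Lemma disjoint_dichotomy :
  (exists2 f, disjoint_family f & forall n, f n != 0) \/
  (exists (f : nat -> Y) (k : nat), [/\ disjoint_family f,
     forall n, (n < k)%N -> f n != 0 &
     forall y, exists c : nat -> R, y = \sum_(i < k) c i *: f i]).
Proof.
have [[z [z0 zn0 noatom]]|H] := pselect (exists z, [/\ lle 0 z, z != 0 &
    forall w, lle w z -> ~ atom w]); first by left; exact: split_sequence noatom.
have {}H z : lle 0 z -> z != 0 -> exists2 w, lle w z & atom w.
  move=> z0 zn0; apply: contrapT => noatom; apply: H; exists z; split=> // w wz aw.
  by apply: noatom; exists w.
pose good s := (forall n, (n < size s)%N -> atom (nth 0 s n)) /\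
  (forall m n, (n < m < size s)%N -> lmeet (nth 0 s n) (nth 0 s m) = 0).
have [[s [[sat sdisj] smax]]|nmax] := pselect (exists s, good s /\
    forall w, atom w -> exists2 z, z \in s & lmeet z w <> 0).
  right; exists (nth 0 s), (size s).
  have f0 n : lle 0 (nth 0 s n).
    have [ns|ns] := ltnP n (size s); first by have [] := sat n ns.
    by rewrite nth_default// lle_refl.
  have fdisj : disjoint_family (nth 0 s).
    apply: disjoint_familyP => // l m lm; have [ms|ms] := ltnP m (size s).
      by apply: sdisj; rewrite lm.
    by rewrite [nth 0 s m]nth_default//; move: (f0 l); vlat.
  have [_ fd] := fdisj.
  split=> // [n ns|y]; first by have [] := sat n ns.
  suff span y' : lle 0 y' -> exists c : nat -> R, y' = \sum_(i < size s) c i *: nth 0 s i.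
    have [c1 e1] := span _ (lpos_ge0 y); have [c2 e2] := span _ (lpos_ge0 (- y)).
    exists (fun i => c1 i - c2 i); have -> : y = lpos y - lpos (- y) by vlat.
    by rewrite e1 e2 -sumrB; apply: eq_bigr => i _; rewrite scalerBl.
  move=> y0; have /choice[c cP] : forall i, exists c : R, (i < size s)%N ->
      [/\ 0 <= c, lle (c *: nth 0 s i) y' & lmeet (y' - c *: nth 0 s i) (nth 0 s i) = 0].
    move=> i; have [si|si] := ltnP i (size s); last by exists 0.
    by have [c hc] := atom_multiple (sat i si) y0; exists c.
  exists c; set S := \sum_(i < _) _.
  pose g i := if (i < size s)%N then c i *: nth 0 s i else 0.
  have SE : S = \sum_(i < size s) g i.
    by apply: eq_bigr => i _; rewrite /g ltn_ord.
  have g0 i : lle 0 (g i).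
    rewrite /g; case: ifP => [is_|_]; last exact: lle_refl.
    by have [ci _ _] := cP i is_; exact: lle_scaler_ge0.
  have gy i : lle (g i) y'.
    by rewrite /g; case: ifP => // is_; have [] := cP i is_.
  have gd i j : i != j -> lmeet (g i) (g j) = 0.
    move=> ij; rewrite /g; case: ifP => is_; case: ifP => js.
    - have [ci _ _] := cP i is_; have [cj _ _] := cP j js.
      by apply: lmeetZ_eq0; rewrite ?fd.
    - by have [ci _ _] := cP i is_; move: (lle_scaler_ge0 _ _ ci (f0 i)); vlat.
    - by have [cj _ _] := cP j js; move: (lle_scaler_ge0 _ _ cj (f0 j)); vlat.
    - by vlat.
  have Sy : lle S y' by rewrite SE; apply: disjoint_sum_ub.
  have Sg i : (i < size s)%N -> lle (c i *: nth 0 s i) S.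
    move=> is_; have -> : c i *: nth 0 s i = \sum_(j < size s) if j == i :> nat then g i else 0.
      rewrite (bigD1 (Ordinal is_)) //= eqxx big1 ?addr0 ?/g ?is_// => j.
      by rewrite -val_eqE /= => /negPf ->.
    rewrite SE; apply: (@lle_sum _ _ _ (fun j => if j == i then g i else 0)) => j _.
    by case: eqP => [->|_]; [exact: lle_refl|exact: g0].
  have rest : forall z, z \in s -> lmeet z (y' - S) = 0.
    move=> _ /(nthP 0)[i is_ <-]; have [_ _ h] := cP i is_.
    rewrite lmeetC; apply: lmeet_eq0_le h; rewrite ?lle_0sub ?f0 ?lle_refl//.
    by apply: lleD; rewrite ?lle_refl// lleN Sg.
  have [/eqP|yS] := eqVneq (y' - S) 0; first by rewrite subr_eq0 => /eqP.
  have yS0 : lle 0 (y' - S) by rewrite lle_0sub.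
  have [w wy aw] := H _ yS0 yS; have [z /[dup] zs /(nthP 0)[i _ iz]] := smax w aw.
  by case; apply: lmeet_eq0_le (rest z zs); rewrite ?lle_refl -?iz//; have [] := aw.
left; have next s : exists w, good s -> atom w /\ forall z, z \in s -> lmeet z w = 0.
  have [gs|] := pselect (good s); last by exists 0.
  apply: contrapT => nw; apply: nmax; exists s; split=> // w aw.
  apply: contrapT => nz; apply: nw; exists w => _; split=> // z zs.
  by apply: contrapT => zw; apply: nz; exists z.
have [j jP] := history_choice next.
have good_j m : good (mkseq j m).
  elim: m => [|m IH]; first by split=> // m n; rewrite /= ltn0 andbF.
  have [am dm] := jP m IH; rewrite mkseqS; have [ag dg] := IH.
  split=> [n|l n]; rewrite size_rcons !nth_rcons !size_mkseq.
    rewrite ltnS leq_eqVlt => /predU1P[->|nm]; first by rewrite ltnn eqxx.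
    by rewrite nm; apply: ag; rewrite size_mkseq.
  rewrite ltnS [(l <= m)%N]leq_eqVlt => /andP[nl /predU1P[lm|lm]].
    subst l; rewrite ltnn eqxx nl; apply: dm; apply/mem_nth; by rewrite size_mkseq.
  by rewrite lm (ltn_trans nl lm); apply: dg; rewrite size_mkseq nl.
exists j; last by move=> n; have [[]] := jP n (good_j n).
apply: disjoint_familyP => [n|l m lm]; first by have [[]] := jP n (good_j n).
have [_] := jP m (good_j m); apply; apply/mapP; exists l => //.
by rewrite mem_iota.
Qed.

End disjoint_systems.

Section infinite_dimension.
Context {R : realType} {X Y : banachLatticeType R}.
Variables (Phi : {linear X -> C01 R}) (C c : R).
Hypothesis C0 : 0 < C.
Hypothesis Phi_le : forall x, `|Phi x| <= C * `|x|.
Hypothesis c0 : 0 < c.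
Hypothesis Phi_ge : forall x, c * `|x| <= `|Phi x|.
Hypothesis Phi_join : forall x y, Phi (ljoin x y) = ljoin (Phi x) (Phi y).
Variables (f : nat -> X).
Hypothesis f0 : disjoint_family f.
Hypothesis f_neq0 : forall n, f n != 0.

Let p n := `|Phi (f n)|.
Let p_gt0 n : 0 < p n.
Proof. by apply: lt_le_trans (Phi_ge _); rewrite mulr_gt0// normr_gt0. Qed.
Let x n := (p n)^-1 *: f n.

Let Phi_meet u v t : C01_at (Phi (lmeet u v)) t = Num.min (C01_at (Phi u) t) (C01_at (Phi v) t).
Proof.
by rewrite lmeetN linearN Phi_join !linearN C01_atN C01_at_join !C01_atN oppr_max !opprK.
Qed.

Let at_le1 n t : `|C01_at (Phi (x n)) t| <= 1.
Proof.
apply: le_trans (C01_at_norm _ _) _; rewrite linearZ normrZ ger0_norm ?invr_ge0 ?(ltW (p_gt0 _))//.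
by rewrite mulVf//; exact: lt0r_neq0 (p_gt0 n).
Qed.

Let at_disjoint m n t : m != n -> C01_at (Phi (x m)) t != 0 -> C01_at (Phi (x n)) t = 0.
Proof.
move=> mn xm; have : C01_at (Phi (lmeet (x m) (x n))) t = 0.
  rewrite lmeetZ_eq0 ?invr_ge0 ?(ltW (p_gt0 _)) ?f0.1 ?f0.2//.
  by rewrite linear0.
rewrite Phi_meet minEle; case: ifP => // _ xm0; by rewrite xm0 eqxx in xm.
Qed.

(** At each point at most one of the functions [Phi (x n)] is nonzero, and its modulus is at most
    1. *)
Let x_signs (T : {linear X -> Y}) (B : R) : 0 <= B -> (forall z, `|T z| <= B * `|Phi z|) ->
  forall ns, uniq ns -> signs_bounded B 0 (map (T \o x) ns).
Proof.
move=> B0 TB ns uns; rewrite map_comp -(linear0 T).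
apply: (@signs_bounded_map _ _ _ Phi) => // t _; rewrite linear0 C01_at0 normr0 add0r big_map.
have [[n nns xn]|H] := pselect (exists2 n, n \in ns & C01_at (Phi (x n)) t != 0).
  rewrite (bigD1_seq n) //= big1 ?addr0 ?at_le1// => m mn.
  by rewrite (at_disjoint _ xn) ?normr0// eq_sym.
rewrite big_seq big1 ?ler01// => n nns; apply/eqP; rewrite normr_eq0.
by apply: contrapT => /negP xn; apply: H; exists n.
Qed.

Lemma infinite_lattice_embeddable : separable_space X ->
  (forall e g p q, lle 0 e -> 0 <= p -> p <= q -> q <= 1 ->
    (forall t, p <= t <= q -> 0 < C01_at (Phi e) t) ->
    C01_at (Phi g) p * C01_at (Phi e) q = C01_at (Phi g) q * C01_at (Phi e) p) ->
  linearly_embeddable X Y -> lattice_embeddable X Y.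
Proof.
move=> sX ratio [T [/bounded_operatorP[B B0 TB] /isomorphism_onto_rangeP[b b0 Tb]]].
have [a [alin ajoin a0 aC ac]] := c0_coordinates C0 Phi_le c0 Phi_ge Phi_join sX ratio.
have TPhi z : `|T z| <= B / c * `|Phi z|.
  apply: le_trans (TB z) _; rewrite -mulrA ler_wpM2l ?(ltW B0)//.
  by rewrite ler_pdivlMl.
have Bc : 0 <= B / c by rewrite divr_ge0 ?ltW.
have bC : 0 < b / C by rewrite divr_gt0.
have [n|z [r [K [r0 z0 zd zr zK]]]] := disjoint_selection bC _ (x_signs Bc TPhi).
  rewrite /=; apply: le_trans (Tb _); rewrite ler_wpM2l ?(ltW b0)//.
  rewrite -[leLHS]mulr1 ler_pdivrMl//; apply: le_trans (Phi_le _).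
  rewrite linearZ normrZ ger0_norm ?invr_ge0 ?(ltW (p_gt0 _))//.
  by rewrite mulVf//; exact: lt0r_neq0 (p_gt0 n).
have c20 : 0 < c / 2 by rewrite divr_gt0.
apply: (c0_embeddable alin ajoin a0 aC c20 r0 _ z0 zd zK) => y /ac[n an].
by exists n.
Qed.

End infinite_dimension.

Section finite_dimension.
Context {R : realType}.

Lemma linear_dependence (k l : nat) (A : nat -> nat -> R) : (l < k)%N ->
  exists2 v : nat -> R, exists2 i, (i < k)%N & v i != 0 &
  forall j, (j < l)%N -> \sum_(i < k) v i * A i j = 0.
Proof.
move=> lk; pose M := \matrix_(i < k, j < l) A i j.
have : kermx M != 0.
  by rewrite -mxrank_eq0 mxrank_ker -lt0n subn_gt0 (leq_ltn_trans _ lk)// rank_leq_col.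
case/rowV0Pn => u /sub_kermxP uM /rV0Pn[i ui].
pose v n := oapp (u 0) 0 (insub n); have vE (m : 'I_k) : v m = u 0 m by rewrite /v valK.
exists v; first by exists i => //; rewrite vE.
move=> j jl; have /matrixP/(_ 0 (Ordinal jl)) := uM; rewrite !mxE => E.
by rewrite -[RHS]E; apply: eq_bigr => m _; rewrite mxE vE.
Qed.

Lemma disjoint_coef0 (X : banachLatticeType R) (f : nat -> X) k (c : nat -> R) i :
  disjoint_family f -> (i < k)%N -> f i != 0 ->
  \sum_(j < k) c j *: f j = 0 -> c i = 0.
Proof.
move=> [f0 fd] ik fi cf; have := norm_disjoint_sum_ge f0 fd c ik.
rewrite cf normr0 pmulr_lle0 ?normr_gt0// => ci; apply/eqP.
by rewrite -normr_le0.
Qed.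

Lemma finite_lattice_embeddable (X Y : banachLatticeType R) (f : nat -> X) k :
  disjoint_family f -> (forall n, (n < k)%N -> f n != 0) ->
  (forall x, exists c : nat -> R, x = \sum_(i < k) c i *: f i) ->
  linearly_embeddable X Y -> lattice_embeddable X Y.
Proof.
move=> fdis fn0 span [T [_ /isomorphism_onto_rangeP[b b0 Tb]]].
(* If [Y] had a basis of [l < k] disjoint vectors, [T] would kill a nontrivial combination of the
   [f i]. *)
have [g gdis gn0] : exists2 g : nat -> Y, disjoint_family g & forall n, (n < k)%N -> g n != 0.
  have [[g gd gn]|[g [l [gd gn gspan]]]] := @disjoint_dichotomy _ Y; first by exists g.
  have [kl|lk] := leqP k l.
    by exists g => // n nk; apply: gn; apply: leq_trans kl.
  have [A AP] := choice (fun n => gspan (T (f n))).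
  have [v [i ik vi] vA] := linear_dependence A lk.
  have Tv : T (\sum_(i < k) v i *: f i) = 0.
    rewrite linear_sum; under eq_bigr => m _ do rewrite linearZ /= AP scaler_sumr.
    rewrite exchange_big big1 //= => j _; under eq_bigr => m _ do rewrite scalerA.
    by rewrite -scaler_suml vA ?scale0r.
  have := Tb (\sum_(i < k) v i *: f i); rewrite Tv normr0 pmulr_rle0// normr_le0 => /eqP.
  by move/(disjoint_coef0 fdis ik (fn0 i ik)) => vi0; rewrite vi0 eqxx in vi.
have [a aP] := choice span.
have [f0 fd] := fdis; have [g0 gd] := gdis.
have aE x (d : nat -> R) i : (i < k)%N -> x = \sum_(j < k) d j *: f j -> a x i = d i.
  move=> ik xd; apply/eqP; rewrite -subr_eq0; apply/eqP.
  apply: (@disjoint_coef0 _ _ k (fun j => a x j - d j) i fdis ik (fn0 i ik)).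
  under eq_bigr => j _ do rewrite scalerBl.
  by rewrite sumrB -aP -xd subrr.
pose z n := if (n < k)%N then `|g n|^-1 *: g n else 0.
have z_norm n : (n < k)%N -> `|z n| = 1.
  move=> nk; rewrite /z nk normrZ ger0_norm ?invr_ge0// mulVf// normr_eq0.
  exact: gn0.
pose S := \sum_(i < k) `|f i|.
have S0 : 0 <= S by rewrite sumr_ge0.
have z0 n : lle 0 (z n).
  by rewrite /z; case: ifP => _; rewrite ?lle_refl// lle_scaler_ge0 ?invr_ge0.
(* If all coordinates were below [(1 + S)^-1] times the norm of [x], the triangle inequality would
   make the norm of [x] smaller than itself. *)
apply: (@c0_embeddable _ _ _ (fun n x => if (n < k)%N then a x n else 0) z
  k%:R (\sum_(i < k) `|f i|^-1) (1 + S)^-1 1).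
- move=> n r x y; case: ifP => nk; last by rewrite mulr0 addr0.
  rewrite (@aE _ (fun i => r * a x i + a y i))//.
  rewrite {1}[x]aP {1}[y]aP scaler_sumr -big_split; apply: eq_bigr => j _ /=.
  by rewrite scalerDl scalerA.
- move=> n x y; case: ifP => nk; last by rewrite maxxx.
  rewrite (@aE _ (fun i => Num.max (a x i) (a y i)))//.
  by rewrite {1}[x]aP {1}[y]aP; exact: disjoint_join.
- by move=> x r r0; exists k => n; rewrite leqNgt => /negPf->; rewrite normr0 ltW.
- move=> n x; case: ifP => nk; last first.
    by rewrite normr0 mulr_ge0// sumr_ge0// => j _; rewrite invr_ge0.
  have fn : 0 < `|f n| by rewrite normr_gt0 fn0.
  apply: (@le_trans _ _ (`|f n|^-1 * `|x|)).
    rewrite ler_pdivlMl// mulrC {2}[x]aP; exact: norm_disjoint_sum_ge.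
  rewrite ler_wpM2r// (bigD1 (Ordinal nk)) //= lerDl sumr_ge0// => j _.
  by rewrite invr_ge0.
- by rewrite invr_gt0; lra.
- exact: ltr01.
- move=> x xn0; apply: contrapT => H; have x1 : 0 < `|x| by rewrite normr_gt0.
  have S1 : 0 < 1 + S by lra.
  suff : `|x| <= (1 + S)^-1 * `|x| * S.
    rewrite -mulrA ler_pdivlMl// mulrDl mul1r mulrC; lra.
  rewrite {1}[x]aP /S mulr_sumr; apply: le_trans (ler_norm_sum _ _ _) _.
  apply: ler_sum => i _; rewrite normrZ ler_wpM2r// leNgt; apply/negP => ai.
  by apply: H; exists i; rewrite ltn_ord z_norm// ltW.
- exact: z0.
- move=> i j ij; have := z0 i; have := z0 j; rewrite /z; case: ifP => _; case: ifP => _.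
  + by rewrite lmeetZ_eq0 ?invr_ge0 ?gd.
  + by move: (_ *: g j) => w; vlat.
  + by move: (_ *: g i) => w; vlat.
  + by vlat.
- move=> N; apply: le_trans (ler_norm_sum _ _ _) _.
  have -> : \sum_(i < N) `|z i| = (minn N k)%:R; last by rewrite ler_nat geq_minr.
  elim: N => [|N IH]; first by rewrite big_ord0 min0n.
  rewrite big_ord_recr /= IH; have [Nk|kN] := ltnP N k.
    by rewrite z_norm// (minn_idPl Nk) natr1.
  by rewrite /z ltnNge kN normr0 addr0 (minn_idPr (leqW kN)).
Qed.

End finite_dimension.

(** * The Banach-Mazur embedding *)

Section switches.
Context {R : realType}.

(** Multiplication by 3 modulo 1 on the outer thirds of the unit interval, hence the shift of
    ternary digits on the Cantor set; the middle third joins the two branches continuously. *)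
Let fold3 (t : R) : R := Num.max (Num.min (3 * t) (2 - 3 * t)) (3 * t - 2).
Definition clamp (t : R) : R := Num.max 0 (Num.min 1 t).

Lemma continuous_clamp : continuous clamp.
Proof.
move=> x; apply: (@continuous_max R R (fun=> 0) (fun y => Num.min 1 y) x); first exact: cvg_cst.
by apply: (@continuous_min R R (fun=> 1) id x); [exact: cvg_cst|exact: cvg_id].
Qed.

Let continuous_fold3 : continuous fold3.
Proof.
have lin a b : continuous (fun t : R => a * t + b).
  by move=> x; apply: cvgD; [apply: cvgM; [exact: cvg_cst|exact: cvg_id]|exact: cvg_cst].
move=> x; apply: (@continuous_max R R (fun t => Num.min (3 * t) (2 - 3 * t)) (fun t => 3 * t - 2)).
  apply: (@continuous_min R R (fun t => 3 * t) (fun t => 2 - 3 * t)).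
    have -> : (fun t : R => 3 * t) = (fun t => 3 * t + 0) by apply/funext => t; rewrite addr0.
    exact: lin.
  have -> : (fun t : R => 2 - 3 * t) = (fun t => (-3) * t + 2).
    by apply/funext => t; rewrite mulNr addrC.
  exact: lin.
exact: lin.
Qed.

Let cantor_point : exists T : (nat -> bool) -> R, forall s,
  0 <= T s <= 1 /\ T s = (2 * (s 0%N)%:R + T (fun n => s n.+1)) / 3.
Proof.
pose u := fix u n (s : nat -> bool) : R :=
  if n is n'.+1 then (2 * (s 0%N)%:R + u n' (fun n => s n.+1)) / 3 else 0.
have b01 (b : bool) : 0 <= (b%:R : R) <= 1 by case: b; rewrite lexx ?ler01.
have u01 n s : 0 <= u n s <= 1.
  elim: n s => [|n IH] s /=; first by rewrite lexx ler01.
  have /andP[h0 h1] := IH (fun n => s n.+1); have /andP[b0 b1] := b01 (s 0%N).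
  by apply/andP; split; lra.
have ud n s : `|u n.+1 s - u n s| <= 1 * 2^-1 ^+ n.
  elim: n s => [|n IH] s.
    rewrite /= subr0 addr0 expr0; have /andP[b0 b1] := b01 (s 0%N).
    by rewrite ger0_norm; lra.
  have -> : u n.+2 s - u n.+1 s = (u n.+1 (fun n => s n.+1) - u n (fun n => s n.+1)) / 3.
    by rewrite /=; lra.
  rewrite normrM (@ger0_norm _ 3^-1) ?invr_ge0// exprS; have := IH (fun n => s n.+1).
  have := normr_ge0 (u n.+1 (fun n => s n.+1) - u n (fun n => s n.+1)); lra.
have [T TP] := choice (fun s => geometric_limit (ud ^~ s)).
exists T => s; have lim_eq (x y : R) : (forall n, `|x - y| <= 4 * 2^-1 ^+ n) -> x = y.
  move=> H; apply/eqP; rewrite -subr_eq0 -normr_eq0 eq_le normr_ge0 andbT.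
  by apply: (@ler_geometric _ _ _ 4) => n; rewrite add0r.
split.
  have Ts := TP s; apply/andP; split.
    apply: (@ler_geometric _ _ _ 2) => n; have := Ts n; have /andP[h0 h1] := u01 n s.
    by rewrite mulr1 ler_norml => /andP[]; lra.
  apply: (@ler_geometric _ _ _ 2) => n; have := Ts n; have /andP[h0 h1] := u01 n s.
  by rewrite mulr1 ler_norml => /andP[]; lra.
apply: lim_eq => n; have := TP s n.+1; have := TP (fun n => s n.+1) n.
rewrite exprS /= !mulr1 !ler_norml => /andP[h1 h2] /andP[h3 h4].
by apply/andP; split; lra.
Qed.

(* Schoenberg's functions: the [k]-th switch reads the [k]-th ternary digit. *)
Lemma switches : exists psi : nat -> R -> R, [/\ forall k, continuous (psi k),
  forall k t, 0 <= psi k t <= 1 &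
  forall s : nat -> bool, exists2 t, 0 <= t <= 1 & forall k, psi k t = (s k)%:R].
Proof.
have [T TP] := cantor_point.
exists (fun k t => clamp (3 * iter k fold3 t - 1)); split=> [k|k t|s].
- have ci : continuous (iter k fold3).
    elim: k => [|k IH] x; first exact: cvg_id.
    by apply: (@continuous_comp _ _ _ (iter k fold3) fold3); [exact: IH|exact: continuous_fold3].
  move=> x; apply: (@continuous_comp _ _ _ (fun t => 3 * iter k fold3 t - 1) clamp).
    by apply: cvgB; [apply: cvgM; [exact: cvg_cst|exact: ci]|exact: cvg_cst].
  exact: continuous_clamp.
- by rewrite /clamp le_max lexx /= ge_max ler01 ge_min lexx.
exists (T s); first by have [] := TP s.
have digit (b : bool) (r : R) : 0 <= r <= 1 ->
    fold3 ((2 * b%:R + r) / 3) = r /\ clamp (3 * ((2 * b%:R + r) / 3) - 1) = b%:R.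
  move=> /andP[r0 r1]; rewrite /fold3 /clamp; case: b; rewrite ?mulr1 ?mulr0 /=;
    by split; case_minmax => *; lra.
have iterT k : iter k fold3 (T s) = T (fun n => s (k + n)%N).
  elim: k => [|k IH] //; rewrite iterS IH; have [_ ->] := TP (fun n => s (k + n)%N).
  have [T01 _] := TP (fun n => s (k + n.+1)%N); rewrite (digit _ _ T01).1.
  by congr T; apply/funext => n; rewrite addnS.
move=> k; rewrite iterT; have [_ ->] := TP (fun n => s (k + n)%N).
by have [T01 _] := TP (fun n => s (k + n.+1)%N); rewrite (digit _ _ T01).2 addn0.
Qed.

End switches.

Lemma norming_functional (R : realType) (X : normedModType R) (x0 : X) :
  exists phi : X -> R, [/\ forall a x y, phi (a *: x + y) = a * phi x + phi y,
    forall x, `|phi x| <= `|x| & phi x0 = `|x0|].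
Proof.
have [||||||phi [phiD phiZ phi_le phi_ge]] := @hahn_banach_cone R X (fun x => `|x|)
    (fun g c => exists2 a, 0 <= a & g = a *: x0 /\ c = a * `|x0|).
- exact: ler_normD.
- by move=> a x a0; rewrite normrZ ger0_norm.
- by exists 0; rewrite // scale0r mul0r.
- move=> g c g' c' [a a0 [-> ->]] [b b0 [-> ->]]; exists (a + b); first exact: addr_ge0.
  by rewrite scalerDl mulrDl.
- move=> a g c a0 [b b0 [-> ->]]; exists (a * b); first by rewrite mulr_ge0// ltW.
  by rewrite scalerA mulrA.
- by move=> g c [a a0 [-> ->]]; rewrite normrZ ger0_norm.
exists phi; split=> [a x y|x|]; first by rewrite phiD phiZ.
  rewrite ler_norml phi_le andbT lerNl -[X in X <= _]mulN1r -phiZ scaleN1r.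
  by rewrite -(normrN x) phi_le.
apply: le_anti; rewrite phi_le; apply: phi_ge; exists 1 => //.
by rewrite scale1r mul1r.
Qed.

(** Vectors are rounded to cells of side [e], and [rep] picks an index in each occupied cell, so
    that the net consists of members of the family; empty cells get the index 0. *)
Lemma finite_net (R : realType) (v : nat -> nat -> R) (n : nat) (B e : R) : 0 < e ->
  (forall j k, (k < n)%N -> `|v j k| <= B) ->
  exists M (rep : nat -> nat), forall j, exists2 i, (i < M)%N &
    forall k, (k < n)%N -> `|v j k - v (rep i) k| <= e.
Proof.
move=> e0 vB; pose N := Num.truncn (2 * B / e).
pose cell j : {ffun 'I_n -> 'I_N.+1} := [ffun k : 'I_n => inord (Num.truncn ((v j k + B) / e))].
pose cells := {: {ffun 'I_n -> 'I_N.+1}}.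
pose rep i := if insub i is Some i' then
  xget 0%N [set j | cell j = enum_val (i' : 'I_#|cells|)] else 0%N.
exists #|cells|, rep => j; exists (enum_rank (cell j)) => // k kn.
rewrite /rep valK enum_rankK; set j' := xget _ _.
have /ffunP/(_ (Ordinal kn)) : cell j' = cell j.
  by apply: (@xgetPex _ 0%N [set j' | cell j' = cell j]); exists j.
have in01 l : 0 <= (v l k + B) / e /\ (v l k + B) / e <= 2 * B / e.
  have := vB l k kn; rewrite ler_norml => /andP[l1 l2].
  by split; [rewrite divr_ge0 ?(ltW e0)//; lra|rewrite ler_pM2r ?invr_gt0//; lra].
rewrite !ffunE /= => /(congr1 val); rewrite /= !inordK; last 2 first.
- by rewrite ltnS; apply: le_truncn; have [] := in01 j.
- by rewrite ltnS; apply: le_truncn; have [] := in01 j'.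
have /truncn_itv/andP[] := (in01 j).1; have /truncn_itv/andP[] := (in01 j').1.
move=> h1 h2 h3 h4 E; rewrite E in h1 h2; move: h1 h2 h3 h4.
rewrite -natr1; set m := _%:R; rewrite !(ler_pdivlMr _ _ e0) !(ltr_pdivrMr _ _ e0) => *.
by rewrite ler_norml; apply/andP; split; lra.
Qed.

Section functional_paths.
Context {R : realType} {X : completeNormedModType R}.
Variables (x : nat -> X) (phi : nat -> X -> R) (psi : nat -> R -> R).
Hypothesis phi_linear : forall j a y z, phi j (a *: y + z) = a * phi j y + phi j z.
Hypothesis phi_le : forall j y, `|phi j y| <= `|y|.
Hypothesis phi_norming : forall j, phi j (x j) = `|x j|.
Hypothesis x_dense : forall y (r : R), 0 < r -> exists n, `|y - x n| < r.
Hypothesis psi_continuous : forall k, continuous (psi k).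
Hypothesis psi01 : forall k t, 0 <= psi k t <= 1.
Hypothesis psi_switch : forall s : nat -> bool,
  exists2 t, 0 <= t <= 1 & forall k, psi k t = (s k)%:R.
Implicit Types F G : R -> X -> R.

(** A path in the dual unit ball, continuous for the weak star topology; it induces an operator of
    norm at most 1 into [C01 R]. *)
Definition functional_path F := [/\ forall t a y z, F t (a *: y + z) = a * F t y + F t z,
  forall t y, `|F t y| <= `|y| & forall y, continuous (F ^~ y)].

(** It is 1 if [F t] and [phi j] are within [4 * 2^-1 ^+ n] at the first [n] points and 0 if they
    differ by more than [8 * 2^-1 ^+ n] at one of them; the ramp in between keeps the path
    continuous. *)
Let gate (n : nat) F (j : nat) t :=
  \prod_(k < n) clamp (2 - `|F t (x k) - phi j (x k)| / (4 * 2^-1 ^+ n)).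
(* Moves [G t] to [phi j] when the switch is on, provided [F t] is close to
   [phi j] at [x 0 .. x (n - 1)]. A stage applies this to all the members of a
   finite net, with the same [F], and so changes little at these points. *)
Let towards (n i j : nat) F G t y :=
  G t y + psi (pickle (n, i)) t * gate n F j t * (phi j y - G t y).
Let stage n (rep : nat -> nat) F M := iteri M (fun i => towards n i (rep i) F) F.

Let p2 n : 0 < 4 * 2^-1 ^+ n :> R.
Proof. by rewrite mulr_gt0// exprn_gt0// invr_gt0. Qed.

Let gate01 n F j t : 0 <= gate n F j t <= 1.
Proof.
rewrite /gate; elim/big_ind: _ => [|a b /andP[a0 a1] /andP[b0 b1]|k _].
- by rewrite ler01 lexx.
- by rewrite mulr_ge0// mulr_ile1.
by rewrite /clamp le_max lexx ge_max ler01 ge_min lexx.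
Qed.

Let gate1 n F j t : (forall k, (k < n)%N -> `|F t (x k) - phi j (x k)| <= 4 * 2^-1 ^+ n) ->
  gate n F j t = 1.
Proof.
move=> H; rewrite /gate big1// => k _; have := H k (ltn_ord k).
rewrite -[leRHS]mul1r -ler_pdivrMr// => h; rewrite /clamp min_l; last by lra.
by rewrite max_r.
Qed.

Let gate_neq0 n F j t k : (k < n)%N -> gate n F j t != 0 ->
  `|F t (x k) - phi j (x k)| <= 8 * 2^-1 ^+ n.
Proof.
move=> kn /prodf_neq0/(_ (Ordinal kn) isT); apply: contraNT; rewrite -ltNge /= => h.
have : 2 * (4 * 2^-1 ^+ n) < `|F t (x k) - phi j (x k)| by lra.
rewrite -ltr_pdivlMr// => {}h; rewrite /clamp min_r; last by lra.
by apply/eqP/max_l; lra.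
Qed.

Let gate_continuous n F j : functional_path F -> continuous (gate n F j).
Proof.
move=> [_ _ Fc]; suff : forall m, continuous (fun t =>
    \prod_(k < m) clamp (2 - `|F t (x k) - phi j (x k)| / (4 * 2^-1 ^+ n))) by apply.
elim=> [|m IH] t.
  under eq_fun do rewrite big_ord0.
  exact: cvg_cst.
under eq_fun do rewrite big_ord_recr /=.
apply: cvgM; first exact: IH.
apply: (@continuous_comp _ _ _ (fun t => 2 - `|F t (x m) - phi j (x m)| / (4 * 2^-1 ^+ n))
  (@clamp R)); last exact: continuous_clamp.
apply: cvgB; first exact: cvg_cst.
apply: cvgM; last exact: cvg_cst.
by apply: cvg_norm; apply: cvgB; [exact: Fc|exact: cvg_cst].
Qed.

Let weight01 (n i : nat) F j t : 0 <= psi (pickle (n, i)) t * gate n F j t <= 1.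
Proof.
have /andP[a0 a1] := psi01 (pickle (n, i)) t; have /andP[b0 b1] := gate01 n F j t.
by rewrite mulr_ge0// mulr_ile1.
Qed.

Let towards_path n i j F G : functional_path F -> functional_path G ->
  functional_path (towards n i j F G).
Proof.
move=> pF [Gl Gn Gc]; split=> [t a y z|t y|y].
- by rewrite /towards Gl phi_linear; ring.
- have /andP[] := weight01 n i F j t; rewrite /towards; move: (psi _ _ * _) => w w0 w1.
  have -> : G t y + w * (phi j y - G t y) = (1 - w) * G t y + w * phi j y by ring.
  have -> : `|y| = (1 - w) * `|y| + w * `|y| by ring.
  rewrite (le_trans (ler_normD _ _))// !normrM (ger0_norm w0) ger0_norm ?subr_ge0//.
  by rewrite lerD// ler_wpM2l// subr_ge0.
move=> t; apply: cvgD; first exact: Gc.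
apply: cvgM; first by apply: cvgM; [exact: psi_continuous|exact: gate_continuous].
by apply: cvgB; [exact: cvg_cst|exact: Gc].
Qed.

Let stage_path n rep F M : functional_path F -> functional_path (stage n rep F M).
Proof. by move=> pF; elim: M => [//|M IH]; exact: towards_path. Qed.

(** Unless its gate is closed, a step averages two values which are both within the bound of
    [F t (x k)]. *)
Let stage_near n rep F M t k : (k < n)%N ->
  `|stage n rep F M t (x k) - F t (x k)| <= 8 * 2^-1 ^+ n.
Proof.
move=> kn; elim: M => [|M IH]; first by rewrite subrr normr0 mulr_ge0// exprn_ge0// invr_ge0.
rewrite /stage iteriS -/(stage n rep F M) /towards.
have [->|gn0] := eqVneq (gate n F (rep M) t) 0; first by rewrite mulr0 mul0r addr0.
have := gate_neq0 kn gn0; have /andP[] := weight01 n M F (rep M) t.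
move: IH; move: (psi _ _ * _) (8 * _) (stage _ _ _ _ _ _) => w b p.
move: (F _ _) (phi _ _) => q c pq w0 w1 qc.
have -> : p + w * (c - p) - q = (1 - w) * (p - q) + w * (c - q) by ring.
have -> : b = (1 - w) * b + w * b by ring.
rewrite (le_trans (ler_normD _ _))// !normrM (ger0_norm w0) ger0_norm ?subr_ge0//.
by rewrite lerD// ler_wpM2l// ?subr_ge0// distrC.
Qed.

Let stage_hit n rep F M t (i0 : nat) : (i0 < M)%N ->
  (forall i : nat, psi (pickle (n, i)) t = (i == i0)%:R) ->
  (forall k, (k < n)%N -> `|F t (x k) - phi (rep i0) (x k)| <= 4 * 2^-1 ^+ n) ->
  forall y, stage n rep F M t y = phi (rep i0) y.
Proof.
move=> iM psit near y.
suff -> m : stage n rep F m t y = if (m <= i0)%N then F t y else phi (rep i0) y.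
  by rewrite leqNgt iM.
elim: m => [//|m IH]; rewrite /stage iteriS -/(stage n rep F m) /towards IH psit.
have [mi0|mi0|->] := ltngtP m i0; rewrite ?mul0r ?addr0//.
by rewrite mul1r gate1// mul1r addrC subrK.
Qed.

Let nets : exists M : nat -> nat, exists rep : nat -> nat -> nat, forall n j,
  exists2 i, (i < M n)%N &
  forall k, (k < n.+1)%N -> `|phi j (x k) - phi (rep n i) (x k)| <= 2^-1 ^+ n.
Proof.
have /choice[f fP] : forall n, exists Mr : nat * (nat -> nat), forall j,
    exists2 i, (i < Mr.1)%N &
    forall k, (k < n.+1)%N -> `|phi j (x k) - phi (Mr.2 i) (x k)| <= 2^-1 ^+ n.
  move=> n; have e0 : 0 < 2^-1 ^+ n :> R by rewrite exprn_gt0// invr_gt0.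
  have [|M [rep H]] := @finite_net R (fun j k => phi j (x k)) n.+1 (\sum_(k < n.+1) `|x k|) _ e0.
    move=> j k kn; apply: le_trans (phi_le _ _) _.
    by rewrite (bigD1 (Ordinal kn))//= lerDl sumr_ge0.
  by exists (M, rep).
by exists (fun n => (f n).1), (fun n => (f n).2).
Qed.

Let functional_pathP F : functional_path F ->
  exists U : {linear X -> C01 R}, forall y t, 0 <= t <= 1 -> C01_at (U y) t = F t y.
Proof.
move=> [Fl _ Fc]; have [|U UF] := @linear_of _ _ _ (fun y => sval (C01_mk (Fc y))).
  move=> a y z; apply: C01_ext => t t01; rewrite C01_atD C01_atZ.
  by rewrite !(svalP (C01_mk _)).
by exists U => y t t01; rewrite UF (svalP (C01_mk _)).
Qed.

(** All paths stay in the dual unit ball, which gives one inequality. For the other, [y] is close to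
    some [x j], and a suitable parameter [t] leads the paths to [phi j], which norms [x j]. *)
Lemma path_limit_isometry : exists T : {linear X -> C01 R}, forall y, `|T y| = `|y|.
Proof.
have [M [rep net]] := nets.
pose P := fix P n := if n is n'.+1 then stage n' (rep n') (P n') (M n') else fun _ _ => 0.
have P_path n : functional_path (P n).
  elim: n => [|n IH]; last exact: stage_path.
  split=> [*|*|y]; first by rewrite mulr0 addr0.
    by rewrite normr0.
  by move=> t; exact: cvg_cst.
have [U UP] := choice (fun n => functional_pathP (P_path n)).
have U_le n y : `|U n y| <= `|y|.
  by apply: C01_at_norm_le => t t01; rewrite UP//; have [_ + _] := P_path n; apply.
have UB n y z : `|U n y - U n z| <= `|y - z| by rewrite -linearB.
(* The changes [8 * 2^-1 ^+ m] for [m >= n] sum to [16 * 2^-1 ^+ n]. *)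
have U_near k n m : (k < n)%N -> `|U (n + m)%N (x k) - U n (x k)| <= 16 * 2^-1 ^+ n.
  move=> kn; suff H : `|U (n + m)%N (x k) - U n (x k)| <=
      16 * 2^-1 ^+ n - 16 * 2^-1 ^+ (n + m).
    by apply: le_trans H _; rewrite gerBl mulr_ge0// exprn_ge0// invr_ge0.
  elim: m => [|m IH]; first by rewrite addn0 !subrr normr0.
  have : `|U (n + m.+1)%N (x k) - U (n + m)%N (x k)| <= 8 * 2^-1 ^+ (n + m).
    apply: C01_at_norm_le => t t01; rewrite C01_atD C01_atN !UP// addnS.
    by apply: stage_near; rewrite (leq_trans kn)// leq_addr.
  have := ler_distD (U (n + m)%N (x k)) (U (n + m.+1)%N (x k)) (U n (x k)).
  rewrite addnS exprS; move: IH; lra.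
have limU y : exists l, forall e : R, 0 < e ->
    exists n, forall m, (n <= m)%N -> `|l - U m y| <= e.
  apply: cauchy_limit => e e0; have e4 : 0 < e / 4 by lra.
  have [k ky] := x_dense y e4; have e32 : 0 < e / 32 by lra.
  have [n ne] := expr2V_small e32; exists (n + k.+1)%N => m nm.
  have kn : (k < n + k.+1)%N by rewrite addnS ltnS leq_addl.
  have := U_near k _ (m - (n + k.+1))%N kn; rewrite subnKC// => h.
  have h1 := UB m y (x k); have h2 := UB (n + k.+1)%N (x k) y.
  have h3 := ler_distD (U m (x k)) (U m y) (U (n + k.+1)%N y).
  have h4 := ler_distD (U (n + k.+1)%N (x k)) (U m (x k)) (U (n + k.+1)%N y).
  have : 2^-1 ^+ (n + k.+1) <= 2^-1 ^+ n :> R.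
    by rewrite exprD ler_piMr// ?exprn_ge0 ?invr_ge0// exprn_ile1 ?invr_ge0// invf_le1// ler1n.
  rewrite [`|x k - y|]distrC in h2; lra.
have [V VP] := choice limU.
have Vlin a y z : V (a *: y + z) = a *: V y + V z.
  apply/eqP; rewrite -subr_eq0 -normr_eq0 eq_le normr_ge0 andbT.
  apply/ler_addgt0Pr => e e0; rewrite add0r; have a2 : 0 < `|a| + 2 by rewrite ltr_wpDl.
  have e1 := divr_gt0 e0 a2.
  have [n1 h1] := VP (a *: y + z) _ e1; have [n2 h2] := VP y _ e1; have [n3 h3] := VP z _ e1.
  pose n := (n1 + n2 + n3)%N.
  have {}h1 : `|V (a *: y + z) - U n (a *: y + z)| <= e / (`|a| + 2).
    by apply: h1; rewrite /n -addnA leq_addr.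
  have {}h2 : `|V y - U n y| <= e / (`|a| + 2).
    by apply: h2; rewrite /n addnAC leq_addl.
  have {}h3 : `|V z - U n z| <= e / (`|a| + 2) by apply: h3; rewrite /n leq_addl.
  have -> : V (a *: y + z) - (a *: V y + V z) = (V (a *: y + z) - U n (a *: y + z))
      - (a *: (V y - U n y) + (V z - U n z)).
    by rewrite (linearD (U n)) (linearZZ (U n)) scalerBr addrACA -opprD opprB addrA subrK.
  rewrite (le_trans (ler_normB _ _))//.
  have -> : e = e / (`|a| + 2) + (`|a| * (e / (`|a| + 2)) + e / (`|a| + 2)).
    by field; rewrite lt0r_neq0.
  rewrite lerD// (le_trans (ler_normD _ _))// lerD// normrZ ler_wpM2l//.
have [T TV] := linear_of Vlin.
exists T => y; rewrite TV; apply/le_anti/andP; split.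
  apply/ler_addgt0Pr => e e0; have [n h] := VP y e e0; have := h n (leqnn n).
  have := ler_distD (U n y) (V y) 0; rewrite !subr0; have := U_le n y; lra.
apply/ler_addgt0Pr => e e0; have e5 : 0 < e / 5 by lra.
have [j yj] := x_dense y e5.
(* The members [rep n (i n)] of the successive nets approach [phi j], and the switches are set so as
   to pass through all of them. *)
have /choice[i iP] : forall n, exists i, (i < M n)%N /\
    forall k, (k < n.+1)%N -> `|phi j (x k) - phi (rep n i) (x k)| <= 2^-1 ^+ n.
  by move=> n; have [i iM H] := net n j; exists i.
have [t t01 psit] := psi_switch (fun m => if unpickle m is Some (n, i') then i' == i n else false).
have hit n z : P n.+1 t z = phi (rep n (i n)) z.
  have psin m i' : psi (pickle (m, i')) t = (i' == i m)%:R by rewrite psit pickleK.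
  elim: n z => [|n IH] z; apply: (stage_hit (iP _).1 (psin _)) => //.
  (* Consecutive members are within [2^-1 ^+ n] and [2^-1 ^+ n.+1] of [phi j] at these points, hence
     close enough to each other for the gate to be fully open. *)
  move=> k kn; suff : `|P n.+1 t (x k) - phi (rep n.+1 (i n.+1)) (x k)| <= 4 * 2^-1 ^+ n.+1 by [].
  rewrite IH; have [_ /(_ k kn) h1] := iP n.
  have [_ /(_ k (leqW kn)) h2] := iP n.+1.
  have := ler_distD (phi j (x k)) (phi (rep n (i n)) (x k)) (phi (rep n.+1 (i n.+1)) (x k)).
  rewrite [`|_ - phi j _|]distrC; move: h2; have := p2 n; rewrite exprS; lra.
have [N1 h1] := VP y _ e5; have [N2 h2] := expr2V_small e5.
pose n := (N1 + N2 + j)%N.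
have {}h1 := h1 n.+1 (leqW (leq_trans (leq_addr N2 N1) (leq_addr j _))).
have {}h2 : 2^-1 ^+ n <= e / 5.
  apply: le_trans h2; rewrite /n addnAC addnC exprD ler_piMr// ?exprn_ge0 ?invr_ge0//.
  by rewrite exprn_ile1 ?invr_ge0// invf_le1// ler1n.
have h3 := UB n.+1 y (x j).
have h4 : `|phi (rep n (i n)) (x j)| <= `|U n.+1 (x j)|.
  by rewrite -hit -UP//; exact: C01_at_norm.
have [_ /(_ j) h5] := iP n; rewrite ltnS leq_addl in h5; have {}h5 := h5 isT.
rewrite phi_norming in h5.
have := ler_distD (x j) y 0; rewrite !subr0 => h6.
have := ler_distD (phi (rep n (i n)) (x j)) `|x j| 0; rewrite !subr0 normr_id => h7.
have := ler_distD (U n.+1 y) (U n.+1 (x j)) 0; rewrite !subr0 => h8.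
have := ler_distD (V y) (U n.+1 y) 0; rewrite !subr0 => h9.
rewrite [`|U n.+1 (x j) - _|]distrC in h8; rewrite [`|U n.+1 y - V y|]distrC in h9.
lra.
Qed.

End functional_paths.

Lemma banach_mazur (R : realType) (X : completeNormedModType R) :
  separable_space X -> linearly_embeddable X (C01 R).
Proof.
move=> /dense_sequence[x x_dense]; have [psi [psic psi01 psis]] := @switches R.
have /choice[phi phiP] j := norming_functional (x j).
have [|||T TE] := @path_limit_isometry _ _ x phi psi _ _ _ x_dense psic psi01 psis.
- by move=> j; have [] := phiP j.
- by move=> j; have [] := phiP j.
- by move=> j; have [] := phiP j.
exists T; split; first by exists 1 => y; rewrite TE mul1r.
by apply/isomorphism_onto_rangeP; exists 1 => // y; rewrite TE mul1r.
Qed.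

Lemma lattice_embeddable_of_linear (R : realType) (X Y : banachLatticeType R) :
  separable_space X -> lattice_embeddable X (C01 R) ->
  linearly_embeddable X Y -> lattice_embeddable X Y.
Proof.
move=> sX XC XY; have [Phi [/bounded_operatorP[C C0 PhiC] /isomorphism_onto_rangeP[c c0 Phic]
  [Phij _]]] := XC.
have [[e [h [d gp]]]|ratio] := ratio_constant_or_good_pair C0 PhiC Phij.
  apply: lattice_embeddable_trans XC _; apply: C01_linearly_embeddable.
  apply: linearly_embeddable_trans XY; apply: lattice_embeddable_linear.
  exact: good_pair_embeddable gp.
have [[f fdis fn0]|[f [k [fdis fn0 span]]]] := @disjoint_dichotomy _ X.
  exact: (infinite_lattice_embeddable C0 PhiC c0 Phic Phij fdis fn0 sX ratio XY).
exact: finite_lattice_embeddable fdis fn0 span XY.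
Qed.

Theorem theoremB (R : realType) (X : banachLatticeType R)
    (X_separable : separable_space X) :
  (forall Y : banachLatticeType R,
     linearly_embeddable X Y <-> lattice_embeddable X Y)
  <-> lattice_embeddable X (C01 R).
Proof.
split=> [H|XC Y]; first by apply/H; exact: banach_mazur.
split; last exact: lattice_embeddable_linear.
exact: lattice_embeddable_of_linear.
Qed.
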